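(* Let $n\in\mathbb N$. Assume that $\mu:(0,1)\to[0,\infty)$ is a non-increasing function satisfying $$\sup_{\lambda\in(0,1)}\lambda\,(\mu(\lambda))^{\frac14}=\infty .$$ Given a positive even integer $s$, there is a smooth function $m$ on $\mathbb R^{2n}$ with bounded partial derivatives of all orders which fulfills $$|\{x\in\mathbb R^{2n}: |(I-\Delta)^{\frac s2}m(x)|>\lambda\}|\le\mu(\lambda),\quad \lambda\in(0,1),$$ and for which the associated bilinear multiplier operator $T_m$ is unbounded from $L^2(\mathbb R^n)\times L^2(\mathbb R^n)$ to $L^1(\mathbb R^n)$.
   Context: $|E|$ denotes Lebesgue measure of a set $E$. The Fourier transform on $\mathbb R^d$ is $\widehat f(\xi)=\int_{\mathbb R^d} f(x)e^{-2\pi i x\cdot\xi}\,dx$. The operator $(I-\Delta)^{s/2}$ on $\mathbb R^{2n}$ is defined by $[(I-\Delta)^{s/2}f]^{\wedge}(\xi)=(1+4\pi^2|\xi|^2)^{s/2}\widehat f(\xi)$ (for even $s$ it is a differential operator). ''Bounded partial derivatives of all orders'' includes order zero, i.e. $m$ itself is bounded. For a bounded function $m$ on $\mathbb R^{2n}=\mathbb R^n\times\mathbb R^n$, the bilinear multiplier operator $T_m$ is defined for Schwartz functions $f,g$ on $\mathbb R^n$ by $$T_m(f,g)(x)=\int_{\mathbb R^n}\int_{\mathbb R^n}m(\xi,\eta)\widehat f(\xi)\widehat g(\eta)e^{2\pi i x\cdot(\xi+\eta)}\,d\xi\,d\eta,\quad x\in\mathbb R^n.$$ $T_m$ is unbounded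 from $L^2(\mathbb R^n)\times L^2(\mathbb R^n)$ to $L^1(\mathbb R^n)$ if there is no finite constant $C$ with $\|T_m(f,g)\|_{L^1}\le C\|f\|_{L^2}\|g\|_{L^2}$ for all Schwartz functions $f,g$ on $\mathbb R^n$. *)

(* Defs.v *)
From HB Require Import structures.
From mathcomp Require Import all_boot all_order all_algebra.
From mathcomp Require Import complex.
From mathcomp Require Import all_classical all_reals all_analysis.

Set Implicit Arguments.
Unset Strict Implicit.
Unset Printing Implicit Defensive.
Import Order.TTheory GRing.Theory Num.Theory.
Import numFieldNormedType.Exports.
Import ComplexField.Normc.

Local Open Scope classical_set_scope.
Local Open Scope complex_scope.
Local Open Scope ring_scope.

(** R^d is the normed space ['rV[R]_d] of row vectors (the norm of the library
    is the sup norm, so the squared Euclidean norm is written out below as [normsq]),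
    and R^n x R^n = R^(2n) is ['rV[R]_(n + n)] through [row_mx]. *)

(** The library puts no sigma-algebra on row vectors; we use the one generated
    by the coordinates. *)
Definition rV_display : measure_display -> measure_display.
Proof. exact. Qed.

Section measurable_rV.
Context {d : measure_display} {T : sigmaRingType d}.
Variable n : nat.

Definition rV_coord (i : 'I_n) (x : 'rV[T]_n) : T := x ord0 i.

Let rV_set0 : g_sigma_preimage rV_coord set0.
Proof. exact: sigma_algebra0. Qed.

Let rV_setC A : g_sigma_preimage rV_coord A -> g_sigma_preimage rV_coord (~` A).
Proof. exact: sigma_algebraC. Qed.

Let rV_bigcup (F : (set 'rV[T]_n)^nat) :
  (forall i, g_sigma_preimage rV_coord (F i)) ->
  g_sigma_preimage rV_coord (\bigcup_i (F i)).
Proof. exact: sigma_algebra_bigcup. Qed.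

HB.instance Definition _ := @isMeasurable.Build (rV_display d)
  'rV[T]_n (g_sigma_preimage rV_coord) rV_set0 rV_setC rV_bigcup.

End measurable_rV.

Lemma measurable_rV_coord (d : measure_display) (T : sigmaRingType d) n
  (i : 'I_n) : measurable_fun [set: 'rV[T]_n] (@rV_coord _ _ n i).
Proof.
move=> _ Y mY; rewrite setTI; apply: sub_sigma_algebra => /=.
rewrite -bigcup_seq/=; exists i => /=; first by rewrite mem_index_enum.
by exists Y => //; rewrite setTI.
Qed.

Lemma measurable_fun_rVP (d1 d2 : measure_display) (T1 : measurableType d1)
    (T2 : measurableType d2) n (f : T1 -> 'rV[T2]_n) :
  (forall i, measurable_fun [set: T1] (fun x => f x ord0 i)) ->
  measurable_fun [set: T1] f.
Proof.
move=> mf _ A mA; rewrite setTI.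
have: g_sigma_preimage (fun i => @rV_coord _ T2 n i \o f) `<=`
      (@measurable _ T1).
  apply: smallest_sub; first exact: sigma_algebra_measurable.
  rewrite -bigcup_seq; apply: bigcup_sub => i _ B [C mC <-].
  exact: mf.
by apply; rewrite g_sigma_preimage_comp; exists A => //; rewrite setTI.
Qed.

(** Lebesgue measure on R^n, as the iterated product of the Lebesgue measure of
    the line. *)
Section lebesgue_rV.
Variable R : realType.

Definition cons_rV n (p : measurableTypeR R * 'rV[R]_n) : 'rV[R]_n.+1 :=
  row_mx (p.1)%:M p.2.

Lemma cons_rV_ord0 n (p : measurableTypeR R * 'rV[R]_n) :
  cons_rV p ord0 ord0 = p.1.
Proof.
have -> : (ord0 : 'I_n.+1) = lshift n (ord0 : 'I_1) by exact/val_inj.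
by rewrite /cons_rV (@row_mxEl R 1 1 n) mxE.
Qed.

Lemma cons_rV_lift n (p : measurableTypeR R * 'rV[R]_n) (i : 'I_n) :
  cons_rV p ord0 (lift ord0 i) = p.2 ord0 i.
Proof.
have -> : lift ord0 i = rshift 1 i by exact/val_inj.
by rewrite /cons_rV (@row_mxEr R 1 1 n).
Qed.

Lemma measurable_cons_rV n : measurable_fun [set: _] (@cons_rV n).
Proof.
apply: measurable_fun_rVP => i.
have [j ->|->] := unliftP ord0 i.
  under eq_fun do rewrite cons_rV_lift.
  exact: (measurableT_comp (@measurable_rV_coord _ R n j) measurable_snd).
under eq_fun do rewrite cons_rV_ord0.
exact: measurable_fst.
Qed.

Section step.
Variables (n : nat) (mu : {sigma_finite_measure set 'rV[R]_n -> \bar R}).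

Definition cons_measure : set 'rV[R]_n.+1 -> \bar R :=
  pushforward (@lebesgue_measure R \x mu)%E (@cons_rV n).

Let cons_measure0 : cons_measure set0 = 0%E.
Proof. by rewrite /cons_measure /pushforward preimage_set0 measure0. Qed.

Let cons_measure_ge0 A : (0 <= cons_measure A)%E.
Proof. by rewrite /cons_measure /pushforward measure_ge0. Qed.

Let cons_measure_sigma_additive : semi_sigma_additive cons_measure.
Proof.
move=> F mF tF mUF.
have mpre A : measurable A -> measurable (@cons_rV n @^-1` A).
  by move=> mA; rewrite -[X in measurable X]setTI; exact: measurable_cons_rV.
rewrite /cons_measure /pushforward preimage_bigcup.
apply: measure_semi_sigma_additive.
- by move=> k; exact: mpre.
- apply/trivIsetP => /= i j _ _ ij; rewrite -preimage_setI.
  by move/trivIsetP : tF => /(_ _ _ _ _ ij) ->//; rewrite preimage_set0.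
- by rewrite -preimage_bigcup; exact: mpre.
Qed.

HB.instance Definition _ := isMeasure.Build _ _ _ cons_measure
  cons_measure0 cons_measure_ge0 cons_measure_sigma_additive.

Let cons_measure_sigma_finite : sigma_finite setT cons_measure.
Proof.
have /sigma_finiteP[F [TF ndF Foo]] := sigma_finiteT (@lebesgue_measure R).
have /sigma_finiteP[G [TG ndG Goo]] := sigma_finiteT mu.
exists (fun k => [set x : 'rV[R]_n.+1 |
    F k (x ord0 ord0) /\ G k (\row_i x ord0 (lift ord0 i))]).
  rewrite predeqE => x; split=> // _.
  have /(_ (x ord0 ord0)) : forall y, (\bigcup_k F k) y by rewrite -TF.
  have /(_ (\row_i x ord0 (lift ord0 i))) : forall y, (\bigcup_k G k) y.
    by rewrite -TG.
  move=> [k _ Gk] [l _ Fl]; exists (maxn k l) => //; split.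
  - by move: Fl; exact/subsetPset/ndF/leq_maxr.
  - by move: Gk; exact/subsetPset/ndG/leq_maxl.
move=> k; have [mF Fk] := Foo k; have [mG Gk] := Goo k; split.
  apply: measurableI.
  - rewrite -[X in measurable X]setTI.
    exact: (@measurable_rV_coord _ R n.+1 ord0).
  - rewrite -[X in measurable X]setTI.
    have: measurable_fun [set: 'rV[R]_n.+1]
        (fun x => \row_(i < n) x ord0 (lift ord0 i)).
      apply: measurable_fun_rVP => i; under eq_fun do rewrite mxE.
      exact: measurable_rV_coord.
    by apply.
rewrite /cons_measure /pushforward.
rewrite (_ : _ @^-1` _ = F k `*` G k); last first.
  rewrite predeqE => -[a v] /=; rewrite cons_rV_ord0.
  rewrite (_ : \row_i _ = v)//.
  by apply/rowP => i; rewrite mxE cons_rV_lift.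
by rewrite product_measure1E// lte_mul_pinfty// ge0_fin_numE.
Qed.

HB.instance Definition _ := Measure_isSigmaFinite.Build _ _ _ cons_measure
  cons_measure_sigma_finite.

End step.

Fixpoint leb n : {sigma_finite_measure set 'rV[R]_n -> \bar R} :=
  match n with
  | 0%N => \d_(0 : 'rV[R]_0)
  | n'.+1 => cons_measure (leb n')
  end.

End lebesgue_rV.

Lemma measurable_box (R : realType) n (A : 'I_n -> set R) :
  (forall i, measurable (A i)) ->
  measurable [set x : 'rV[R]_n | forall i, A i (x ord0 i)].
Proof.
move=> mA; rewrite (_ : mkset _ =
    \bigcap_(i in [set: 'I_n]) (@rV_coord _ R n i @^-1` A i)); last first.
  by rewrite predeqE => x; split => [H i _|H i]; exact: H.
apply: fin_bigcap_measurable => // i _.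
by rewrite -[X in measurable X]setTI; exact: measurable_rV_coord.
Qed.

Lemma leb_box (R : realType) n (A : 'I_n -> set R) :
  (forall i, measurable (A i)) ->
  leb R n [set x | forall i, A i (x ord0 i)] =
  (\prod_(i < n) (@lebesgue_measure R) (A i))%E.
Proof.
elim: n A => [A _|n IH A mA].
  by rewrite big_ord0 /= diracE mem_set//= => -[].
rewrite big_ord_recl /= /cons_measure /pushforward.
rewrite (_ : _ @^-1` _ = A ord0 `*`
    [set x : 'rV[R]_n | forall i, A (lift ord0 i) (x ord0 i)]); last first.
  rewrite predeqE => -[a v] /=; split=> [H|[H0 H] i].
    split; first by have := H ord0; rewrite cons_rV_ord0.
    by move=> i; have := H (lift ord0 i); rewrite cons_rV_lift.
  by have [j ->|->] := unliftP ord0 i; rewrite ?cons_rV_lift ?cons_rV_ord0.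
rewrite product_measure1E.
- by congr (_ * _)%E; exact: (IH (fun i => A (lift ord0 i))).
- exact: mA.
- exact: (measurable_box (fun i => mA (lift ord0 i))).
Qed.

Section Cvalued.
Variable R : realType.
Local Notation C := R[i].

Section on_Rd.
Variable d : nat.
Implicit Types (f u v : 'rV[R]_d -> C) (x xi : 'rV[R]_d).

Definition dot x xi : R := \sum_(i < d) x ord0 i * xi ord0 i.
Definition normsq x : R := dot x x.

(** [pderiv [:: i1; ...; ik] f] is d_i1 ... d_ik f. *)
Definition pderiv (s : seq 'I_d) (f : 'rV[R]_d -> R) : 'rV[R]_d -> R :=
  foldr (fun i g x => 'D_(delta_mx ord0 i) g x) f s.

Definition smooth (f : 'rV[R]_d -> R) : Prop :=
  forall s : seq 'I_d, continuous (pderiv s f) /\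
    forall i x, derivable (pderiv s f) x (delta_mx ord0 i).

Definition continuousC f : Prop :=
  continuous (fun x => complex.Re (f x)) /\ continuous (fun x => complex.Im (f x)).

Definition smoothC f : Prop :=
  smooth (fun x => complex.Re (f x)) /\ smooth (fun x => complex.Im (f x)).

Definition pderivC (s : seq 'I_d) f x : C :=
  pderiv s (fun y => complex.Re (f y)) x +i* pderiv s (fun y => complex.Im (f y)) x.

Definition bounded_pderivs f : Prop :=
  forall s : seq 'I_d, exists M : R, forall x, normc (pderivC s f x) <= M.

Definition schwartz f : Prop :=
  smoothC f /\
  forall (a : 'I_d -> nat) (s : seq 'I_d), exists M : R, forall x,
    `|\prod_(i < d) x ord0 i ^+ a i| * normc (pderivC s f x) <= M.

Definition Cint f : C :=
  (\int[leb R d]_x complex.Re (f x)) +i* (\int[leb R d]_x complex.Im (f x)).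

Definition cis (t : R) : C := cos t +i* sin t.

Definition fourier f xi : C :=
  Cint (fun x => f x * cis (- (2 * pi * dot x xi))).

(** Continuous functions of at most polynomial growth; we identify them with the
    tempered distributions that they represent. *)
Definition temperate f : Prop :=
  continuousC f /\
  exists (c : R) (k : nat), forall x, normc (f x) <= c * (1 + normsq x) ^+ k.

(** [bessel s u v] says that v = (I - Delta)^(s/2) u, that is, that
    v^ = (1 + 4 pi^2 |xi|^2)^(s/2) u^ as tempered distributions, the Fourier
    transform of a tempered distribution w being phi |-> w(phi^). As v is
    continuous, it is determined at every point by u. *)
Definition bessel (s : R) u v : Prop :=
  [/\ temperate u, temperate v &
   forall phi, schwartz phi ->
     Cint (fun x => v x * fourier phi x) =
     Cint (fun x => u x * fourier
       (fun xi => ((1 + 4 * pi ^+ 2 * normsq xi) `^ (s / 2))%:C * phi xi) x)].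

Definition Lpnorm (p : \bar R) f : \bar R :=
  'N[leb R d]_p[EFin \o (@normc R \o f)]%E.

End on_Rd.

Definition bilinear_multiplier n (m : 'rV[R]_(n + n) -> C)
    (f g : 'rV[R]_n -> C) (x : 'rV[R]_n) : C :=
  Cint (fun xi => Cint (fun eta =>
    m (row_mx xi eta) * fourier f xi * fourier g eta
      * cis (2 * pi * dot x (xi + eta)))).

Definition unbounded_L2L2L1 n (m : 'rV[R]_(n + n) -> C) : Prop :=
  ~ exists c : R, forall f g : 'rV[R]_n -> C, schwartz f -> schwartz g ->
    (Lpnorm 1 (bilinear_multiplier m f g)
       <= c%:E * Lpnorm 2%:E f * Lpnorm 2%:E g)%E.

End Cvalued.

(* Main.v *)
From HB Require Import structures.
Require Import Defs.
From mathcomp Require Import all_boot all_order all_algebra.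
From mathcomp Require Import complex.
From mathcomp Require Import ring lra zify.
From mathcomp Require Import all_classical all_reals all_analysis measurable_realfun.

Set Implicit Arguments.
Unset Strict Implicit.
Unset Printing Implicit Defensive.
Import Order.TTheory GRing.Theory Num.Theory.
Import numFieldNormedType.Exports.
Import ComplexField.Normc.

Local Open Scope classical_set_scope.
Local Open Scope complex_scope.
Local Open Scope ring_scope.

(** At scale [K], let [a_K] be the Rudin-Shapiro signs and let [m] carry, around the points
    whose first xi- and eta-coordinates are [2^K + i] and [2^K + j] with [i, j < 2^K], and whose
    other coordinates vanish, a bump with coefficient [w_K a_(K+1)(i + j) a_K(i) a_K(j)].  Where
    [(I - Delta)^(s/2) m] exceeds [lambda], we are at a scale with [w_K > lambda], hence in a box
    of measure at most [4^(K+1)]; so [w_K] may be a multiple of the supremum of the levels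
    [lambda] with [4^(K+1) <= mu(lambda)], and the hypothesis on [mu] says that [w_K^2 2^K] is
    unbounded.

    Test [T_m] on [f = g], a wave packet whose Fourier transform is the sum over [i] of [a_K(i)]
    times a bump at [(2^K + i) e_0].  The bound [2^((K+1)/2)] for Rudin-Shapiro polynomials makes
    the product of the [L^2] norms O([2^K]).  The signs [a_K(i) a_K(j)] cancel in [T_m(f, f)],
    whose modulus is a fixed profile times that of the sum over [k, l < 2^K] of
    [w_K a_(K+1)(k + l) exp(2 pi i (k + l) x_0)]; pairing the latter with the polynomial of the
    [a_(K+1)] shows that its [L^1] norm on the unit interval is at least
    [w_K 4^K / 2^((K+2)/2)].  Boundedness of [T_m] would therefore bound [w_K 2^(K/2)].

    The Fourier transform of a real function [f] is handled through [trig c f xi], the integral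
    of [f x * cos (2 pi x.xi + c)], with [c = 0] for the cosine and [c = - pi / 2] for the sine
    transform.  Fourier inversion is only needed up to a positive constant, for which any even
    Schwartz function [rho] with [rho 0 <> 0] can replace the Gaussian. *)

(** * Integration on row vectors *)

(** For even [s] the operator is differential, hence local: it keeps each bump inside its own
    support and costs only a constant depending on [s] and the bump. A nonlocal potential would
    spread the bumps. The scales are nested near the origin: every scale whose coefficients are too
    large for [lambda] fits in one box of measure [mu(lambda)], so no measures are summed over
    scales. Starting block [K] at [2^K] makes the blocks disjoint, and a packet at scale [K] meets
    only its own block.

    A block costs measure of order [4^K], from the two active coordinates, and gains [2^(K/2)], the
    quotient of [4^K / 2^(K/2)] by [2^K]. With [4^K] comparable to [mu(lambda)] the quantity
    [lambda 2^(K/2)] becomes [lambda mu(lambda)^(1/4)], which explains the exponent in the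
    hypothesis.

    The flatness of Rudin-Shapiro polynomials enters twice: for the packet it gives a pointwise
    majorant, from which the [L^2] bound is read off; for the dual polynomial it turns the pairing
    into an [L^1] lower bound. The sign attached to a pair depends on [i + j] because the
    frequencies of the two packets add up. *)

Section lebesgue_rV_theory.
Variable R : realType.

(** In the sup norm an open set is the countable union of the cubes with rational centre and
    half-side [1 / k.+1] that it contains, and these lie in the coordinate sigma-algebra. This links
    that sigma-algebra to the topology. *)
Lemma open_measurable_rV d (U : set 'rV[R]_d) : open U -> measurable U.
Proof.
move=> oU.
pose B (p : 'rV[rat]_d * nat) : set 'rV[R]_d :=
  [set x | forall i, `|x ord0 i - ratr (p.1 ord0 i)| < p.2.+1%:R^-1].
pose D := [set p | B p `<=` U].
rewrite (_ : U = \bigcup_(p in D) B p).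
  rewrite bigcup_mkcond; apply: countable_bigcupT_measurable => [|p].
    exact: countableP.
  case: ifP => // _.
  apply: (measurable_box (A := fun i => [set t | `|t - ratr (p.1 ord0 i)| < p.2.+1%:R^-1])) => i.
  rewrite (_ : mkset _ = ball (ratr (p.1 ord0 i) : R) p.2.+1%:R^-1); last first.
    by apply/seteqP; split => t /=; rewrite /ball /= distrC.
  exact: measurable_ball.
rewrite predeqE => x; split=> [Ux|[p Dp]]; last exact: Dp.
have /nbhs_ballP[e /= e0 eU] : nbhs x U by exact: open_nbhs_nbhs.
have e2 : 0 < e / 2 by rewrite divr_gt0.
near \oo => k.
have k0 : (0 : R) < k.+1%:R^-1 by rewrite invr_gt0 ltr0n.
have ke : k.+1%:R^-1 + k.+1%:R^-1 < e.
  rewrite [e]splitr ltrD//; near: k; exact: (near_infty_natSinv_lt (PosNum e2)).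
have [q hq] : exists q : 'rV[rat]_d, forall i, `|x ord0 i - ratr (q ord0 i)| < k.+1%:R^-1.
  have /choice[q hq] : forall i : 'I_d, exists q : rat, `|x ord0 i - ratr q| < k.+1%:R^-1.
    move=> i; have /rat_in_itvoo[q] : x ord0 i - k.+1%:R^-1 < x ord0 i + k.+1%:R^-1.
      by rewrite ltrD2l gt0_cp.
    rewrite in_itv/= => /andP[q1 q2]; exists q.
    by rewrite ltr_distlC q1 q2.
  by exists (\row_i q i) => i; rewrite mxE.
exists (q, k) => //= y hy; apply: eU; split=> // i j; rewrite ord1 /ball/=.
rewrite (le_lt_trans (ler_distD (ratr (q ord0 j)) _ _))//.
by apply: lt_trans ke; rewrite ltrD// distrC.
Unshelve. all: by end_near. Qed.

Lemma continuous_measurable_rV d (f : 'rV[R]_d -> R) :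
  continuous f -> measurable_fun setT f.
Proof.
move=> cf; apply: (measurability _ (RGenOpens.measurableE R)) => //.
move=> _ [_ [a [b ->] <-]]; rewrite setTI; apply: open_measurable_rV.
by apply: open_comp; [move=> x _; exact: cf|exact: interval_open].
Qed.

End lebesgue_rV_theory.

(** * Affine changes of variables *)

Section affine_change_of_variables.
Variable R : realType.
Local Notation leb1 := (@lebesgue_measure R).
Local Open Scope ereal_scope.

Definition affine1 (a v : R) (x : R) : measurableTypeR R := (a * x + v)%R.

Lemma measurable_affine1 a v : measurable_fun [set: measurableTypeR R] (affine1 a v).
Proof. by apply: measurable_funD => //; exact: measurable_funM. Qed.

HB.instance Definition _ a v :=
  isMeasurableFun.Build _ _ _ _ (affine1 a v) (measurable_affine1 a v).

(** By uniqueness of Lebesgue measure it is enough to compare half-open intervals, whose preimages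
    under [affine1 a v] are [a] times shorter. *)
Lemma lebesgue_measure_affine_gt0 (a v : R) (A : set R) : (0 < a)%R -> measurable A ->
  a%:E * pushforward leb1 (affine1 a v) A = leb1 A.
Proof.
move=> a0 mA; have a0' := ltW a0.
apply/esym.
apply: (@lebesgue_measure_unique _ (mscale (NngNum a0') (pushforward leb1 (affine1 a v)))); last exact: mA.
  exact: measurable_affine1.
move=> ? _ [[b c] _ <-].
change (leb1 `]b, c]%classic = a%:E * leb1 (affine1 a v @^-1` `]b, c]%classic)).
rewrite (_ : _ @^-1` _ = `](b - v) / a, (c - v) / a]%classic)%R; last first.
  apply/seteqP; split => x /=; rewrite !in_itv/= /affine1 ltr_pdivrMr// ler_pdivlMr//;
  by rewrite ltrBlDr lerBrDr ![(x * _)%R]mulrC.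
rewrite !lebesgue_measure_itv/= !lte_fin ltr_pM2r ?invr_gt0// ltrD2r.
case: ifP => bc; last by rewrite mule0.
rewrite -!EFinD -EFinM; congr EFin; field; exact: lt0r_neq0.
Qed.

Lemma ge0_integral_affine1 (a v : R) (F : R -> \bar R) : a != 0%R ->
  measurable_fun setT F -> (forall x, 0 <= F x) ->
  \int[leb1]_x F (a * x + v)%R = (`|a|^-1)%:E * \int[leb1]_x F x.
Proof.
(* A negative slope is reduced to a positive one by the reflection invariance of Lebesgue
   measure. *)
wlog a0 : a F / (0 < a)%R.
  move=> H an0; case: (ltgtP 0%R a) an0 => // a0 _ mF F0.
    by apply: H => //; exact: lt0r_neq0.
  have := H (- a)%R (fun x => F x).
  rewrite oppr_gt0 oppr_eq0 normrN => /(_ a0 (ltr0_neq0 a0) mF F0) <-.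
  have mF' : measurable_fun setT (fun x => F (- a * x + v)%R).
    apply: measurableT_comp => //; exact: measurable_affine1.
  have -> : \int[leb1]_x F (- a * x + v)%R =
     \int[pushforward leb1 (-%R : _ -> measurableTypeR R)]_x F (- a * x + v)%R.
    apply: eq_measure_integral => //= A mA AS; exact/esym/lebesgue_measureN.
  rewrite ge0_integral_pushforward//=.
  by apply: eq_integral => x _ /=; rewrite mulrNN.
move=> _ mF F0; rewrite gtr0_norm//.
have -> : \int[leb1]_x F x = \int[mscale (NngNum (ltW a0)) (pushforward leb1 (affine1 a v))]_x F x.
  - by move=> ?; apply: eq_measure_integral => A mA _; exact/esym/lebesgue_measure_affine_gt0.
  - exact: measurable_affine1.
move=> ?; rewrite ge0_integral_mscale//= muleA -EFinM mulVf ?lt0r_neq0// mul1e.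
by rewrite ge0_integral_pushforward.
Qed.

Lemma cons_rVE n (t : R) (x : 'rV[R]_n) k i :
  cons_rV (t, x) k i = if unlift ord0 i is Some j then x ord0 j else t.
Proof.
by rewrite (ord1 k); case: unliftP => [j|] ->; rewrite ?cons_rV_ord0 ?cons_rV_lift.
Qed.

Lemma leb_tonelli n (F : 'rV[R]_n.+1 -> \bar R) : measurable_fun setT F -> (forall x, 0 <= F x) ->
  \int[leb R n.+1]_x F x = \int[leb1]_t \int[leb R n]_x F (cons_rV (t, x)).
Proof.
move=> mF F0.
rewrite [LHS](_ : _ = \int[pushforward (leb1 \x leb R n) (@cons_rV R n)]_x F x)//.
rewrite ge0_integral_pushforward//=; last exact: measurable_cons_rV.
rewrite fubini_tonelli1//; apply: measurableT_comp => //; exact: measurable_cons_rV.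
Qed.

Lemma measurable_affine_rV n a (v : 'rV[R]_n) :
  measurable_fun [set: 'rV[R]_n] (fun x => a *: x + v)%R.
Proof.
apply: measurable_fun_rVP => i; under eq_fun do rewrite !mxE.
apply: measurable_funD => //; apply: measurable_funM => //; exact: measurable_rV_coord.
Qed.

(** Tonelli splits off one coordinate at a time, and each contributes a factor [1 / |a|]. *)
Lemma ge0_integral_affine n (a : R) (v : 'rV[R]_n) (F : 'rV[R]_n -> \bar R) : a != 0%R ->
  measurable_fun setT F -> (forall x, 0 <= F x) ->
  \int[leb R n]_x F (a *: x + v)%R = (`|a| ^- n)%:E * \int[leb R n]_x F x.
Proof.
move=> a0; elim: n v F => [|n IH] v F mF F0.
  rewrite expr0 invr1 mul1e; apply: eq_integral => x _; congr (F _).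
  by apply/rowP => -[].
have mFc t : measurable_fun setT (fun x => F (cons_rV (t, x))).
  apply: measurableT_comp => //.
  apply: measurableT_comp; first exact: measurable_cons_rV.
  exact: measurable_pair1.
rewrite !leb_tonelli//; last by apply: measurableT_comp => //; exact: measurable_affine_rV.
pose v' : 'rV[R]_n := (\row_i v ord0 (lift ord0 i))%R.
transitivity (\int[leb1]_t (\int[leb R n]_x F (cons_rV ((a * t + v ord0 ord0)%R, (a *: x + v')%R)))).
  apply: eq_integral => t _; apply: eq_integral => x _; congr F.
  apply/rowP => i; rewrite [RHS]cons_rVE mxE [X in (X + _)%R]mxE cons_rVE.
  by case: unliftP => [j|] ->//; rewrite !mxE.
under eq_integral => t _ do rewrite (IH v' (fun x => F (cons_rV ((a * t + v ord0 ord0)%R, x))))//.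
have mG : measurable_fun setT (fun t => \int[leb R n]_x F (cons_rV (t, x))).
  apply: (@measurable_fun_fubini_tonelli_F _ _ _ _ _ _ (fun p => F (cons_rV p))) => //.
  by apply: measurableT_comp => //; exact: measurable_cons_rV.
rewrite (@ge0_integral_affine1 a (v ord0 ord0) (fun t => (`|a| ^- n)%:E * \int[leb R n]_x F (cons_rV (t, x))))//.
- rewrite ge0_integralZl ?lee_fin//.
  + by rewrite muleA -EFinM exprS invfM.
  + by move=> t _; exact: integral_ge0.
- by apply: measurable_funeM.
- by move=> t; rewrite mule_ge0 ?lee_fin ?integral_ge0.
Qed.

End affine_change_of_variables.

(** * Tensor products and an integrable weight *)

Section weight.
Variable R : realType.
Local Notation leb1 := (@lebesgue_measure R).

(** Serves both for the integrability of [weight] and for the [L^1] lower bound on the operator,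
    where the minorant is a tensor product. *)
Lemma ge0_integral_tensor n (g : 'I_n -> R -> R) :
  (forall i, measurable_fun setT (g i)) -> (forall i t, 0 <= g i t) ->
  (\int[leb R n]_x (\prod_i g i (x ord0 i))%:E = \prod_i \int[leb1]_t (g i t)%:E)%E.
Proof.
elim: n g => [|n IH] g mg g0.
  rewrite big_ord0 /= (_ : (fun x => _) = cst 1%E).
    by rewrite integral_cst//= diracE mem_set// mul1e.
  by apply/funext => x; rewrite big_ord0.
have mtens k (h : 'I_k -> R -> R) : (forall i, measurable_fun setT (h i)) ->
    measurable_fun [set: 'rV[R]_k] (fun x => \prod_i h i (x ord0 i)).
  move=> mh; apply: measurable_prod => i _.
  by apply: measurableT_comp => //; exact: measurable_rV_coord.
rewrite leb_tonelli//; first last.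
- by move=> x; rewrite lee_fin prodr_ge0.
- by apply/measurable_EFinP; exact: mtens.
rewrite [RHS]big_ord_recl -(IH (fun i => g (lift ord0 i)))//.
rewrite -ge0_integralZr//; first last.
- by apply: integral_ge0 => x _; rewrite lee_fin prodr_ge0.
- by move=> t _; rewrite lee_fin.
- by apply/measurable_EFinP; exact: mg.
apply: eq_integral => t _; rewrite -ge0_integralZl//; first last.
- by rewrite lee_fin.
- by move=> x _; rewrite lee_fin prodr_ge0.
- by apply/measurable_EFinP; exact: (mtens _ (fun i => g (lift ord0 i))).
apply: eq_integral => x _; rewrite -EFinM; congr EFin.
rewrite big_ord_recl cons_rV_ord0/=; congr (_ * _).
by apply: eq_bigr => i _; rewrite cons_rV_lift.
Qed.

Lemma oneDsqrV_gt0 (t : R) : 0 < (oneDsqr t)^-1.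
Proof. by rewrite invr_gt0 (lt_le_trans ltr01)// oneDsqr_ge1. Qed.

(** A standard majorant for Schwartz functions. The product form makes it integrable by one-variable
    integrals and stable, up to a constant, under unit shifts of one coordinate. *)
Definition weight d (x : 'rV[R]_d) : R := \prod_i (oneDsqr (x ord0 i))^-1.

Lemma weight_gt0 d (x : 'rV[R]_d) : 0 < weight x.
Proof. by apply: prodr_gt0 => i _; exact: oneDsqrV_gt0. Qed.

Lemma measurable_weight d : measurable_fun setT (@weight d).
Proof.
apply: measurable_prod => i _.
apply: (@measurableT_comp _ _ _ _ _ _ (fun t : R => (oneDsqr t)^-1)).
  by apply: continuous_measurable_fun; exact: continuous_oneDsqrV.
exact: measurable_rV_coord.
Qed.

Lemma integral_oneDsqrV_lty : (\int[leb1]_x ((oneDsqr x)^-1)%:E < +oo)%E.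
Proof.
rewrite (@ge0_symfun_integralT _ (fun x => (oneDsqr x)^-1)).
- rewrite (_ : [set x : R | 0 <= x] = `[0, +oo[%classic); last first.
    by apply/seteqP; split => x /=; rewrite in_itv/= andbT.
  by rewrite integral0y_oneDsqr -EFinM ltry.
- by move=> x; exact/ltW/oneDsqrV_gt0.
- exact: continuous_oneDsqrV.
- by move=> x /=; rewrite /oneDsqr sqrrN.
Qed.

Lemma integrable_weight d : (leb R d).-integrable setT (EFin \o @weight d).
Proof.
apply/integrableP; split; first by apply/measurable_EFinP; exact: measurable_weight.
under eq_integral do rewrite /= ger0_norm ?(ltW (weight_gt0 _))//.
rewrite (ge0_integral_tensor (g := fun _ t => (oneDsqr t)^-1)).
- rewrite -ge0_fin_numE; last first.
    apply: prode_ge0 => i _; apply: integral_ge0 => t _.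
    by rewrite lee_fin (ltW (oneDsqrV_gt0 _)).
  elim/big_ind: _ => // [x y xoo yoo|i _]; first by rewrite fin_numM.
  rewrite ge0_fin_numE ?integral_oneDsqrV_lty//.
  by apply: integral_ge0 => t _; rewrite lee_fin (ltW (oneDsqrV_gt0 _)).
- by move=> i; apply: continuous_measurable_fun; exact: continuous_oneDsqrV.
- by move=> i t; exact/ltW/oneDsqrV_gt0.
Qed.

End weight.

(** * Dominated convergence and Fubini for real integrals *)

Section Rintegral_theory.
Context d (T : measurableType d) (R : realType) (mu : {measure set T -> \bar R}).

Lemma Rintegral_dominated_cvg (f_ : nat -> T -> R) (f g : T -> R) :
  (forall n, measurable_fun setT (f_ n)) -> mu.-integrable setT (EFin \o g) ->
  (forall x, f_ ^~ x @ \oo --> f x) -> (forall n x, `|f_ n x| <= g x) ->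
  (fun n => \int[mu]_x f_ n x) @ \oo --> \int[mu]_x f x.
Proof.
move=> mf_ ig ff fg.
have mf : measurable_fun setT f by apply: (measurable_fun_cvg mf_) => x _; exact: ff.
have [|||||iF _] := @dominated_convergence _ T R mu setT measurableT
  (fun n => EFin \o f_ n) (EFin \o f) (EFin \o g).
- by move=> n; exact/measurable_EFinP.
- exact/measurable_EFinP.
- by apply: aeW => x _ /=; apply: cvg_EFin; [exact: nearW|exact: ff].
- exact: ig.
- by apply: aeW => x n _ /=; rewrite lee_fin.
move=> cF; apply: fine_cvg.
rewrite /Rintegral fineK; first exact: cF.
exact: (integrable_fin_num _ iF).
Qed.

Lemma integrable_le (f g : T -> R) : measurable_fun setT f ->
  mu.-integrable setT (EFin \o g) -> (forall x, `|f x| <= g x) ->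
  mu.-integrable setT (EFin \o f).
Proof.
move=> mf ig fg; apply: le_integrable ig => //; first exact/measurable_EFinP.
by move=> x _; rewrite /= lee_fin (le_trans (fg x))// ler_norm.
Qed.

Lemma integrable_Mbounded (f k : T -> R) (C : R) : measurable_fun setT k ->
  (forall x, `|k x| <= C) ->
  mu.-integrable setT (EFin \o f) -> mu.-integrable setT (EFin \o (fun x => f x * k x)).
Proof.
move=> mk kC fi.
have mf : measurable_fun setT f by apply/measurable_EFinP; case/integrableP: fi.
apply: (@integrable_le _ (fun x => C * `|f x|)).
- exact: measurable_funM.
- rewrite (_ : _ \o _ = fun x => C%:E * (abse \o (EFin \o f)) x)%E; last by apply/funext.
  by apply: integrableZl => //; exact: integrable_norm.
- by move=> x; rewrite normrM mulrC ler_wpM2r.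
Qed.

End Rintegral_theory.

Section Rintegral_kernel.
Context d1 d2 (T1 : measurableType d1) (T2 : measurableType d2) (R : realType).
Variables (m1 : {sigma_finite_measure set T1 -> \bar R}).
Variables (m2 : {sigma_finite_measure set T2 -> \bar R}).
Variable (K : T1 -> T2 -> R).
Hypothesis mK : measurable_fun setT (fun z : T1 * T2 => K z.1 z.2).
Hypothesis K1 : forall x y, `|K x y| <= 1.

Lemma measurable_Rintegral_kernel (b : T2 -> R) : measurable_fun setT b ->
  measurable_fun setT (fun x => \int[m2]_y (b y * K x y)).
Proof.
move=> mb; rewrite /Rintegral.
have mbK : measurable_fun setT (fun z : T1 * T2 => (b z.2 * K z.1 z.2)%:E).
  apply/measurable_EFinP/measurable_funM => //.
  exact: (measurableT_comp mb measurable_snd).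
apply: (measurableT_comp (fine_measurable measurableT)).
under eq_fun do rewrite integralE.
apply: emeasurable_funB.
- apply: (measurable_fun_fubini_tonelli_F (fun z : T1 * T2 => (((fun y => (b y * K z.1 y)%:E)^\+)%E z.2))) => //.
  by apply: eq_measurable_fun (measurable_funepos mbK) => z _; rewrite !funeposE.
- apply: (measurable_fun_fubini_tonelli_F (fun z : T1 * T2 => (((fun y => (b y * K z.1 y)%:E)^\-)%E z.2))) => //.
  by apply: eq_measurable_fun (measurable_funeneg mbK) => z _; rewrite !funenegE.
Qed.

(** The kernel is bounded by 1, so the double integrand is dominated by [|a x| * |b y|] and Fubini
    applies. *)
Lemma Rintegral_kernelC (a : T1 -> R) (b : T2 -> R) :
  m1.-integrable setT (EFin \o a) -> m2.-integrable setT (EFin \o b) ->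
  \int[m1]_x (a x * \int[m2]_y (b y * K x y)) =
  \int[m2]_y (b y * \int[m1]_x (a x * K x y)).
Proof.
move=> ia ib.
have ma : measurable_fun setT a by apply/measurable_EFinP; case/integrableP: ia.
have mb : measurable_fun setT b by apply/measurable_EFinP; case/integrableP: ib.
have mKx x : measurable_fun setT (K x).
  exact: (measurableT_comp mK (measurable_pair1 x)).
have mKy y : measurable_fun setT (K ^~ y).
  exact: (measurableT_comp mK (measurable_pair2 y)).
pose f (z : T1 * T2) : \bar R := (a z.1 * (b z.2 * K z.1 z.2))%:E.
have mf : measurable_fun setT f.
  apply/measurable_EFinP; apply: measurable_funM.
    exact: (measurableT_comp ma measurable_fst).
  by apply: measurable_funM => //; exact: (measurableT_comp mb measurable_snd).
have if_ : (m1 \x m2)%E.-integrable setT f.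
  apply/integrable12ltyP => //.
  apply: (@le_lt_trans _ _ (\int[m1]_x (`|a x|%:E * \int[m2]_y `|b y|%:E))%E).
    apply: ge0_le_integral => //.
    - by move=> x _; exact: integral_ge0.
    - apply: (measurable_fun_fubini_tonelli_F (fun z => `|f z|)%E) => //.
      exact: measurableT_comp.
    - apply: emeasurable_funM => //; apply/measurable_EFinP; exact: measurableT_comp.
    - move=> x _; rewrite -ge0_integralZl//; first last.
      + by apply/measurable_EFinP; exact: measurableT_comp.
      apply: ge0_le_integral => //.
      + do 2 apply: measurableT_comp => //; exact: measurable_funM.
      + apply/measurable_EFinP; apply: measurable_funM => //; exact: measurableT_comp.
      + move=> y _; rewrite /f/= lee_fin !normrM ler_wpM2l// ler_piMr//.
  rewrite ge0_integralZr//; first last.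
  - exact: integral_ge0.
  - by apply/measurable_EFinP; exact: measurableT_comp.
  case/integrableP: ia => _ ia; case/integrableP: ib => _ ib.
  rewrite lte_mul_pinfty//; first exact: integral_ge0.
  by rewrite ge0_fin_numE//; exact: integral_ge0.
have ibK x : m2.-integrable setT (EFin \o (fun y => b y * K x y)).
  exact: integrable_Mbounded.
have iaK y : m1.-integrable setT (EFin \o (fun x => a x * K x y)).
  exact: (integrable_Mbounded (mKy y) (K1 ^~ y)).
rewrite /Rintegral; congr fine.
transitivity (\int[m1]_x \int[m2]_y f (x, y))%E.
  apply: eq_integral => x _; rewrite /f/=.
  rewrite EFinM fineK; last exact: (integrable_fin_num _ (ibK x)).
  by rewrite -(integralZl measurableT (ibK x)).
rewrite (Fubini if_); apply: eq_integral => y _; rewrite /f/=.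
rewrite EFinM fineK; last exact: (integrable_fin_num _ (iaK y)).
rewrite -(integralZl measurableT (iaK y)).
by apply: eq_integral => x _; rewrite mulrCA.
Qed.

End Rintegral_kernel.

(** * Smooth and Schwartz real functions *)

Section calculus_rV.
Variables (R : realType) (d : nat).
Implicit Types (f g : 'rV[R]_d -> R) (x v : 'rV[R]_d).

Local Notation e_ i := (delta_mx ord0 i : 'rV[R]_d).
Local Notation dd i f := (fun x => 'D_(e_ i) f x).

(** The difference quotient along a line is that of a function of one real variable; this carries
    one-variable calculus over to directional derivatives. *)
Lemma line_diffquot f x v (t : R) :
  (fun h : R => h^-1 *: (f ((h *: (1 : R) + t) *: v + x) - f (t *: v + x))) =
  (fun h : R => h^-1 *: (f (h *: v + (t *: v + x)) - f (t *: v + x))).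
Proof.
apply/funext => h; rewrite (_ : h *: (1 : R) = h) ?scalerDl ?addrA//.
exact: mulr1.
Qed.

Lemma derive_line f x v (t : R) :
  'D_1 (fun s : R => f (s *: v + x)) t = 'D_v f (t *: v + x).
Proof. by rewrite /derive/= -line_diffquot. Qed.

Lemma derivable_line f x v (t : R) :
  derivable (fun s : R => f (s *: v + x)) t 1 <-> derivable f (t *: v + x) v.
Proof. by rewrite /derivable/= -line_diffquot. Qed.

Lemma is_derive_line f x v (df : R) :
  is_derive (0 : R) 1 (fun s : R => f (s *: v + x)) df -> is_derive x v f df.
Proof.
move=> H; apply: DeriveDef.
  by have [/derivable_line + _] := H; rewrite scale0r add0r.
by rewrite -(@derive_val _ _ _ _ _ _ _ H) derive_line scale0r add0r.
Qed.

Lemma line_is_derive f x v (t : R) : derivable f (t *: v + x) v ->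
  is_derive t 1 (fun s : R => f (s *: v + x)) ('D_v f (t *: v + x)).
Proof. by move=> H; apply: DeriveDef; [exact/derivable_line|exact: derive_line]. Qed.

Lemma pderiv_cat s t f : pderiv (s ++ t) f = pderiv s (pderiv t f).
Proof. by rewrite /pderiv foldr_cat. Qed.

Lemma pderiv_near s f g x : (\forall y \near x, f y = g y) ->
  \forall y \near x, pderiv s f y = pderiv s g y.
Proof.
elim: s f g => [//|i s IH] f g fg /=.
have := nbhs_interior (IH _ _ fg); apply: filterS => y; exact: near_eq_derive.
Qed.

(** Replaces an induction over derivative sequences: smoothness follows once a function lies in some
    class closed under partial derivatives. *)
Lemma smooth_coind (P : ('rV[R]_d -> R) -> Prop) :
  (forall f, P f -> continuous f /\
     forall i, (forall x, derivable f x (e_ i)) /\ P (dd i f)) ->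
  forall f, P f -> smooth f.
Proof.
move=> HP f Pf.
have Ps s : P (pderiv s f).
  by elim: s => [//|i s IH]; exact: ((HP _ IH).2 i).2.
by move=> s; split => [|i x]; [exact: (HP _ (Ps s)).1|exact: ((HP _ (Ps s)).2 i).1].
Qed.

Lemma smooth_pderiv s f : smooth f -> smooth (pderiv s f).
Proof. by move=> sf t; rewrite -pderiv_cat; exact: sf. Qed.

Lemma smooth_continuous f : smooth f -> continuous f.
Proof. by move=> /(_ [::])[]. Qed.

Lemma smooth_derivable f i x : smooth f -> derivable f x (e_ i).
Proof. by move=> /(_ [::])[_]. Qed.

Lemma smooth_dd f i : smooth f -> smooth (dd i f).
Proof. exact: (@smooth_pderiv [:: i]). Qed.

(** Meant for the multiplier, which near each point coincides with a multiple of a single bump. *)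
Lemma smooth_local f : (forall x, exists2 g, smooth g & \forall y \near x, f y = g y) ->
  smooth f.
Proof.
move=> H; apply: (@smooth_coind (fun f =>
  forall x, exists2 g, smooth g & \forall y \near x, f y = g y)) => // {H}f H; split.
  move=> x; have [g sg fg] := H x.
  rewrite /continuous_at (nbhs_singleton fg).
  have fg' : \forall y \near x, g y = f y by apply: filterS fg => y ->.
  exact: cvg_trans (near_eq_cvg fg') (smooth_continuous sg (x := x)).
move=> i; split=> x; have [g sg fg] := H x.
  have fg' : \forall y \near x, g y = f y by apply: filterS fg => y ->.
  have := @near_eq_derivable R 'rV[R]_d R g f x (e_ i) fg'; apply.
  exact: smooth_derivable.
exists (dd i g); first exact: smooth_dd.
exact: (@pderiv_near [:: i]).
Qed.

Lemma continuousD_rV f g : continuous f -> continuous g -> continuous (fun x => f x + g x).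
Proof. by move=> cf cg x; exact: (cvgD (cf x) (cg x)). Qed.

Lemma continuousM_rV f g : continuous f -> continuous g -> continuous (fun x => f x * g x).
Proof. by move=> cf cg x; exact: (cvgM (cf x) (cg x)). Qed.

Lemma continuous_cst_rV (c : R) : continuous (fun _ : 'rV[R]_d => c).
Proof. by move=> x; exact: cst_continuous. Qed.

Lemma smoothZD (a : R) f g : smooth f -> smooth g -> smooth (fun x => a * f x + g x).
Proof.
move=> sf sg; apply: (@smooth_coind (fun h =>
  exists f g, [/\ smooth f, smooth g & h = fun x => a * f x + g x])); last by exists f, g.
move=> _ [{sf}f [{sg}g [sf sg ->]]]; split.
  apply: continuousD_rV; last exact: smooth_continuous.
  by apply: continuousM_rV; [exact: continuous_cst_rV|exact: smooth_continuous].
move=> i; have df x : derivable f x (e_ i) by exact: smooth_derivable.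
have dg x : derivable g x (e_ i) by exact: smooth_derivable.
split=> [x|].
  by apply: derivableD => //; exact: derivableZ.
exists (dd i f), (dd i g); split; [exact: smooth_dd..|].
by apply/funext => x; rewrite deriveD// ?deriveZ//; exact: derivableZ.
Qed.

Lemma is_derive_coord i j x : is_derive x (e_ i) (fun y => y ord0 j) (i == j)%:R.
Proof.
apply: is_derive_line.
rewrite (_ : (fun s : R => _) = (fun s => (i == j)%:R * s + x ord0 j)); last first.
  by apply/funext => s; rewrite !mxE eqxx/= mulrC eq_sym.
by apply: is_derive_eq; rewrite /GRing.scale/= addr0 mulr1.
Qed.

Lemma smooth_cst (c : R) : smooth (fun _ : 'rV[R]_d => c).
Proof.
apply: (@smooth_coind (fun h => exists c, h = fun=> c)); last by exists c.
move=> _ [{}c ->]; split=> [|i]; first exact: continuous_cst_rV.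
split=> [x|]; first exact: derivable_cst.
by exists 0; apply/funext => x; rewrite derive_cst.
Qed.

Lemma derivable_coordM f i j x : derivable f x (e_ i) ->
  derivable (fun x => x ord0 j * f x) x (e_ i).
Proof.
move=> df; have [dc _] := is_derive_coord i j x.
exact: (@derivableM R 'rV[R]_d (fun x => x ord0 j) f x (e_ i) dc df).
Qed.

Lemma derive_coordM f i j x : derivable f x (e_ i) ->
  'D_(e_ i) (fun x => x ord0 j * f x) x = x ord0 j * 'D_(e_ i) f x + (i == j)%:R * f x.
Proof.
move=> df; have [dc <-] := is_derive_coord i j x.
rewrite (@deriveM R 'rV[R]_d (fun x => x ord0 j) f x (e_ i) dc df).
by rewrite /GRing.scale/= [f x * _]mulrC.
Qed.

Lemma derivableD_rV f g x v : derivable f x v -> derivable g x v ->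
  derivable (fun x => f x + g x) x v.
Proof. by move=> df dg; exact: (@derivableD R 'rV[R]_d R f g x v df dg). Qed.

Lemma deriveD_rV f g x v : derivable f x v -> derivable g x v ->
  'D_v (fun x => f x + g x) x = 'D_v f x + 'D_v g x.
Proof. by move=> df dg; exact: (@deriveD R 'rV[R]_d R f g x v df dg). Qed.

End calculus_rV.

Section real_schwartz.
Variables (R : realType) (d : nat).
Implicit Types (f g : 'rV[R]_d -> R) (x v : 'rV[R]_d).

Local Notation e_ i := (delta_mx ord0 i : 'rV[R]_d).
Local Notation dd i f := (fun x => 'D_(e_ i) f x).

Definition decays f := forall a : 'I_d -> nat, exists M : R, forall x,
  `|\prod_(i < d) x ord0 i ^+ a i| * `|f x| <= M.

Definition schwartzR f := smooth f /\ forall s, decays (pderiv s f).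

Lemma decaysZD (c : R) f g : decays f -> decays g -> decays (fun x => c * f x + g x).
Proof.
move=> df dg a; have [M fM] := df a; have [N gN] := dg a.
exists (`|c| * M + N) => x; apply: le_trans (lerD (ler_wpM2l (normr_ge0 c) (fM x)) (gN x)).
by rewrite mulrCA -mulrDr ler_wpM2l// -normrM ler_normD.
Qed.

Lemma decays_coordM j f : decays f -> decays (fun x => x ord0 j * f x).
Proof.
move=> df a; have [M fM] := df (fun i => ((i == j) + a i)%N).
exists M => x; apply: le_trans (fM x).
rewrite normrM mulrA -normrM ler_wpM2r// (bigD1 j)//= [in leRHS](bigD1 j)//= eqxx.
rewrite exprD expr1 mulrC mulrA le_eqVlt; apply/orP; left; apply/eqP.
by congr (`|_ * _|); apply: eq_bigr => i /negPf ->.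
Qed.

(** Expanding the product of the [1 + x_i ^ 2] over subsets of the coordinates leaves finitely many
    monomials, each controlled by [decays]. *)
Lemma decays_weight f : decays f -> exists C : R, forall x, `|f x| <= C * weight x.
Proof.
move=> df; have /choice[M HM] := fun J : {set 'I_d} => df (fun i => if i \in J then 2%N else 0%N).
exists (\sum_J M J) => x.
rewrite /weight prodfV ler_pdivlMr; last first.
  by rewrite prodr_gt0// => i _; rewrite -invr_gt0 oneDsqrV_gt0.
rewrite (eq_bigr (fun i => x ord0 i ^+ 2 + 1)); last by move=> i _; rewrite /oneDsqr addrC.
rewrite bigA_distr mulr_sumr; apply: ler_sum => J _.
apply: le_trans (HM J x); rewrite mulrC ler_wpM2r//.
rewrite (eq_bigr (fun i => x ord0 i ^+ (if i \in J then 2 else 0)%N)) ?ler_norm//.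
by move=> i _; case: ifP.
Qed.

Lemma schwartzR_coind (P : ('rV[R]_d -> R) -> Prop) :
  (forall f, P f -> [/\ continuous f, decays f &
     forall i, (forall x, derivable f x (e_ i)) /\ P (dd i f)]) ->
  forall f, P f -> schwartzR f.
Proof.
move=> HP f Pf.
have Ps s : P (pderiv s f).
  by elim: s => [|i s IH]; [exact: Pf|have [_ _ /(_ i)[]] := HP _ IH].
split; last by move=> s; have [] := HP _ (Ps s).
apply: smooth_coind Pf => {Ps}f /HP[cf _ H]; by split.
Qed.

Lemma schwartzR_continuous f : schwartzR f -> continuous f.
Proof. by case=> sf _; exact: smooth_continuous. Qed.

Lemma schwartzR_decays f : schwartzR f -> decays f.
Proof. by case=> _ /(_ [::]). Qed.

Lemma schwartzR_derivable f i x : schwartzR f -> derivable f x (e_ i).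
Proof. by case=> sf _; exact: smooth_derivable. Qed.

Lemma schwartzR_pderiv s f : schwartzR f -> schwartzR (pderiv s f).
Proof.
by case=> sf df; split => [|t]; [exact: smooth_pderiv|rewrite -pderiv_cat; exact: df].
Qed.

Lemma schwartzR_dd i f : schwartzR f -> schwartzR (dd i f).
Proof. exact: (@schwartzR_pderiv [:: i]). Qed.

Lemma decays0 : decays (fun=> 0).
Proof. by move=> a; exists 0 => x; rewrite normr0 mulr0. Qed.

Lemma continuousZD (c : R) f g : continuous f -> continuous g ->
  continuous (fun x => c * f x + g x).
Proof.
by move=> cf cg; apply: continuousD_rV cg; apply: continuousM_rV cf; exact: continuous_cst_rV.
Qed.

Lemma derivableZ_rV (c : R) f x v : derivable f x v -> derivable (fun x => c * f x) x v.
Proof. by move=> df; exact: (@derivableZ R 'rV[R]_d R f c x v df). Qed.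

Lemma deriveZ_rV (c : R) f x v : derivable f x v -> 'D_v (fun x => c * f x) x = c * 'D_v f x.
Proof. by move=> df; exact: (@deriveZ R 'rV[R]_d R f c x v df). Qed.

Lemma derivableZD_rV (c : R) f g x v : derivable f x v -> derivable g x v ->
  derivable (fun x => c * f x + g x) x v.
Proof. by move=> df dg; apply: derivableD_rV dg; exact: derivableZ_rV. Qed.

Lemma deriveZD_rV (c : R) f g x v : derivable f x v -> derivable g x v ->
  'D_v (fun x => c * f x + g x) x = c * 'D_v f x + 'D_v g x.
Proof.
by move=> df dg; rewrite (deriveD_rV (derivableZ_rV df) dg) deriveZ_rV.
Qed.

Lemma schwartzR_ZD (c : R) f g : schwartzR f -> schwartzR g ->
  schwartzR (fun x => c * f x + g x).
Proof.
move=> Sf Sg; apply: (@schwartzR_coind (fun h =>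
  exists f g, [/\ schwartzR f, schwartzR g & h = fun x => c * f x + g x])); last by exists f, g.
move=> _ [{Sf}f [{Sg}g [Sf Sg ->]]]; split.
- exact: (continuousZD (schwartzR_continuous Sf) (schwartzR_continuous Sg)).
- exact: (decaysZD _ (schwartzR_decays Sf) (schwartzR_decays Sg)).
move=> i; have df x : derivable f x (e_ i) by exact: schwartzR_derivable.
have dg x : derivable g x (e_ i) by exact: schwartzR_derivable.
split=> [x|]; first exact: (derivableZD_rV (df x) (dg x)).
exists (dd i f), (dd i g); split; [exact: schwartzR_dd..|].
apply/funext => x; apply: deriveZD_rV; [exact: df|exact: dg].
Qed.

Lemma schwartzR0 : schwartzR (fun=> 0).
Proof.
apply: (@schwartzR_coind (fun h => h = fun=> 0)) => // _ ->.
split; [exact: continuous_cst_rV|exact: decays0|].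
by move=> i; split => [x|]; [exact: derivable_cst|apply/funext => x; exact: derive_cst].
Qed.

Lemma schwartzR_coordM j f : schwartzR f -> schwartzR (fun x => x ord0 j * f x).
Proof.
(* Differentiating [x_j * f] creates the extra term [(i == j) * f], so the class closed under
   derivatives has to contain an additional Schwartz summand [g]. *)
move=> Sf; apply: (@schwartzR_coind (fun h =>
  exists f g, [/\ schwartzR f, schwartzR g & h = fun x => 1 * (x ord0 j * f x) + g x])); last first.
  exists f, (fun=> 0); split; [exact: Sf|exact: schwartzR0|].
  by apply/funext => x; rewrite addr0 mul1r.
move=> _ [{Sf}f [g [Sf Sg ->]]]; split.
- apply: continuousZD; last exact: schwartzR_continuous.
  by apply: continuousM_rV; [exact: coord_continuous|exact: schwartzR_continuous].
- exact: (decaysZD _ (decays_coordM _ (schwartzR_decays Sf)) (schwartzR_decays Sg)).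
move=> i; have df x : derivable f x (e_ i) by exact: schwartzR_derivable.
have dcf x : derivable (fun x => x ord0 j * f x) x (e_ i) by exact: derivable_coordM.
have dg x : derivable g x (e_ i) by exact: schwartzR_derivable.
split=> [x|]; first exact: (derivableZD_rV (dcf x) (dg x)).
exists (dd i f), (fun x => (i == j)%:R * f x + dd i g x); split.
- exact: schwartzR_dd.
- exact: (schwartzR_ZD _ Sf (schwartzR_dd i Sg)).
- apply/funext => x; rewrite deriveZD_rV; [|exact: dcf|exact: dg].
  by rewrite derive_coordM ?mul1r ?addrA; last exact: df.
Qed.

Lemma schwartzR_sum (I : Type) (r : seq I) (c : I -> R) (F : I -> 'rV[R]_d -> R) :
  (forall i, schwartzR (F i)) -> schwartzR (fun x => \sum_(i <- r) c i * F i x).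
Proof.
move=> SF; elim: r => [|i r IH].
  by rewrite (_ : (fun _ => _) = fun=> 0); [exact: schwartzR0|apply/funext => x; rewrite big_nil].
rewrite (_ : (fun _ => _) = fun x => c i * F i x + \sum_(i <- r) c i * F i x).
  exact: schwartzR_ZD.
by apply/funext => x; rewrite big_cons.
Qed.

Lemma schwartzR_weight f : schwartzR f -> exists C : R, forall x, `|f x| <= C * weight x.
Proof. by move=> /schwartzR_decays /decays_weight. Qed.

Lemma weight_integrable f : continuous f -> (exists C : R, forall x, `|f x| <= C * weight x) ->
  (leb R d).-integrable setT (EFin \o f).
Proof.
move=> cf [C fC]; apply: (integrable_le (g := fun x => C * weight x)) => //.
  exact: continuous_measurable_rV.
rewrite (_ : _ \o _ = fun x => C%:E * (EFin \o @weight R d) x)%E; last by apply/funext.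
by apply: integrableZl => //; exact: integrable_weight.
Qed.

Lemma schwartzR_integrable f : schwartzR f -> (leb R d).-integrable setT (EFin \o f).
Proof.
by move=> Sf; apply: weight_integrable; [exact: schwartzR_continuous|exact: schwartzR_weight].
Qed.

End real_schwartz.

Section Rintegral_linear.
Context d (T : measurableType d) (R : realType) (mu : {measure set T -> \bar R}).
Implicit Types f g : T -> R.

Lemma integrable_ZD (a : R) f g : mu.-integrable setT (EFin \o f) ->
  mu.-integrable setT (EFin \o g) ->
  mu.-integrable setT (EFin \o (fun x => a * f x + g x)).
Proof.
move=> If Ig; rewrite (_ : _ \o _ = (fun x => (a%:E * (EFin \o f) x)%E) \+ (EFin \o g))%E.
  by apply: integrableD => //; exact: integrableZl.
exact/funext.
Qed.

Lemma Rintegral_ZD (a : R) f g : mu.-integrable setT (EFin \o f) ->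
  mu.-integrable setT (EFin \o g) ->
  \int[mu]_x (a * f x + g x) = a * \int[mu]_x f x + \int[mu]_x g x.
Proof.
move=> If Ig; rewrite RintegralD//; first by rewrite RintegralZl.
exact: (integrableZl measurableT a If).
Qed.

Lemma integrable0R : mu.-integrable setT (EFin \o (fun=> 0 : R)).
Proof. exact: integrable0. Qed.

Lemma integrable_Z (a : R) f : mu.-integrable setT (EFin \o f) ->
  mu.-integrable setT (EFin \o (fun x => a * f x)).
Proof. by move=> If; exact: (integrableZl measurableT a If). Qed.

Lemma Rintegral_Z (a : R) f : mu.-integrable setT (EFin \o f) ->
  \int[mu]_x (a * f x) = a * \int[mu]_x f x.
Proof. by move=> If; rewrite RintegralZl. Qed.

Lemma integrable_sumR (I : Type) (r : seq I) (a : I -> R) (F : I -> T -> R) :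
  (forall i, mu.-integrable setT (EFin \o F i)) ->
  mu.-integrable setT (EFin \o (fun x => \sum_(i <- r) a i * F i x)).
Proof.
move=> IF; elim: r => [|i r IH].
  under [X in EFin \o X]eq_fun do rewrite big_nil; exact: integrable0R.
under [X in EFin \o X]eq_fun do rewrite big_cons; exact: integrable_ZD.
Qed.

Lemma Rintegral_sumR (I : Type) (r : seq I) (a : I -> R) (F : I -> T -> R) :
  (forall i, mu.-integrable setT (EFin \o F i)) ->
  \int[mu]_x (\sum_(i <- r) a i * F i x) = \sum_(i <- r) a i * \int[mu]_x F i x.
Proof.
move=> IF; elim: r => [|i r IH].
  rewrite big_nil -[RHS](Rintegral_set0 mu (fun=> 0)) /Rintegral integral_set0.
  by under eq_integral do rewrite big_nil; rewrite integral0.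
rewrite big_cons -IH -Rintegral_ZD//; last exact: integrable_sumR.
by apply: eq_Rintegral => x _; rewrite big_cons.
Qed.

End Rintegral_linear.

(** * Cosine and sine transforms *)

Section transform.
Variables (R : realType) (d : nat).
Implicit Types (f g : 'rV[R]_d -> R) (x v xi : 'rV[R]_d).

Local Notation e_ i := (delta_mx ord0 i : 'rV[R]_d).
Local Notation J := (leb R d).

Lemma dotC x xi : dot x xi = dot xi x.
Proof. by apply: eq_bigr => i _; rewrite mulrC. Qed.

Lemma dotDl x y xi : dot (x + y) xi = dot x xi + dot y xi.
Proof. by rewrite -big_split; apply: eq_bigr => i _; rewrite mxE mulrDl. Qed.

Lemma dotDr x xi eta : dot x (xi + eta) = dot x xi + dot x eta.
Proof. by rewrite dotC dotDl ![dot _ x]dotC. Qed.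

Lemma dotZl a x xi : dot (a *: x) xi = a * dot x xi.
Proof. by rewrite /dot mulr_sumr; apply: eq_bigr => i _; rewrite mxE mulrA. Qed.

Lemma dotZr a x xi : dot x (a *: xi) = a * dot x xi.
Proof. by rewrite dotC dotZl dotC. Qed.

Lemma dotNl x xi : dot (- x) xi = - dot x xi.
Proof. by rewrite -scaleN1r dotZl mulN1r. Qed.

Lemma dot_ebase i xi : dot (e_ i) xi = xi ord0 i.
Proof.
rewrite /dot (bigD1 i)//= big1 ?addr0; last first.
  by move=> j /negPf ji; rewrite mxE eqxx/= ji mul0r.
by rewrite mxE !eqxx mul1r.
Qed.

(** A phase instead of separate cosine and sine: differentiation only adds [pi / 2] to [c], so a
    single family is closed under derivatives. *)
Definition wave (c : R) x xi : R := cos (2 * pi * dot x xi + c).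

Lemma wave_le1 c x xi : `|wave c x xi| <= 1.
Proof. exact: cos_max. Qed.

Lemma waveC c x xi : wave c x xi = wave c xi x.
Proof. by rewrite /wave dotC. Qed.

Lemma continuous_sum_rV (I : Type) (r : seq I) (F : I -> 'rV[R]_d -> R) :
  (forall i, continuous (F i)) -> continuous (fun x => \sum_(i <- r) F i x).
Proof.
move=> cF; elim: r => [|i r IH].
  by under eq_fun do rewrite big_nil; exact: continuous_cst_rV.
by under eq_fun do rewrite big_cons; exact: continuousD_rV.
Qed.

Lemma continuous_prod_rV (I : Type) (r : seq I) (F : I -> 'rV[R]_d -> R) :
  (forall i, continuous (F i)) -> continuous (fun x => \prod_(i <- r) F i x).
Proof.
move=> cF; elim: r => [|i r IH].
  by under eq_fun do rewrite big_nil; exact: continuous_cst_rV.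
by under eq_fun do rewrite big_cons; exact: continuousM_rV.
Qed.

Lemma continuous_dot xi : continuous (fun x => dot x xi).
Proof.
apply: continuous_sum_rV => i; apply: continuousM_rV; last exact: continuous_cst_rV.
exact: coord_continuous.
Qed.

Lemma continuous_wave c xi : continuous (fun x => wave c x xi).
Proof.
move=> x; apply: (@continuous_comp _ _ _ (fun x => 2 * pi * dot x xi + c) cos); last exact: continuous_cos.
apply: continuousD_rV; last exact: continuous_cst_rV.
by apply: continuousM_rV; [exact: continuous_cst_rV|exact: continuous_dot].
Qed.

Lemma measurable_wave2 c :
  measurable_fun setT (fun z : 'rV[R]_d * 'rV[R]_d => wave c z.1 z.2).
Proof.
apply: (@measurableT_comp _ _ _ _ _ _ (@cos R)).
  by apply: continuous_measurable_fun; exact: continuous_cos.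
apply: measurable_funD => //; apply: measurable_funM => //.
apply: measurable_sum => i; apply: measurable_funM.
- exact: (measurableT_comp (@measurable_rV_coord _ R d i) measurable_fst).
- exact: (measurableT_comp (@measurable_rV_coord _ R d i) measurable_snd).
Qed.

Definition trig (c : R) f xi : R := \int[J]_x (f x * wave c x xi).

Lemma measurable_wave c xi : measurable_fun setT (fun x => wave c x xi).
Proof. by apply: continuous_measurable_rV; exact: continuous_wave. Qed.

Lemma integrable_wave c f xi : J.-integrable setT (EFin \o f) ->
  J.-integrable setT (EFin \o (fun x => f x * wave c x xi)).
Proof.
by move=> If; apply: (@integrable_Mbounded _ _ _ _ _ _ 1 (measurable_wave c xi) _ If) => x; exact: wave_le1.
Qed.

(** The multiplication formula of Fourier analysis; it holds because [wave c] is symmetric in its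
    two arguments. *)
Lemma trig_sym c f g :
  J.-integrable setT (EFin \o f) -> J.-integrable setT (EFin \o g) ->
  \int[J]_x (f x * trig c g x) = \int[J]_x (trig c f x * g x).
Proof.
move=> If Ig; under eq_Rintegral => x _.
  rewrite /trig (_ : \int[J]_y _ = \int[J]_y (g y * wave c x y)); last first.
    by apply: eq_Rintegral => y _; rewrite waveC.
  over.
rewrite (Rintegral_kernelC (measurable_wave2 c) (@wave_le1 c) If Ig).
by apply: eq_Rintegral => y _; rewrite mulrC.
Qed.

Lemma trigZ c (a : R) f xi :
  J.-integrable setT (EFin \o f) -> trig c (fun x => a * f x) xi = a * trig c f xi.
Proof.
move=> If; rewrite /trig -Rintegral_Z; last exact: integrable_wave.
by apply: eq_Rintegral => x _; rewrite mulrA.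
Qed.

Lemma trig_shift c t f xi : J.-integrable setT (EFin \o f) ->
  trig (c + t) f xi = cos t * trig c f xi - sin t * trig (c - pi / 2) f xi.
Proof.
move=> If; rewrite -mulNr /trig -!Rintegral_Z; [|exact: integrable_wave..].
rewrite -RintegralD//; [|exact/integrable_Z/integrable_wave..].
apply: eq_Rintegral => x _; rewrite /wave !addrA cosD cosB cos_pihalf sin_pihalf.
rewrite mulr0 mulr1 add0r; lra.
Qed.

Lemma measurable_trig c f : measurable_fun setT f -> measurable_fun setT (trig c f).
Proof.
move=> mf; rewrite (_ : trig c f = fun x => \int[J]_y (f y * wave c x y)).
  exact: (measurable_Rintegral_kernel J (measurable_wave2 c) mf).
by apply/funext => x; apply: eq_Rintegral => y _; rewrite waveC.
Qed.

Lemma trig_le c f xi : J.-integrable setT (EFin \o f) -> `|trig c f xi| <= \int[J]_x `|f x|.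
Proof.
move=> If; apply: (le_trans (le_normr_Rintegral measurableT (integrable_wave c xi If))).
apply: le_Rintegral => //.
- exact: (integrable_norm (integrable_wave c xi If)).
- exact: (integrable_norm If).
- by move=> x _; rewrite normrM ler_piMr// wave_le1.
Qed.

End transform.

(** * Translation invariance and integration by parts *)

Section integration_by_parts.
Variables (R : realType) (d : nat).
Implicit Types (f g : 'rV[R]_d -> R) (x v xi : 'rV[R]_d).

Local Notation e_ i := (delta_mx ord0 i : 'rV[R]_d).
Local Notation dd i f := (fun x => 'D_(e_ i) f x).
Local Notation J := (leb R d).

Lemma integrable_affine f (a : R) v : a != 0 -> J.-integrable setT (EFin \o f) ->
  J.-integrable setT (EFin \o (fun x => f (a *: x + v))).
Proof.
move=> a0 /integrableP[mf If]; apply/integrableP; split.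
  exact: (measurableT_comp mf (measurable_affine_rV a v)).
rewrite (ge0_integral_affine v a0 (F := fun x => `|(f x)%:E|%E))//; last exact: measurableT_comp.
by rewrite lte_mul_pinfty// lee_fin invr_ge0 exprn_ge0.
Qed.

Lemma Rintegral_affine f (a : R) v : a != 0 -> J.-integrable setT (EFin \o f) ->
  \int[J]_x f (a *: x + v) = `|a| ^- d * \int[J]_x f x.
Proof.
move=> a0 If; have mf : measurable_fun setT (EFin \o f) by case/integrableP: If.
rewrite /Rintegral integralE [in RHS]integralE.
have Ip := integrable_pos_fin_num measurableT If.
have In := integrable_neg_fin_num measurableT If.
have -> : (\int[J]_x (fun x => (f (a *: x + v))%:E)^\+ x =
    (`|a| ^- d)%:E * \int[J]_x (EFin \o f)^\+ x)%E.
  rewrite -(ge0_integral_affine v a0)//; last exact: measurable_funepos.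
  by apply: eq_integral => x _; rewrite !funeposE.
have -> : (\int[J]_x (fun x => (f (a *: x + v))%:E)^\- x =
    (`|a| ^- d)%:E * \int[J]_x (EFin \o f)^\- x)%E.
  rewrite -(ge0_integral_affine v a0)//; last exact: measurable_funeneg.
  by apply: eq_integral => x _; rewrite !funenegE.
by rewrite -muleBr ?fin_num_adde_defr// fineM// fin_numB Ip In.
Qed.

Lemma Rintegral_translation f v : J.-integrable setT (EFin \o f) ->
  \int[J]_x f (x + v) = \int[J]_x f x.
Proof.
move=> If; rewrite -[RHS]mul1r -[X in X * _](_ : `|1 : R| ^- d = 1).
  rewrite -(Rintegral_affine v (oner_neq0 _) If).
  by apply: eq_Rintegral => x _; rewrite scale1r.
by rewrite normr1 expr1n invr1.
Qed.

(** Gives one integrable majorant for all difference quotients of step at most 1. *)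
Lemma weight_shift i (t : R) x : `|t| <= 1 -> weight (t *: e_ i + x) <= 3 * weight x.
Proof.
move=> t1; rewrite /weight (bigD1 i)//= [in leRHS](bigD1 i)//= mulrA.
rewrite (eq_bigr (fun j => (oneDsqr (x ord0 j))^-1)); last first.
  by move=> j /negPf ji; rewrite !mxE eqxx/= ji mulr0 add0r.
apply: ler_wpM2r; first by apply: prodr_ge0 => j _; exact/ltW/oneDsqrV_gt0.
rewrite !mxE !eqxx mulr1 -ler_pdivrMr ?oneDsqrV_gt0//.
rewrite invrK mulrC ler_pdivrMr; last by rewrite -invr_gt0 oneDsqrV_gt0.
rewrite /oneDsqr; set y := x ord0 i.
have t2 : t ^+ 2 <= 1 by rewrite -real_normK ?num_real// expr_le1.
(* The identity behind this is [y^2 + (y + 2 t)^2 = 2 (y + t)^2 + 2 t^2], with [t^2 <= 1]. *)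
have := sqr_ge0 (y + 2 * t); nra.
Qed.

Lemma cvg_harmonic_dnbhs : (fun k : nat => k.+1%:R^-1 : R) @ \oo --> (0 : R)^'.
Proof.
move=> A; rewrite /= /dnbhs /within/= => A0.
have : \forall k \near \oo, (k.+1%:R^-1 : R) != 0 -> A (k.+1%:R^-1 : R).
  exact: (@cvg_harmonic R _ A0).
by apply: filterS => k; apply; rewrite invr_neq0// pnatr_eq0.
Qed.

(* The integral of a difference quotient vanishes by translation invariance. *)
Lemma Rintegral_derive_eq0 g i (C C' : R) :
  continuous g -> (forall x, derivable g x (e_ i)) ->
  (forall x, `|g x| <= C' * weight x) -> (forall x, `|dd i g x| <= C * weight x) ->
  \int[J]_x dd i g x = 0.
Proof.
move=> cg dg gC dgC.
have Ig : J.-integrable setT (EFin \o g) by apply: weight_integrable => //; exists C'.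
pose q (k : nat) x : R := k.+1%:R * g (x + k.+1%:R^-1 *: e_ i) + - k.+1%:R * g x.
have Is k : J.-integrable setT (EFin \o (fun x => g (x + k.+1%:R^-1 *: e_ i))).
  have := integrable_affine (k.+1%:R^-1 *: e_ i) (oner_neq0 R) Ig.
  by under [X in EFin \o X]eq_fun do rewrite scale1r.
have q0 k : \int[J]_x q k x = 0.
  rewrite /q Rintegral_ZD//; last exact: integrable_Z.
  by rewrite Rintegral_Z// Rintegral_translation// mulNr subrr.
have mq k : measurable_fun setT (q k).
  apply/measurable_EFinP; case/integrableP: (integrable_ZD k.+1%:R (Is k) (integrable_Z (- k.+1%:R) Ig)).
  by [].
have C0 : 0 <= C.
  have := le_trans (normr_ge0 _) (dgC 0); rewrite pmulr_lge0//; exact: weight_gt0.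
(* By the mean value theorem the quotient is a derivative at a point less than 1 away, where the
   weight is at most three times larger. *)
have qC k x : `|q k x| <= 3 * C * weight x.
  pose h : R := k.+1%:R^-1.
  have h0 : 0 < h by rewrite invr_gt0.
  have h1 : h <= 1 by rewrite invf_le1// ler1n.
  have [||c] := @MVT _ (fun s => g (s *: e_ i + x)) (fun s => dd i g (s *: e_ i + x)) 0 h h0.
  - by move=> s _; apply: line_is_derive; exact: dg.
  - apply: continuous_subspaceT => s; apply: differentiable_continuous.
    by apply/derivable1_diffP; apply/derivable_line; exact: dg.
  rewrite in_itv/= => /andP[c0 ch]; rewrite scale0r add0r subr0 => E.
  have -> : q k x = dd i g (c *: e_ i + x).
    rewrite /q -/h mulNr -mulrBr [x + _]addrC E mulrCA -/h mulfV ?mulr1//.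
  apply: (le_trans (dgC _)); rewrite [3 * C]mulrC -mulrA ler_wpM2l//.
  apply: weight_shift; rewrite gtr0_norm//; lra.
have qcvg x : q ^~ x @ \oo --> dd i g x.
  have := dg x => /cvg_ex[l gl].
  have -> : dd i g x = l by apply: cvg_lim gl.
  have := cvg_comp _ _ cvg_harmonic_dnbhs gl; apply: cvg_trans; apply: near_eq_cvg.
  apply: nearW => k /=; rewrite /q invrK mulNr -mulrBr [x + _]addrC.
  by [].
have IW : J.-integrable setT (EFin \o (fun x => 3 * C * weight x)).
  exact: integrable_Z (integrable_weight _ _).
have := Rintegral_dominated_cvg mq IW qcvg qC; under eq_fun do rewrite q0.
by move=> /cvg_lim <-//; rewrite lim_cst.
Qed.

End integration_by_parts.

Section transform_schwartz.
Variables (R : realType) (d : nat).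
Implicit Types (f g : 'rV[R]_d -> R) (x v xi : 'rV[R]_d).

Local Notation e_ i := (delta_mx ord0 i : 'rV[R]_d).
Local Notation dd i f := (fun x => 'D_(e_ i) f x).
Local Notation J := (leb R d).

Lemma is_derive_cos_affine (a b t : R) :
  is_derive t 1 (fun s => cos (a * s + b)) (a * cos (a * t + b + pi / 2)).
Proof.
have H : is_derive t 1 (fun s : R => a * s + b) a.
  by apply: is_derive_eq; rewrite /GRing.scale/= addr0 mulr1.
have := @is_derive1_comp R cos (fun s => a * s + b) t _ _ (is_derive_cos (a * t + b)) H.
by rewrite cosDpihalf [a * - _]mulrC.
Qed.

Lemma is_derive_wave c x xi i :
  is_derive x (e_ i) (fun y => wave c y xi) (2 * pi * xi ord0 i * wave (c + pi / 2) x xi).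
Proof.
apply: is_derive_line; rewrite /wave.
under eq_fun do rewrite dotDl dotZl dot_ebase mulrDr mulrCA mulrC -addrA.
have := is_derive_cos_affine (2 * pi * xi ord0 i) (2 * pi * dot x xi + c) 0.
by rewrite mulr0 add0r !addrA.
Qed.

Lemma derivableM_rV f g x v : derivable f x v -> derivable g x v ->
  derivable (fun x => f x * g x) x v.
Proof. by move=> df dg; exact: (@derivableM R 'rV[R]_d f g x v df dg). Qed.

Lemma deriveM_rV f g x v : derivable f x v -> derivable g x v ->
  'D_v (fun x => f x * g x) x = f x * 'D_v g x + g x * 'D_v f x.
Proof. by move=> df dg; exact: (@deriveM R 'rV[R]_d f g x v df dg). Qed.

(** Integration by parts: the derivative of [f * wave c] has integral zero, and the product rule
    splits it into the two transforms. *)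
Lemma trig_dd c f i xi : schwartzR f ->
  trig c (dd i f) xi = - (2 * pi * xi ord0 i) * trig (c + pi / 2) f xi.
Proof.
move=> Sf; have Sdf := schwartzR_dd i Sf.
have If := schwartzR_integrable Sf; have Idf := schwartzR_integrable Sdf.
pose g x := f x * wave c x xi.
have df x : derivable f x (e_ i) by exact: schwartzR_derivable.
have dw x : derivable (fun y => wave c y xi) x (e_ i) by have [] := is_derive_wave c x xi i.
have Dw x : 'D_(e_ i) (fun y => wave c y xi) x = 2 * pi * xi ord0 i * wave (c + pi / 2) x xi.
  by have [] := is_derive_wave c x xi i.
have Dg x : dd i g x = (2 * pi * xi ord0 i) * (f x * wave (c + pi / 2) x xi) + dd i f x * wave c x xi.
  by rewrite /g deriveM_rV ?Dw; [rewrite mulrCA [wave c x xi * _]mulrC|exact: df|exact: dw].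
have [C fC] := schwartzR_weight Sf; have [C' dfC] := schwartzR_weight Sdf.
have : \int[J]_x dd i g x = 0.
  apply: (@Rintegral_derive_eq0 _ _ g i (`|2 * pi * xi ord0 i| * C + C') C).
  - by apply: continuousM_rV; [exact: schwartzR_continuous|exact: continuous_wave].
  - by move=> x; apply: derivableM_rV; [exact: df|exact: dw].
  - move=> x; rewrite normrM; apply: le_trans (fC x).
    by rewrite ler_piMr// wave_le1.
  - move=> x; rewrite Dg; apply: (le_trans (ler_normD _ _)); rewrite [leRHS]mulrDl lerD//.
      rewrite normrM -[leRHS]mulrA ler_wpM2l// normrM; apply: le_trans (fC x).
      by rewrite ler_piMr// wave_le1.
    rewrite normrM; apply: le_trans (dfC x).
    by rewrite ler_piMr// wave_le1.
under eq_Rintegral do rewrite Dg.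
rewrite Rintegral_ZD; [|exact: integrable_wave..].
by rewrite addrC => /eqP; rewrite addr_eq0 => /eqP; rewrite mulNr.
Qed.

Lemma trig_addpi c f xi : J.-integrable setT (EFin \o f) ->
  trig (c + pi) f xi = - trig c f xi.
Proof.
move=> If; rewrite -mulN1r -trigZ//; apply: eq_Rintegral => x _.
by rewrite /wave addrA cosDpi mulrN !mulNr mul1r.
Qed.

Lemma trig_dd2 c f i xi : schwartzR f ->
  trig c (pderiv [:: i; i] f) xi = - (4 * pi ^+ 2 * xi ord0 i ^+ 2) * trig c f xi.
Proof.
move=> Sf; rewrite /= (trig_dd _ _ _ (schwartzR_dd i Sf)) (trig_dd _ _ _ Sf).
have -> : c + pi / 2 + pi / 2 = c + pi by rewrite -addrA -splitr.
rewrite trig_addpi; last exact: schwartzR_integrable.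
by rewrite expr2; lra.
Qed.

Lemma cos_lipschitz (a b : R) : `|cos a - cos b| <= `|a - b|.
Proof.
wlog ab : a b / b <= a.
  by move=> H; have [/H//|/ltW/H] := leP b a; rewrite distrC [leRHS]distrC.
have [|c _ ->] := @MVT_segment R cos (fun t : R => - sin t) b a ab.
- by apply: continuous_subspaceT => x; exact: continuous_cos.
- by rewrite normrM normrN ler_piMl// sin_max.
Qed.

Lemma dot_le_norm x v : `|dot x v| <= (\sum_i `|x ord0 i|) * `|v|.
Proof.
rewrite (le_trans (ler_norm_sum _ _ _))// mulr_suml ler_sum// => i _.
rewrite normrM ler_wpM2l//.
rewrite [leRHS]mx_normrE; apply: (le_trans _ (le_bigmax _ _ (ord0, i))); exact: lexx.
Qed.

Lemma lipschitz_continuous_rV f (K : R) : (forall x y, `|f x - f y| <= K * `|x - y|) ->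
  continuous f.
Proof.
move=> fK x; have K0 : 0 < `|K| + 1 by rewrite ltr_pwDr.
rewrite /continuous_at; apply/(@cvgrPdist_lt _ _ _ (nbhs x)) => e e0.
apply/nbhs_ballP; exists (e / (`|K| + 1)); first by rewrite /= divr_gt0.
move=> y; rewrite -ball_normE/= => xy; rewrite (le_lt_trans (fK _ _))//.
rewrite (@le_lt_trans _ _ ((`|K| + 1) * `|x - y|))//.
  by rewrite ler_wpM2r// (le_trans (ler_norm _))// lerDl.
by rewrite mulrC -ltr_pdivlMr.
Qed.

Lemma schwartzR_scale (a : R) f : schwartzR f -> schwartzR (fun x => a * f x).
Proof.
move=> Sf; have := schwartzR_ZD a Sf (schwartzR0 R d).
by under eq_fun do rewrite addr0.
Qed.

Lemma dotBr x xi eta : dot x (xi - eta) = dot x xi - dot x eta.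
Proof. by rewrite dotDr -scaleN1r dotZr mulN1r. Qed.

(** Cosine is 1-Lipschitz, so the transform is Lipschitz in the sup norm, with constant the integral
    of [2 * pi * |x_i * f x|] summed over the coordinates. *)
Lemma continuous_trig c f : schwartzR f -> continuous (trig c f).
Proof.
move=> Sf; have If := schwartzR_integrable Sf.
pose G x := \sum_(i <- index_enum 'I_d) (2 * pi) * `|x ord0 i * f x|.
have IG : J.-integrable setT (EFin \o G).
  apply: (@integrable_sumR _ _ _ J _ _ _ (fun i x => `|x ord0 i * f x|)) => i.
  exact: integrable_norm (schwartzR_integrable (schwartzR_coordM i Sf)).
apply: (@lipschitz_continuous_rV _ (\int[J]_x G x)) => xi eta.
have Iw xi' := integrable_wave c xi' If.
rewrite /trig -RintegralB//.
apply: le_trans (le_normr_Rintegral measurableT (integrableB measurableT (Iw xi) (Iw eta))) _.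
rewrite mulrC -Rintegral_Z//; apply: le_Rintegral => //.
- exact: integrable_norm (integrableB measurableT (Iw xi) (Iw eta)).
- exact: integrable_Z.
move=> x _; rewrite -mulrBr normrM /wave.
have := cos_lipschitz (2 * pi * dot x xi + c) (2 * pi * dot x eta + c).
rewrite opprD addrACA subrr addr0 -mulrBr -dotBr normrM.
rewrite (ger0_norm (x := 2 * pi)); last by rewrite mulr_ge0 ?pi_ge0.
move=> H; apply: (le_trans (ler_wpM2l (normr_ge0 (f x)) H)).
have -> : `|xi - eta| * G x =
    `|f x| * (2 * pi * ((\sum_i `|x ord0 i|) * `|xi - eta|)).
  rewrite /G -mulr_sumr.
  rewrite (eq_bigr (fun i => `|x ord0 i| * `|f x|)); last by move=> i _; rewrite normrM.
  by rewrite -mulr_suml; ring.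
by rewrite !ler_wpM2l ?mulr_ge0 ?pi_ge0//; exact: dot_le_norm.
Qed.

(** Differentiation under the integral sign along the line through [xi]; the majorant
    [2 * pi * |x_i * f x|] does not depend on the parameter. *)
Lemma is_derive_trig c f xi i : schwartzR f ->
  is_derive xi (e_ i) (trig c f) (trig (c + pi / 2) (fun x => 2 * pi * (x ord0 i * f x)) xi).
Proof.
move=> Sf; apply: is_derive_line.
pose F (t : R) x := f x * wave c x (t *: e_ i + xi).
pose G x := 2 * pi * `|x ord0 i * f x|.
have IF t : J.-integrable setT (EFin \o F t) by apply/integrable_wave/schwartzR_integrable.
have dF (t : R) x : is_derive t 1 (F ^~ x)
    (2 * pi * (x ord0 i * f x) * wave (c + pi / 2) x (t *: e_ i + xi)).
  have := is_derive_wave c (t *: e_ i + xi) x i.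
  case=> Hd Hv; have [] := line_is_derive Hd; rewrite Hv.
  rewrite (_ : (fun s : R => wave c (s *: e_ i + xi) x) = (fun s : R => wave c x (s *: e_ i + xi))); last first.
    by apply/funext => s; rewrite waveC.
  move=> dw Dw; rewrite /F; apply: DeriveDef; first exact: (@derivableZ R R R _ (f x) t 1 dw).
  rewrite (@deriveZ R R R _ (f x) t 1 dw) Dw /GRing.scale/= waveC; ring.
have IG : J.-integrable setT (EFin \o G).
  apply: integrable_Z; apply: integrable_norm; exact: schwartzR_integrable (schwartzR_coordM i Sf).
have D1 t x : partial1of2 F t x = 2 * pi * (x ord0 i * f x) * wave (c + pi / 2) x (t *: e_ i + xi).
  by rewrite partial1of2E; have [] := dF t x.
have G0 x : 0 <= G x by rewrite !mulr_ge0 ?pi_ge0.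
have GF t x : `|partial1of2 F t x| <= G x.
  rewrite D1 /G normrM [in leLHS]normrM (ger0_norm (x := 2 * pi)); last by rewrite mulr_ge0 ?pi_ge0.
  by rewrite ler_piMr ?wave_le1// !mulr_ge0 ?pi_ge0.
have i0 : `](-1), 1[%classic (0 : R) by rewrite /= in_itv/= ltrN10 ltr01.
apply: DeriveDef.
  apply: (@derivable_under_integral R _ _ J F setT measurableT 0 (-1) 1 i0 _ _ G) => //.
rewrite -derive1E (@differentiation_under_integral R _ _ J F setT measurableT 0 (-1) 1 i0 _ _ G)//.
by apply: eq_Rintegral => x _; rewrite D1 scale0r add0r.
Qed.

(** Each factor [2 * pi * xi_i] is traded for a derivative of [f] by [trig_dd], until a bounded
    transform remains. *)
Lemma decays_trig c f : schwartzR f -> decays (trig c f).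
Proof.
move=> Sf a.
have : forall (l : seq 'I_d) c f, schwartzR f -> exists M : R, forall xi,
    `|\prod_(i <- l) (2 * pi * xi ord0 i)| * `|trig c f xi| <= M.
  elim=> [|i l IH] {}c {Sf}f Sf.
    exists (\int[J]_x `|f x|) => xi; rewrite big_nil normr1 mul1r.
    exact/trig_le/schwartzR_integrable.
  have [M HM] := IH (c - pi / 2) _ (schwartzR_dd i Sf).
  exists M => xi; apply: le_trans (HM xi).
  by rewrite trig_dd// big_cons subrK !normrM normrN !normrM mulrCA mulrA.
(* The list repeats each index [i] exactly [a i] times, so that it encodes the monomial with
   exponents [a]. *)
move=> /(_ (flatten [seq nseq (a i) i | i <- index_enum 'I_d]) c f Sf)[M HM].
exists M => xi; apply: le_trans (HM xi); rewrite ler_wpM2r//.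
rewrite big_flatten/= big_map !normr_prod; apply: ler_prod => i _.
rewrite normr_ge0/= big_nseq iter_mulr_1 !normrX lerXn2r ?nnegrE// normrM.
rewrite ler_peMl// ger0_norm ?mulr_ge0 ?pi_ge0//.
(* The monomial lacks the factors [2 * pi]; restoring them only increases it, since they exceed
   1. *)
have := @pi_ge2 R; lra.
Qed.

Lemma schwartzR_trig c f : schwartzR f -> schwartzR (trig c f).
Proof.
move=> Sf; apply: (@schwartzR_coind _ _ (fun g => exists c f, schwartzR f /\ g = trig c f)).
  move=> _ [{}c [{Sf}f [Sf ->]]]; split.
  - exact: continuous_trig.
  - exact: decays_trig.
  move=> i; split=> [xi|]; first by have [] := is_derive_trig c xi i Sf.
  exists (c + pi / 2), (fun x => 2 * pi * (x ord0 i * f x)); split.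
    exact: schwartzR_scale (schwartzR_coordM i Sf).
  by apply/funext => xi; have [] := is_derive_trig c xi i Sf.
by exists c, f.
Qed.

End transform_schwartz.

Section Rintegral_add.
Context d (T : measurableType d) (R : realType) (mu : {measure set T -> \bar R}).
Implicit Types f g : T -> R.

Lemma integrable_D f g : mu.-integrable setT (EFin \o f) ->
  mu.-integrable setT (EFin \o g) ->
  mu.-integrable setT (EFin \o (fun x => f x + g x)).
Proof.
move=> If Ig; have := integrable_ZD 1 If Ig.
by under [X in EFin \o X]eq_fun do rewrite mul1r.
Qed.

Lemma Rintegral_D f g : mu.-integrable setT (EFin \o f) ->
  mu.-integrable setT (EFin \o g) ->
  \int[mu]_x (f x + g x) = \int[mu]_x f x + \int[mu]_x g x.
Proof. by move=> If Ig; rewrite RintegralD. Qed.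

Lemma Rintegral_B f g : mu.-integrable setT (EFin \o f) ->
  mu.-integrable setT (EFin \o g) ->
  \int[mu]_x (f x - g x) = \int[mu]_x f x - \int[mu]_x g x.
Proof. by move=> If Ig; rewrite RintegralB. Qed.

End Rintegral_add.

(** * Fourier inversion up to a positive constant *)

Section inversion.
Variables (R : realType) (d : nat).
Implicit Types (b f g : 'rV[R]_d -> R) (x v xi s : 'rV[R]_d).

Local Notation J := (leb R d).

Lemma schwartzR_bounded f : schwartzR f -> exists C : R, forall x, `|f x| <= C.
Proof.
move=> Sf; have [C HC] := schwartzR_decays Sf (fun=> 0%N); exists C => x.
apply: le_trans (HC x); rewrite big1 ?normr1 ?mul1r// => i _; exact: expr0.
Qed.

Lemma integrable_translation f s : J.-integrable setT (EFin \o f) ->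
  J.-integrable setT (EFin \o (fun t => f (t + s))).
Proof.
move=> If; have := integrable_affine s (oner_neq0 R) If.
by under [X in EFin \o X]eq_fun do rewrite scale1r.
Qed.

Lemma continuous_translation f s : continuous f -> continuous (fun t : 'rV[R]_d => f (t + s)).
Proof.
move=> cf x; apply: (@continuous_comp _ _ _ (fun t : 'rV[R]_d => t + s) f); last exact: cf.
exact: cvgD cvg_id (cvg_cst _).
Qed.

Lemma trig_translate c b s x : J.-integrable setT (EFin \o b) ->
  trig c (fun t => b (t + s)) x = trig (c - 2 * pi * dot x s) b x.
Proof.
move=> Ib; rewrite /trig.
rewrite -(Rintegral_translation s (integrable_wave (c - 2 * pi * dot x s) x Ib)).
apply: eq_Rintegral => t _; rewrite /wave dotDl [dot s x]dotC.
by congr (_ * cos _); ring.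
Qed.

Lemma trig_dilate c b (N : R) x : 0 < N -> J.-integrable setT (EFin \o b) ->
  trig c (fun t => b (N^-1 *: t)) x = N ^+ d * trig c b (N *: x).
Proof.
move=> N0 Ib; have Nn0 : N^-1 != 0 by rewrite invr_neq0// lt0r_neq0.
have := Rintegral_affine 0 Nn0 (integrable_wave c (N *: x) Ib).
rewrite normfV gtr0_norm// exprVn invrK => <-; apply: eq_Rintegral => t _.
by rewrite addr0 /wave dotZl dotZr mulKf// lt0r_neq0.
Qed.

(* Multiplication formula for [rho] dilated by [k.+1]; both sides converge as k grows. *)
Lemma Rintegral_trig c (rho b : 'rV[R]_d -> R) (M : R) : schwartzR rho ->
  continuous b -> (forall x, `|b x| <= M) ->
  J.-integrable setT (EFin \o b) -> J.-integrable setT (EFin \o trig c b) ->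
  rho 0 * \int[J]_x trig c b x = b 0 * \int[J]_x trig c rho x.
Proof.
move=> Srho cb bM Ib Itb.
have Irho := schwartzR_integrable Srho.
have Itrho := schwartzR_integrable (schwartzR_trig c Srho).
have crho := schwartzR_continuous Srho.
have [C rhoC] := schwartzR_bounded Srho.
have scale0 x : (fun k : nat => k.+1%:R^-1 *: x) @ \oo --> (0 : 'rV[R]_d).
  rewrite -[X in _ --> X](scale0r x); apply: cvgZr_tmp; exact: cvg_harmonic.
have cvgs f x : continuous f -> (fun k : nat => f (k.+1%:R^-1 *: x)) @ \oo --> f 0.
  by move=> cf; apply: (cvg_comp _ _ (scale0 x)); exact: cf.
have IZ f (k : nat) : J.-integrable setT (EFin \o f) ->
    J.-integrable setT (EFin \o (fun x => f (k.+1%:R^-1 *: x))).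
  move=> If; have k0 : (k.+1%:R^-1 : R) != 0 by rewrite invr_neq0// pnatr_eq0.
  by have := integrable_affine 0 k0 If; under [X in EFin \o X]eq_fun do rewrite addr0.
have mR f : J.-integrable setT (EFin \o f) -> measurable_fun setT f.
  by move=> /integrableP[/measurable_EFinP].
have mS f (k : nat) : J.-integrable setT (EFin \o f) ->
    measurable_fun setT (fun x => f (k.+1%:R^-1 *: x)).
  by move=> If; exact: mR (IZ f k If).
(* Dilating [rho] dilates its transform inversely; a change of variables then moves the dilation
   onto [b]. *)
have E (k : nat) : \int[J]_x (rho (k.+1%:R^-1 *: x) * trig c b x) =
    \int[J]_x (trig c rho x * b (k.+1%:R^-1 *: x)).
  have k0 : (0 : R) < k.+1%:R by [].
  have kn0 : (k.+1%:R : R) != 0 by rewrite lt0r_neq0.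
  rewrite (trig_sym c (IZ rho k Irho) Ib).
  under eq_Rintegral do rewrite trig_dilate//.
  have IG : J.-integrable setT (EFin \o (fun x => trig c rho x * b (k.+1%:R^-1 *: x))).
    by apply: (@integrable_Mbounded _ _ _ _ _ _ M) => //; exact: mS.
  have := Rintegral_affine 0 kn0 IG; rewrite gtr0_norm// => H.
  rewrite -[RHS](@mulVKf _ (k.+1%:R ^+ d)) ?expf_neq0// -H -Rintegral_Z; last first.
    have := integrable_affine 0 kn0 IG; by [].
  by apply: eq_Rintegral => x _; rewrite addr0 scalerA mulVf// scale1r mulrA.
have L1 : (fun k : nat => \int[J]_x (rho (k.+1%:R^-1 *: x) * trig c b x)) @ \oo -->
    rho 0 * \int[J]_x trig c b x.
  rewrite -Rintegral_Z//; apply: (Rintegral_dominated_cvg (g := fun x => C * `|trig c b x|)).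
  - by move=> k; apply: measurable_funM; [exact: mS|exact: mR].
  - by apply: integrable_Z; exact: integrable_norm.
  - by move=> x; apply: cvgM; [exact: cvgs|exact: cvg_cst].
  - by move=> k x; rewrite normrM ler_wpM2r.
have L2 : (fun k : nat => \int[J]_x (trig c rho x * b (k.+1%:R^-1 *: x))) @ \oo -->
    b 0 * \int[J]_x trig c rho x.
  rewrite -Rintegral_Z//; apply: (Rintegral_dominated_cvg (g := fun x => M * `|trig c rho x|)).
  - by move=> k; apply: measurable_funM; [exact: mR|exact: mS].
  - by apply: integrable_Z; exact: integrable_norm.
  - by move=> x; rewrite mulrC; apply: cvgM; [exact: cvg_cst|exact: cvgs].
  - by move=> k x; rewrite normrM mulrC ler_wpM2r.
move: L1; rewrite (_ : (fun k : nat => _) = fun k : nat =>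
  \int[J]_x (trig c rho x * b (k.+1%:R^-1 *: x))); last exact/funext.
by move=> /cvg_unique/(_ L2); apply.
Qed.

Lemma trig_even b x : (forall t, b (- t) = b t) -> J.-integrable setT (EFin \o b) ->
  trig (- (pi / 2)) b x = 0.
Proof.
move=> eb Ib; have H := Rintegral_affine 0 (@ltr0_neq0 R (-1) (ltrN10 R)) (integrable_wave (- (pi / 2)) x Ib).
move: H; rewrite normrN1 expr1n invr1 mul1r.
have -> : \int[J]_t (b (-1 *: t + 0) * wave (- (pi / 2)) (-1 *: t + 0) x) =
    - \int[J]_t (b t * wave (- (pi / 2)) t x).
  rewrite -[RHS]mulN1r -Rintegral_Z; last exact: integrable_wave.
  apply: eq_Rintegral => t _; rewrite addr0 scaleN1r eb /wave dotNl !cosBpihalf.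
  by rewrite mulrN sinN mulrN mulN1r.
rewrite /trig => H; lra.
Qed.

Lemma trig_subpihalf2 b x : J.-integrable setT (EFin \o b) ->
  trig (- (pi / 2) - pi / 2) b x = - trig 0 b x.
Proof.
move=> Ib; have := trig_addpi (- (pi / 2) - pi / 2) x Ib.
by rewrite (_ : _ + pi = 0) => [->|]; rewrite ?opprK//; lra.
Qed.

Variable rho : 'rV[R]_d -> R.
Hypotheses (Srho : schwartzR rho) (even_rho : forall t, rho (- t) = rho t) (rho0 : rho 0 != 0).
Hypothesis rho_pos : 0 < \int[J]_x (trig 0 rho x) ^+ 2.

(** The constant of the inversion formula, equal to 1 by Fourier inversion; [invconst_gt0] gives its
    positivity. *)
Definition invconst := (\int[J]_x trig 0 rho x) / rho 0.

(** [Rintegral_trig] applied to the translate [b (t + s)]: the cosine transform of the translate is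
    the real part of the transform of [b] times [cis (2 * pi * dot x s)], and its integral is the
    left side. *)
Lemma trig_inversion_re b s : schwartzR b ->
  trig 0 (trig 0 b) s + trig (- (pi / 2)) (trig (- (pi / 2)) b) s = invconst * b s.
Proof.
move=> Sb; have Ib := schwartzR_integrable Sb.
have It c := schwartzR_integrable (schwartzR_trig c Sb).
have E x : trig 0 (fun t => b (t + s)) x =
    trig 0 b x * wave 0 x s + trig (- (pi / 2)) b x * wave (- (pi / 2)) x s.
  rewrite trig_translate// trig_shift// cosN sinN /wave cosBpihalf addr0 sub0r.
  by rewrite mulNr opprK; congr (_ + _); exact: mulrC.
have Is : J.-integrable setT (EFin \o trig 0 (fun t => b (t + s))).
  rewrite (funext E : trig _ (fun t => b (t + s)) = _).
  exact: (integrable_D (integrable_wave 0 s (It 0)) (integrable_wave (- (pi / 2)) s (It (- (pi / 2))))).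
have [M bM] := schwartzR_bounded Sb.
have Ibs := integrable_translation s Ib.
have cbs : continuous (fun t : 'rV[R]_d => b (t + s)).
  by apply: continuous_translation; exact: schwartzR_continuous.
have := @Rintegral_trig 0 rho _ M Srho cbs (fun x => bM _) Ibs Is.
rewrite add0r => H; have -> : invconst * b s = \int[J]_x trig 0 (fun t => b (t + s)) x.
  by apply: (mulfI rho0); rewrite H /invconst mulrA [rho 0 * _]mulrC divfK// mulrC.
apply: (eq_trans (esym (Rintegral_D (integrable_wave 0 s (It 0))
  (integrable_wave (- (pi / 2)) s (It (- (pi / 2))))))).
by apply: eq_Rintegral => x _; rewrite E.
Qed.

(** The same argument with the sine phase; the right side vanishes because the sine transform of the
    even function [rho] is zero. *)
Lemma trig_inversion_im b s : schwartzR b ->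
  trig 0 (trig (- (pi / 2)) b) s - trig (- (pi / 2)) (trig 0 b) s = 0.
Proof.
move=> Sb; have Ib := schwartzR_integrable Sb.
have It c := schwartzR_integrable (schwartzR_trig c Sb).
have E x : trig (- (pi / 2)) (fun t => b (t + s)) x =
    trig (- (pi / 2)) b x * wave 0 x s + -1 * (trig 0 b x * wave (- (pi / 2)) x s).
  rewrite trig_translate// trig_shift// cosN sinN /wave cosBpihalf addr0 trig_subpihalf2//.
  ring.
have Is : J.-integrable setT (EFin \o trig (- (pi / 2)) (fun t => b (t + s))).
  rewrite (funext E : trig _ (fun t => b (t + s)) = _).
  exact: (integrable_D (integrable_wave 0 s (It (- (pi / 2))))
    (integrable_Z (-1) (integrable_wave (- (pi / 2)) s (It 0)))).
have [M bM] := schwartzR_bounded Sb.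
have Ibs := integrable_translation s Ib.
have cbs : continuous (fun t : 'rV[R]_d => b (t + s)).
  by apply: continuous_translation; exact: schwartzR_continuous.
have := @Rintegral_trig (- (pi / 2)) rho _ M Srho cbs (fun x => bM _) Ibs Is.
under [X in _ = _ * X -> _]eq_Rintegral do rewrite (trig_even _ even_rho (schwartzR_integrable Srho)).
rewrite [X in _ = _ * X](_ : _ = 0); last by rewrite /Rintegral integral0.
rewrite mulr0 => /eqP; rewrite mulf_eq0 (negPf rho0)/= => /eqP H.
rewrite -[RHS]H; apply: (eq_trans (esym (Rintegral_B
  (integrable_wave 0 s (It (- (pi / 2)))) (integrable_wave (- (pi / 2)) s (It 0))))).
by apply: eq_Rintegral => x _; rewrite E mulN1r.
Qed.

(** The multiplication formula and inversion applied to [rho] itself write the positive number in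
    [rho_pos] as [invconst] times the integral of [rho ^ 2], which is nonnegative. *)
Lemma invconst_gt0 : 0 < invconst.
Proof.
have It c := schwartzR_integrable (schwartzR_trig c Srho).
have Irho := schwartzR_integrable Srho.
have [M rM] := schwartzR_bounded Srho.
have I2 : J.-integrable setT (EFin \o (fun x => rho x * rho x)).
  apply: (@integrable_Mbounded _ _ _ _ _ _ M) => //.
  by apply: continuous_measurable_rV; exact: schwartzR_continuous.
move: rho_pos; have -> : \int[J]_x (trig 0 rho x) ^+ 2 = invconst * \int[J]_x (rho x * rho x).
  under eq_Rintegral do rewrite expr2.
  rewrite -(trig_sym 0 Irho (It 0)) -Rintegral_Z//; apply: eq_Rintegral => x _.
  have := trig_inversion_re x Srho.
  have -> : trig (- (pi / 2)) rho = fun=> 0.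
    by apply/funext => y; exact: trig_even.
  rewrite [X in _ + X](_ : _ = 0); last first.
    by rewrite /trig /Rintegral (eq_integral (cst 0%E)) ?integral0// => y _; rewrite mul0r.
  by rewrite addr0 => ->; rewrite mulrCA.
have : 0 <= \int[J]_x (rho x * rho x) by apply: Rintegral_ge0 => x _; rewrite -expr2 sqr_ge0.
by rewrite le_eqVlt => /predU1P[<-|/pmulr_lgt0 -> //]; rewrite mulr0 ltxx.
Qed.

End inversion.

(** * Bump functions *)

Section bump.
Variable R : realType.
Implicit Types (x t : R).

(** The classical flat function [exp (-1/x)] together with its multiples by [x ^- k]; their span is
    closed under differentiation. *)
Definition flat (k : nat) x : R := if 0 < x then x ^- k * expR (- x^-1) else 0.

(** From [y ^ N / N! <= exp y] at [y = 1 / x]. The case [n = 2] gives the zero derivative at the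
    origin, the case [n = 0] boundedness. *)
Lemma flat_le (k n : nat) x : `|flat k x| <= ((n + k)`!)%:R * `|x| ^+ n.
Proof.
rewrite /flat; case: ltP => x0; last by rewrite normr0 mulr_ge0 ?exprn_ge0.
have xk j : 0 < x ^+ j by rewrite exprn_gt0.
rewrite normrM !gtr0_norm ?expR_gt0 ?invr_gt0//.
have H : x ^- (n + k) <= ((n + k)`!)%:R * expR x^-1.
  rewrite mulrC -ler_pdivrMr ?ltr0n ?fact_gt0// -exprVn.
  case: (n + k)%N => [|N]; first by rewrite expr0 divr1 -expR0 ler_expR invr_ge0 ltW.
  by apply: le_trans (expR_ge1Dxn N _); rewrite ?lerDr// invr_ge0 ltW.
rewrite expRN ler_pdivrMr ?expR_gt0// -[leRHS]mulrAC.
rewrite -ler_pdivrMr// -invfM -exprD addnC.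
exact: H.
Qed.

Lemma flat_ge0 x : 0 <= flat 0 x.
Proof. by rewrite /flat; case: ifP => // _; rewrite mulr_ge0 ?expR_ge0 ?invr_ge0. Qed.

Lemma is_derive_flat k x : is_derive x 1 (flat k) (flat k.+2 x - k%:R * flat k.+1 x).
Proof.
have [x0|x0|->] := ltgtP x 0.
- apply: (@near_eq_is_derive _ _ _ (cst 0)).
    near=> y; rewrite /flat ltNge (_ : y <= 0)//; apply/ltW; near: y; exact: lt_nbhsl.
  have -> : flat k.+2 x - k%:R * flat k.+1 x = 0.
    by rewrite /flat ltNge (ltW x0)/= mulr0 subrr.
  exact: is_derive_cst.
- apply: (@near_eq_is_derive R R R (fun y : R => y^-1 ^+ k * expR (- y^-1))).
    near=> y; rewrite /flat exprVn (_ : 0 < y)//; near: y; exact: lt_nbhsr.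
  have xn0 : x != 0 by rewrite lt0r_neq0.
  have dV : is_derive x 1 (fun y : R => y^-1) (- x ^- 2).
    by have := is_deriveV xn0 (is_derive_id x 1); rewrite /GRing.scale/= mulr1.
  have dE : is_derive x 1 (fun y : R => expR (- y^-1)) (expR (- x^-1) * x ^- 2).
    have := @is_derive1_comp _ expR (fun y : R => - y^-1) x _ _ (is_derive_expR _) (is_deriveN dV).
    by rewrite opprK.
  have dX : is_derive x 1 (fun y : R => y^-1 ^+ k) (k%:R * (x^-1) ^+ k.-1 * (- x ^- 2)).
    have := is_deriveX k dV.
    by rewrite exprfctE.
  case: (is_deriveM dX dE) => Hd Hv; apply: DeriveDef; first exact: Hd.
  apply: (eq_trans Hv).
  rewrite /flat x0 /GRing.scale/= -!exprVn.
  case: k {dX Hd Hv} => [|k] /=; first ring.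
  rewrite !exprS expr0; ring.
- have -> : flat k.+2 0 - k%:R * flat k.+1 0 = 0 by rewrite /flat ltxx mulr0 subrr.
  have H : (fun h : R => h^-1 *: (flat k (h *: 1 + 0) - flat k 0)) @ (0 : R)^' --> (0 : R).
    apply/cvgr0Pnorm_lt => e e0.
    have C0 : 0 < ((2 + k)`!)%:R :> R by rewrite ltr0n fact_gt0.
    near=> h; rewrite addr0 [flat k 0]/flat ltxx subr0 (_ : h *: (1 : R) = h); last exact: mulr1.
    have h0 : h != 0 by near: h; exact: nbhs_dnbhs_neq.
    rewrite normrM normfV mulrC ltr_pdivrMr ?normr_gt0//.
    apply: (le_lt_trans (flat_le k 2 h)); rewrite expr2 mulrA ltr_pM2r ?normr_gt0//.
    rewrite mulrC -ltr_pdivlMr//; near: h; apply: dnbhs0_lt; by rewrite divr_gt0.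
  by apply: DeriveDef; [apply/cvg_ex; exists 0|apply: cvg_lim].
Unshelve. all: by end_near. Qed.

Variable r : R.

(** An entry [(c, j, k)] stands for [c] times [flat j] on the right edge times [flat k] on the left
    edge. All derivatives of [bump] have this form. *)
Definition bump_comb (l : seq (R * nat * nat)) t : R :=
  \sum_(p <- l) p.1.1 * (flat p.1.2 (r - t) * flat p.2 (r + t)).

Lemma bump_comb_derive l : exists l', forall t, is_derive t 1 (bump_comb l) (bump_comb l' t).
Proof.
elim: l => [|[[c j] k] l [l' IH]].
  exists [::] => t; rewrite /bump_comb.
  by under [X in is_derive _ _ X]eq_fun do rewrite big_nil; rewrite big_nil; exact: is_derive_cst.
(* The product rule and [is_derive_flat] yield four terms per entry; the first two change sign
   because [t] enters as [r - t]. *)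
exists [:: (- c, j.+2, k), (c * j%:R, j.+1, k), (c, j, k.+2), (- (c * k%:R), j, k.+1) & l'] => t.
have H1 : is_derive t 1 (fun t : R => r - t) (-1).
  by have [] := is_deriveB (is_derive_cst r t 1) (is_derive_id t 1); rewrite sub0r => *; exact: DeriveDef.
have H2 : is_derive t 1 (fun t : R => r + t) 1.
  by have [] := is_deriveD (is_derive_cst r t 1) (is_derive_id t 1); rewrite add0r => *; exact: DeriveDef.
have D1 := @is_derive1_comp _ (flat j) (fun t : R => r - t) t _ _ (is_derive_flat j (r - t)) H1.
have D2 := @is_derive1_comp _ (flat k) (fun t : R => r + t) t _ _ (is_derive_flat k (r + t)) H2.
have [D E] := is_deriveD (is_deriveZ c (is_deriveM D1 D2)) (IH t).
rewrite (_ : bump_comb ((c, j, k) :: l) =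
   (fun t => c *: ((flat j \o (fun t : R => r - t)) * (flat k \o (fun t : R => r + t))) t +
      bump_comb l t)); last first.
  by apply/funext => u; rewrite /bump_comb big_cons.
apply: DeriveDef; first exact: D.
apply: (eq_trans E); rewrite /bump_comb !big_cons /= /GRing.scale/=; ring.
Qed.

Definition bump t := flat 0 (r - t) * flat 0 (r + t).

Lemma bump_derive1n k : exists l, (bump^`(k))%classic = bump_comb l.
Proof.
elim: k => [|k [l IH]].
  exists [:: (1, 0%N, 0%N)]; apply/funext => t.
  by rewrite /bump_comb big_seq1/= mul1r.
have [l' H] := bump_comb_derive l; exists l'; apply/funext => t.
by rewrite derive1nS derive1E IH; have [] := H t.
Qed.

Lemma is_derive_bump k t : is_derive t 1 (bump^`(k))%classic ((bump^`(k.+1))%classic t).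
Proof.
have [l H] := bump_derive1n k; have [l' H'] := bump_comb_derive l.
rewrite derive1nS derive1E H; have [dl _] := H' t.
exact: DeriveDef.
Qed.

Lemma bump_bounded k : exists M : R, forall t, `|(bump^`(k))%classic t| <= M.
Proof.
have [l ->] := bump_derive1n k.
exists (\sum_(p <- l) `|p.1.1| * (((0 + p.1.2)`!)%:R * ((0 + p.2)`!)%:R)) => t.
apply: le_trans (ler_norm_sum _ _ _) _; apply: ler_sum => p _.
rewrite !normrM ler_wpM2l//; apply: ler_pM => //.
- by have := flat_le p.1.2 0 (r - t); rewrite expr0 mulr1.
- by have := flat_le p.2 0 (r + t); rewrite expr0 mulr1.
Qed.

(** The endpoints [|t| = r] are included since every [flat j] vanishes at 0, so all derivatives live
    in the open ball. *)
Lemma bump_eq0 k t : r <= `|t| -> (bump^`(k))%classic t = 0.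
Proof.
move=> rt; have [l ->] := bump_derive1n k; rewrite /bump_comb big1// => p _.
have : (r - t <= 0) \/ (r + t <= 0).
  by move: rt; rewrite ler_normr => /orP[rt|rt]; [left|right]; lra.
have f0 j u : u <= 0 -> flat j u = 0 by rewrite /flat ltNge => ->.
by case=> h; rewrite (f0 _ _ h) ?mul0r ?mulr0.
Qed.

Lemma bump_ge0 t : 0 <= bump t.
Proof. by rewrite mulr_ge0 ?flat_ge0. Qed.

Lemma bump_even t : bump (- t) = bump t.
Proof. by rewrite /bump opprK mulrC. Qed.

Lemma bump_gt0 : 0 < r -> forall t, `|t| < r -> 0 < bump t.
Proof.
move=> r0 t; rewrite ltr_norml => /andP[t1 t2].
rewrite /bump /flat subr_gt0 t2 (_ : 0 < r + t); last lra.
rewrite expr0 invr1 !mul1r mulr_gt0 ?expR_gt0//.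
Qed.

End bump.

Section bump_rV.
Variables (R : realType) (d : nat) (r : R).
Implicit Types (x v : 'rV[R]_d) (s : seq 'I_d).

Local Notation e_ i := (delta_mx ord0 i : 'rV[R]_d).

(** The derivative [pderiv s] of the tensor bump centred at [v], as [pderiv_bumpd] shows: in a
    tensor product only the multiplicity of each index in [s] counts. *)
Definition bumpd s v x : R := \prod_(i < d) ((bump r)^`(count_mem i s))%classic (x ord0 i - v ord0 i).

Lemma is_derive_bumpd s v x i : is_derive x (e_ i) (bumpd s v) (bumpd (i :: s) v x).
Proof.
apply: is_derive_line.
pose P := \prod_(j < d | j != i) ((bump r)^`(count_mem j s))%classic (x ord0 j - v ord0 j).
rewrite (_ : (fun t : R => _) = (fun t => P *:
    ((bump r)^`(count_mem i s) \o (fun t : R => t + (x ord0 i - v ord0 i))) t)%classic); last first.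
  apply/funext => t; rewrite /bumpd (bigD1 i)//= mulrC; congr (_ * _).
    by apply: eq_bigr => j /negPf ji; rewrite !mxE eqxx ji mulr0 add0r.
  by rewrite !mxE !eqxx mulr1 addrA.
have -> : bumpd (i :: s) v x = P *: ((bump r)^`((count_mem i s).+1))%classic (x ord0 i - v ord0 i).
  rewrite /bumpd (bigD1 i)//= eqxx add1n mulrC; congr (_ * _).
  by apply: eq_bigr => j /negPf ji; rewrite eq_sym ji.
have H1 : is_derive (0 : R) 1 (fun t : R => t + (x ord0 i - v ord0 i)) 1.
  by apply: is_derive_eq; rewrite addr0.
have := is_derive_bump r (count_mem i s) (0 + (x ord0 i - v ord0 i)).
move=> H2; have := @is_derive1_comp _ _ _ 0 _ _ H2 H1; rewrite mulr1 add0r.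
by move=> [D E]; apply: DeriveDef; [exact: derivableZ|rewrite deriveZ// E].
Qed.

Lemma continuous_bumpd s v : continuous (bumpd s v).
Proof.
apply: continuous_prod_rV => i x.
apply: (@continuous_comp _ _ _ (fun x : 'rV[R]_d => x ord0 i - v ord0 i)).
  apply: continuousD_rV; [exact: coord_continuous|exact: continuous_cst_rV].
apply: differentiable_continuous; apply/derivable1_diffP.
by have [] := is_derive_bump r (count_mem i s) (x ord0 i - v ord0 i).
Qed.

Lemma smooth_bumpd s v : smooth (bumpd s v).
Proof.
apply: (@smooth_coind _ _ (fun f => exists s, f = bumpd s v)); last by exists s.
move=> _ [{}s ->]; split; first exact: continuous_bumpd.
move=> i; split=> [x|]; first by have [] := is_derive_bumpd s v x i.
by exists (i :: s); apply/funext => x; have [] := is_derive_bumpd s v x i.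
Qed.

Lemma pderiv_bumpd s v : pderiv s (bumpd [::] v) = bumpd s v.
Proof.
elim: s => [//|i s IH]; rewrite /= IH.
by apply/funext => x; have [] := is_derive_bumpd s v x i.
Qed.

Lemma bumpd_bounded s : exists M : R, forall v x, `|bumpd s v x| <= M.
Proof.
have /choice[M HM] := fun i : 'I_d => bump_bounded r (count_mem i s).
exists (\prod_i M i) => v x; rewrite normr_prod; apply: ler_prod => i _.
by rewrite normr_ge0 HM.
Qed.

Lemma bumpd_eq0 s v x i : r <= `|x ord0 i - v ord0 i| -> bumpd s v x = 0.
Proof. by move=> h; rewrite /bumpd (bigD1 i)//= bump_eq0// mul0r. Qed.

Lemma bumpd_shift s v w x : bumpd s v (x + w) = bumpd s (v - w) x.
Proof.
by apply: eq_bigr => i _; rewrite !mxE; congr (derive1n _ _ _); ring.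
Qed.

End bump_rV.

Section test_functions.
Variables (R : realType) (d : nat).

Lemma schwartzR_supported (f : 'rV[R]_d -> R) (B : R) : smooth f ->
  (forall s, exists M : R, forall x, `|pderiv s f x| <= M) ->
  (forall s (x : 'rV[R]_d) i, B < `|x ord0 i| -> pderiv s f x = 0) -> schwartzR f.
Proof.
move=> sf bf f0; split => // s a; have [M fM] := bf s.
exists (\prod_i (`|B| ^+ a i) * M) => x.
have M0 : 0 <= M by apply: le_trans (fM x).
have [/existsP[i Hi]|] := boolP [exists i, B < `|x ord0 i|].
  by rewrite (f0 s x i Hi) normr0 mulr0 mulr_ge0// prodr_ge0// => j _; rewrite exprn_ge0.
rewrite negb_exists => /forallP H.
rewrite normr_prod; apply: ler_pM => //; first by rewrite prodr_ge0.
apply: ler_prod => i _; rewrite normr_ge0 normrX lerXn2r ?nnegrE//.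
by have := H i; rewrite -leNgt => /le_trans -> //; exact: ler_norm.
Qed.

Lemma schwartzR_bumpd (r : R) s (v : 'rV[R]_d) : schwartzR (bumpd r s v).
Proof.
have E t : pderiv t (bumpd r s v) = bumpd r (t ++ s) v.
  by rewrite -[bumpd r s v]pderiv_bumpd -pderiv_cat pderiv_bumpd.
apply: (@schwartzR_supported _ (`|r| + \sum_i `|v ord0 i|)).
- exact: smooth_bumpd.
- by move=> t; rewrite E; have [M HM] := bumpd_bounded r (t ++ s); exists M => x; exact: HM.
move=> t x i xi; rewrite E; apply: (@bumpd_eq0 _ _ _ _ _ _ i).
have : `|x ord0 i| <= `|x ord0 i - v ord0 i| + `|v ord0 i|.
  by rewrite -{1}(subrK (v ord0 i) (x ord0 i)) ler_normD.
have : `|v ord0 i| <= \sum_j `|v ord0 j|.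
  by rewrite (bigD1 i)//= lerDl sumr_ge0.
have := ler_norm r; lra.
Qed.

End test_functions.

(** * Rudin-Shapiro polynomials *)

Section rudin_shapiro.
Variable R : realType.
Local Notation C := R[i].

(** Coefficients of the pair [P' = P + z^(2^K) Q], [Q' = P - z^(2^K) Q]. They are total functions on
    [nat]; the polynomials have [2 ^ K] terms. *)
Fixpoint rudin_shapiro (K : nat) : (nat -> R) * (nat -> R) :=
  if K is K'.+1 then
    let ab := rudin_shapiro K' in
    (fun i => if (i < 2 ^ K')%N then ab.1 i else ab.2 (i - 2 ^ K')%N,
     fun i => if (i < 2 ^ K')%N then ab.1 i else - ab.2 (i - 2 ^ K')%N)
  else (fun=> 1, fun=> 1).

Local Notation rs K := (rudin_shapiro K).1.

Lemma rudin_shapiro_sqr K i :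
  (rudin_shapiro K).1 i ^+ 2 = 1 /\ (rudin_shapiro K).2 i ^+ 2 = 1.
Proof.
elim: K i => [|K IH] i /=; first by rewrite expr1n.
by case: ifP => _; rewrite ?sqrrN; split; apply (IH _).
Qed.

Lemma rs_sqr K i : rs K i ^+ 2 = 1.
Proof. by have [] := rudin_shapiro_sqr K i. Qed.

Definition trigpoly (a : nat -> R) (N : nat) (t : R) : C :=
  \sum_(i < N) (a i)%:C * cis (2 * pi * i%:R * t).

Lemma cisD (u v : R) : cis (u + v) = cis u * cis v :> C.
Proof. by apply/eqP; rewrite eq_complex /= cosD sinD; apply/andP; split; apply/eqP; ring. Qed.

Definition sqnorm (z : C) : R := complex.Re z ^+ 2 + complex.Im z ^+ 2.

Lemma sqnorm_cis u : sqnorm (cis u) = 1.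
Proof. exact: cos2Dsin2. Qed.

Lemma sqnormM z w : sqnorm (z * w) = sqnorm z * sqnorm w.
Proof. by case: z => a b; case: w => c e; rewrite /sqnorm /=; ring. Qed.

Lemma sqnorm_parallelogram z w :
  sqnorm (z + w) + sqnorm (z - w) = 2 * (sqnorm z + sqnorm w).
Proof. by case: z => a b; case: w => c e; rewrite /sqnorm /=; ring. Qed.

Lemma normc_sqnorm z : normc z = Num.sqrt (sqnorm z).
Proof. by case: z. Qed.

(** The parallelogram law for [P] and [z^(2^K) Q] doubles the sum at each step, since the modulus of
    [z] is 1. *)
Lemma rudin_shapiro_sqnorm K t :
  sqnorm (trigpoly (rudin_shapiro K).1 (2 ^ K) t) +
  sqnorm (trigpoly (rudin_shapiro K).2 (2 ^ K) t) = 2 ^+ K.+1.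
Proof.
elim: K => [|K IH].
  rewrite /trigpoly !big_ord1 !mulr0 !mul0r /cis cos0 sin0 /sqnorm/=; ring.
(* Both recursions at once: [e] is the sign of the second half of the coefficients. *)
have split_ (a b : nat -> R) (c : nat -> R) (e : R) : (forall i, (i < 2 ^ K)%N -> c i = a i) ->
    (forall i, c (2 ^ K + i)%N = e * b i) ->
    trigpoly c (2 ^ K.+1) t = trigpoly a (2 ^ K) t +
      (e%:C * cis (2 * pi * (2 ^ K)%:R * t)) * trigpoly b (2 ^ K) t.
  move=> ca cb; rewrite /trigpoly expnS mul2n -addnn big_split_ord/=; congr (_ + _).
    by apply: eq_bigr => i _; rewrite ca.
  rewrite mulr_sumr; apply: eq_bigr => i _.
  rewrite cb natrD mulrDr mulrDl cisD rmorphM/=; ring.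
rewrite (split_ (rudin_shapiro K).1 (rudin_shapiro K).2 _ 1); first last.
- by move=> i /=; rewrite ltnNge leq_addr/= addKn mul1r.
- by move=> i /= ->.
rewrite (split_ (rudin_shapiro K).1 (rudin_shapiro K).2 (rudin_shapiro K.+1).2 (-1)); first last.
- by move=> i /=; rewrite ltnNge leq_addr/= addKn mulN1r.
- by move=> i /= ->.
rewrite rmorph1 mul1r rmorphN1 mulN1r mulNr sqnorm_parallelogram.
by rewrite sqnormM sqnorm_cis mul1r IH -exprS.
Qed.

Lemma rs_normc K t : normc (trigpoly (rs K) (2 ^ K) t) <= Num.sqrt (2 ^+ K.+1).
Proof.
rewrite normc_sqnorm ler_wsqrtr// -(rudin_shapiro_sqnorm K t) lerDl.
by rewrite addr_ge0 ?sqr_ge0.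
Qed.

Lemma cos_2pin (n : nat) : cos (2 * pi * n%:R) = 1 :> R /\ sin (2 * pi * n%:R) = 0 :> R.
Proof.
elim: n => [|n [IHc IHs]]; first by rewrite mulr0 cos0 sin0.
rewrite -[n.+1%:R]natr1 mulrDr mulr1 cosD sinD IHc IHs (mulr_natl pi 2) cos2pi sin2pi.
by rewrite !mul1r !mul0r subr0 addr0.
Qed.

Local Notation leb1 := (@lebesgue_measure R).

Lemma integrable_segment (f : R -> R) : continuous f ->
  leb1.-integrable `[0, 1] (EFin \o f).
Proof.
move=> cf; apply: continuous_compact_integrable; first exact: segment_compact.
exact: continuous_subspaceT.
Qed.

Lemma continuous_cos_affine (a b : R) : continuous (fun t : R => cos (a * t + b)).
Proof.
move=> t; apply: differentiable_continuous; apply/derivable1_diffP.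
by have [] := is_derive_cos_affine a b t.
Qed.

Lemma integral_cos_diff (n l : nat) :
  \int[leb1]_(t in `[0, 1]) cos (2 * pi * n%:R * t - 2 * pi * l%:R * t) = (n == l)%:R.
Proof.
have [->|nl] := eqVneq n l.
  under eq_Rintegral do rewrite subrr cos0.
  by rewrite /Rintegral integral_cst//= lebesgue_measure_itv/= lte01 oppr0 adde0 mul1e.
pose k : R := 2 * pi * (n%:R - l%:R).
have k0 : k != 0.
  by rewrite !mulf_neq0 ?subr_eq0 ?eqr_nat// lt0r_neq0 ?pi_gt0.
(* This primitive is [sin (k t) / k], written as a shifted cosine so that [is_derive_cos_affine]
   applies. *)
pose F (t : R) : R := k^-1 * cos (k * t + - (pi / 2)).
have dF (t : R) : is_derive t 1 F (cos (k * t + 0)).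
  have [D E] := is_deriveZ k^-1 (is_derive_cos_affine k (- (pi / 2)) t).
  apply: DeriveDef; first exact: D.
  apply: (eq_trans E); rewrite /GRing.scale/= mulKf// -addrA.
  by rewrite (_ : - (pi / 2) + pi / 2 = 0) // addNr.
transitivity (\int[leb1]_(t in `[0, 1]) cos (k * t + 0)).
  by apply: eq_Rintegral => t _; rewrite addr0 /k mulrBr mulrBl.
have cF (t : R) : F u @[u --> t] --> F t.
  by apply: differentiable_continuous; apply/derivable1_diffP; have [] := dF t.
have E : (\int[leb1]_(t in `[0%R, 1%R]) (cos (k * t + 0))%:E = (F 1)%:E - (F 0)%:E)%E.
  apply: (@continuous_FTC2 R (fun t => cos (k * t + 0)) F 0 1) => //.
  - exact/continuous_subspaceT/continuous_cos_affine.
  - split.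
    + by move=> t _; have [] := dF t.
    + by apply: cvg_at_right_filter; exact: cF.
    + by apply: cvg_at_left_filter; exact: cF.
  - by move=> t _; rewrite derive1E; have [] := dF t.
rewrite /Rintegral E /F /= mulr0 mulr1 !cosBpihalf sin0 mulr0 subr0.
rewrite /k mulrBr sinB; have [-> ->] := cos_2pin n; have [-> ->] := cos_2pin l.
by rewrite mulr0 mul0r subrr mulr0.
Qed.

(** At frequency [l] its coefficient is [rs K.+1 l] times the number of pairs with [i + j = l]. *)
Definition rs_sum K t : C :=
  \sum_(i < 2 ^ K) \sum_(j < 2 ^ K) (rs K.+1 (i + j)%N)%:C * cis (2 * pi * (i + j)%:R * t).

Lemma continuous_sumR (I : Type) (r : seq I) (c : I -> R) (F : I -> R -> R) :
  (forall i, continuous (F i)) -> continuous (fun t : R => \sum_(i <- r) c i * F i t).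
Proof.
move=> cF; elim: r => [|j r IH].
  by under eq_fun do rewrite big_nil; exact: cst_continuous.
under eq_fun do rewrite big_cons; move=> t; apply: (@cvgD _ _ _ _ _ (fun t => c j * F j t)).
  by apply: cvgM; [exact: cvg_cst|exact: cF].
exact: IH.
Qed.

Lemma Rintegral_segment_sum (I : Type) (r : seq I) (c : I -> R) (F : I -> R -> R) :
  (forall i, continuous (F i)) ->
  \int[leb1]_(t in `[0, 1]) (\sum_(i <- r) c i * F i t) =
  \sum_(i <- r) c i * \int[leb1]_(t in `[0, 1]) F i t.
Proof.
move=> cF; elim: r => [|i r IH].
  under eq_Rintegral do rewrite big_nil.
  by rewrite big_nil /Rintegral integral0.
under eq_Rintegral do rewrite big_cons.
have cS : continuous (fun t : R => \sum_(j <- r) c j * F j t) by exact: continuous_sumR.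
rewrite big_cons -IH RintegralD//.
- by rewrite RintegralZl//; exact: integrable_segment.
- apply: (@integrable_segment (fun t => c i * F i t)) => t.
  by apply: cvgM; [exact: cvg_cst|exact: cF].
- exact: integrable_segment.
Qed.

(** The real part of [z] times the conjugate of [w], which suffices for a duality argument with real
    signs. *)
Definition cinner (z w : C) : R := complex.Re z * complex.Re w + complex.Im z * complex.Im w.

Lemma cinner_le z w : cinner z w <= normc z * normc w.
Proof.
case: z => a b; case: w => c e; rewrite /cinner/= -sqrtrM ?addr_ge0 ?sqr_ge0//.
apply: (le_trans (ler_norm _)); rewrite -sqrtr_sqr ler_wsqrtr//.
have := sqr_ge0 (a * e - b * c); nra.
Qed.

Lemma cinner_suml (I : Type) (r : seq I) (z : I -> C) w :
  cinner (\sum_(i <- r) z i) w = \sum_(i <- r) cinner (z i) w.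
Proof.
apply: (big_morph (cinner^~ w)) => [x y|].
  by case: x => a b; case: y => c e; rewrite /cinner/=; ring.
by rewrite /cinner/= !mul0r addr0.
Qed.

Lemma cinnerC z w : cinner z w = cinner w z.
Proof. by rewrite /cinner mulrC [X in _ + X]mulrC. Qed.

Lemma cinner_cis a b u v :
  cinner (a%:C * cis u) (b%:C * cis v) = a * b * cos (u - v).
Proof. by rewrite /cinner /= cosB; ring. Qed.

Lemma continuous_normc_trig (I : Type) (r : seq I) (c u : I -> R) :
  continuous (fun t => normc (\sum_(i <- r) (c i)%:C * cis (u i * t))).
Proof.
have cS (b : R) : continuous (fun t : R => \sum_(i <- r) c i * cos (u i * t + b)).
  by apply: continuous_sumR => i; exact: continuous_cos_affine.
rewrite (_ : (fun t => _) = fun t : R => Num.sqrt (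
    (\sum_(i <- r) c i * cos (u i * t + 0)) ^+ 2 +
    (\sum_(i <- r) c i * cos (u i * t + - (pi / 2))) ^+ 2)); last first.
  apply/funext => t; rewrite normc_sqnorm /sqnorm.
  rewrite !raddf_sum/=; congr (Num.sqrt (_ ^+ 2 + _ ^+ 2)); apply: eq_bigr => i _.
    by rewrite addr0; ring.
  by rewrite cosBpihalf; ring.
have cS2 b : continuous (fun t : R => (\sum_(i <- r) c i * cos (u i * t + b)) ^+ 2).
  move=> t; apply: (@continuous_comp R R R _ (fun y : R => y ^+ 2)); first exact: cS.
  exact: exprn_continuous.
move=> t; apply: (@continuous_comp R R R (fun t : R =>
    (\sum_(i <- r) c i * cos (u i * t + 0)) ^+ 2 +
    (\sum_(i <- r) c i * cos (u i * t + - (pi / 2))) ^+ 2) Num.sqrt).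
  exact: (cvgD (cS2 _ t) (cS2 _ t)).
exact: sqrt_continuous.
Qed.

Lemma rs_sumE K t : rs_sum K t = \sum_(p : 'I_(2 ^ K) * 'I_(2 ^ K))
  (rs K.+1 (p.1 + p.2)%N)%:C * cis ((2 * pi * (p.1 + p.2)%:R) * t).
Proof. by rewrite /rs_sum pair_bigA. Qed.

Lemma continuous_rs_sum K : continuous (fun t => normc (rs_sum K t)).
Proof.
under eq_fun do rewrite rs_sumE.
exact: continuous_normc_trig.
Qed.

(** In the pairing with the polynomial of [rs K.+1] every pair [(i, j)] contributes a squared sign,
    that is 1, and there are [4 ^ K] pairs; the factor in front is the sup bound on that
    polynomial. *)
Lemma rs_sum_lower K :
  4 ^+ K <= Num.sqrt (2 ^+ K.+2) * \int[leb1]_(t in `[0, 1]) normc (rs_sum K t).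
Proof.
pose P := trigpoly (rs K.+1) (2 ^ K.+1).
pose T := ('I_(2 ^ K) * 'I_(2 ^ K) * 'I_(2 ^ K.+1))%type.
pose c (q : T) := rs K.+1 (q.1.1 + q.1.2)%N * rs K.+1 q.2.
pose F (q : T) (t : R) := cos (2 * pi * (q.1.1 + q.1.2)%:R * t - 2 * pi * q.2%:R * t).
have E t : cinner (rs_sum K t) (P t) = \sum_(q : T) c q * F q t.
  rewrite rs_sumE cinner_suml -(pair_bigA _ (fun p l => c (p, l) * F (p, l) t))/=.
  apply: eq_bigr => p _; rewrite cinnerC cinner_suml; apply: eq_bigr => l _.
  by rewrite cinnerC cinner_cis.
have cF q : continuous (F q).
  rewrite (_ : F q = fun t => cos ((2 * pi * (q.1.1 + q.1.2)%:R - 2 * pi * q.2%:R) * t + 0)).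
    exact: continuous_cos_affine.
  by apply/funext => t; rewrite addr0 mulrBl.
have -> : 4 ^+ K = \int[leb1]_(t in `[0, 1]) (\sum_(q : T) c q * F q t).
  rewrite Rintegral_segment_sum// -(pair_bigA _ (fun p l => c (p, l) * \int[leb1]_(t in `[0, 1]) F (p, l) t))/=.
  rewrite (eq_bigr (fun=> 1)); last first.
    (* The sum [i + j] may exceed [2 ^ K], so the dual polynomial is taken one level higher;
       orthogonality then picks the single index [l = i + j]. *)
    move=> p _; have lt_ij : (p.1 + p.2 < 2 ^ K.+1)%N.
      by rewrite expnS mul2n -addnn; have := ltn_ord p.1; have := ltn_ord p.2; lia.
    rewrite (bigD1 (Ordinal lt_ij))//= big1 ?addr0; last first.
      move=> l lij; rewrite /F integral_cos_diff/= (_ : _ == _ = false) ?mulr0//.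
      by apply/negbTE; apply: contra lij => /eqP/= h; apply/eqP/val_inj.
    by rewrite /F integral_cos_diff eqxx mulr1 /c -expr2; exact: rs_sqr.
  rewrite sumr_const card_prod !card_ord -[1 *+ _]/(_%:R) natrM natrX -exprMn; congr (_ ^+ _); ring.
rewrite -RintegralZl//; last by apply: integrable_segment; exact: continuous_rs_sum.
apply: le_Rintegral => //.
- by apply: integrable_segment; exact: continuous_sumR.
- apply: (@integrable_segment (fun t => Num.sqrt (2 ^+ K.+2) * normc (rs_sum K t))) => t.
  by apply: cvgM; [exact: cvg_cst|exact: continuous_rs_sum].
move=> t _; rewrite -E; apply: (le_trans (cinner_le _ _)).
rewrite mulrC ler_wpM2r ?rs_normc// normc_sqnorm; exact: sqrtr_ge0.
Qed.

End rudin_shapiro.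

(** * The multiplier and its Bessel potential *)

Section pderiv_linear.
Variables (R : realType) (d : nat).
Implicit Types (f : 'rV[R]_d -> R).

Lemma pderivZ s (c : R) f : smooth f -> pderiv s (fun x => c * f x) = fun x => c * pderiv s f x.
Proof.
move=> sf; elim: s => [//|i s IH]; rewrite /= IH; apply/funext => x.
by rewrite deriveZ_rV//; exact: smooth_derivable (smooth_pderiv s sf).
Qed.

Lemma smoothZ (c : R) f : smooth f -> smooth (fun x => c * f x).
Proof.
move=> sf; have := smoothZD c sf (@smooth_cst R d 0).
by under eq_fun do rewrite addr0.
Qed.

Lemma trig_sum c (I : Type) (l : seq I) (a : I -> R) (F : I -> 'rV[R]_d -> R) xi :
  (forall i, (leb R d).-integrable setT (EFin \o F i)) ->
  trig c (fun x => \sum_(i <- l) a i * F i x) xi = \sum_(i <- l) a i * trig c (F i) xi.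
Proof.
move=> IF; rewrite /trig -Rintegral_sumR; last by move=> i; exact: integrable_wave.
by apply: eq_Rintegral => x _; rewrite mulr_suml; apply: eq_bigr => i _; rewrite mulrA.
Qed.

(* [(I - Delta)^k] is the sum of the [c * pderiv s] over the pairs [(c, s)] of this list. *)
Fixpoint bessel_terms (k : nat) : seq (R * seq 'I_d) :=
  if k is k'.+1 then
    flatten [seq (p.1, p.2) :: [seq (- p.1, [:: i, i & p.2]) | i <- index_enum 'I_d]
            | p <- bessel_terms k']
  else [:: (1, [::])].

Definition bessel_op k f x : R := \sum_(p <- bessel_terms k) p.1 * pderiv p.2 f x.

(** By [trig_dd2] each second derivative, taken with a minus sign, multiplies the transform by
    [4 * pi ^+ 2 * xi_i ^+ 2]; one factor of the symbol arises per induction step. *)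
Lemma trig_bessel_op c k f xi : schwartzR f ->
  trig c (bessel_op k f) xi = (1 + 4 * pi ^+ 2 * normsq xi) ^+ k * trig c f xi.
Proof.
move=> Sf; have Ip s := schwartzR_integrable (schwartzR_pderiv s Sf).
rewrite trig_sum//; elim: k => [|k IH] /=; first by rewrite big_seq1/= expr0.
rewrite big_flatten big_map exprS -mulrA -IH mulr_sumr; apply: eq_bigr => -[a s] _ /=.
rewrite big_cons big_map/=.
rewrite (eq_bigr (fun i => (4 * pi ^+ 2 * (a * trig c (pderiv s f) xi)) * (xi ord0 i * xi ord0 i))); last first.
  move=> i _; have := trig_dd2 c i xi (schwartzR_pderiv s Sf) => /= ->; ring.
by rewrite -mulr_sumr /normsq /dot; ring.
Qed.

Definition symbolM k f x : R := (1 + 4 * pi ^+ 2 * normsq x) ^+ k * f x.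

Lemma schwartzR_symbolM k f : schwartzR f -> schwartzR (symbolM k f).
Proof.
elim: k f => [|k IH] f Sf.
  by rewrite (_ : symbolM _ _ = f)//; apply/funext => x; rewrite /symbolM expr0 mul1r.
rewrite (_ : symbolM _ _ = symbolM k (fun x => 1 * f x +
    \sum_(i <- index_enum 'I_d) (4 * pi ^+ 2) * (x ord0 i * (x ord0 i * f x)))).
  apply: IH; apply: (schwartzR_ZD 1 Sf); apply: schwartzR_sum => i.
  by do 2 apply: schwartzR_coordM.
apply/funext => x; rewrite /symbolM exprSr -mulrA; congr (_ * _).
rewrite -mulr_sumr /normsq /dot mul1r mulrDl mul1r -mulrA mulr_suml; congr (_ + _ * _).
by apply: eq_bigr => i _; rewrite mulrA.
Qed.

End pderiv_linear.

Section multiplier.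
Variables (R : realType) (n : nat).
Local Notation N := n.+1.
Local Notation D := (N + N)%N.
Local Notation i0 := (lshift N (ord0 : 'I_N)).
Local Notation i1 := (rshift N (ord0 : 'I_N)).
Local Notation J := (leb R D).
Variable r : R.
Hypothesis r6 : r <= 1 / 6.

Lemma r_le_half : r <= 1 / 2.
Proof. by move: r6 => h; lra. Qed.

(* [Num.truncn] is 0 on negative numbers, so this is the nearest natural number to [t]. *)
Definition rnd (t : R) : nat := Num.truncn (t + 1 / 2).

Lemma rnd_eq (t : R) (p : nat) : `|t - p%:R| < 1 / 2 -> rnd t = p.
Proof.
rewrite ltr_norml => /andP[h1 h2]; apply/eqP; rewrite /rnd.
have t0 : 0 <= t + 1 / 2 by have := ler0n R p; lra.
by rewrite truncn_eq// -[p.+1%:R]natr1; apply/andP; split; lra.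
Qed.

Definition cen (p q : nat) : 'rV[R]_D :=
  \row_i (if i == i0 then p%:R else if i == i1 then q%:R else 0).

(** The infinite sum of the bumps [A p q] at [cen p q], or of their [s]-derivatives: the supports
    are disjoint, so rounding the two active coordinates selects the only term that can be
    nonzero. *)
Definition mult (A : nat -> nat -> R) (s : seq 'I_D) (z : 'rV[R]_D) : R :=
  A (rnd (z ord0 i0)) (rnd (z ord0 i1)) *
  bumpd r s (cen (rnd (z ord0 i0)) (rnd (z ord0 i1))) z.

Lemma cen0 p q : cen p q ord0 i0 = p%:R.
Proof. by rewrite mxE eqxx. Qed.

Lemma cen1 p q : cen p q ord0 i1 = q%:R.
Proof. by rewrite mxE eqxx eq_rlshift. Qed.

Lemma mult_at A s (z : 'rV[R]_D) p q :
  `|z ord0 i0 - p%:R| < r -> `|z ord0 i1 - q%:R| < r ->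
  mult A s z = A p q * bumpd r s (cen p q) z.
Proof.
move=> h0 h1.
have r2 := r_le_half.
have -> : p = rnd (z ord0 i0) by apply/esym/rnd_eq; exact: lt_le_trans h0 r2.
by have -> : q = rnd (z ord0 i1) by apply/esym/rnd_eq; exact: lt_le_trans h1 r2.
Qed.

(** Rounding jumps at half-integers, but there all bumps vanish, so one centre serves a whole
    neighbourhood. The neighbourhood is independent of [s], hence derivatives can be compared on
    it. *)
Lemma mult_local A (z : 'rV[R]_D) : exists p q, \forall y \near z, forall s : seq 'I_D,
  mult A s y = A p q * bumpd r s (cen p q) y.
Proof.
set p := rnd (z ord0 i0); set q := rnd (z ord0 i1); exists p, q.
have near_coord i : \forall y \near z, `|(y : 'rV[R]_D) ord0 i - z ord0 i| < 1 / 6.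
  have := @coord_continuous R 1 D ord0 i z; move=> /(@cvgrPdist_lt _ _ _ (nbhs z))/(_ (1 / 6)).
  by rewrite divr_gt0// => /(_ isT); apply: filterS => y; rewrite distrC.
have r6' := r6.
(* If [y] and a nearby [z'] round differently, [y] is outside the bumps of both integers; being
   inside one would put both points within [1/6 + 1/6 < 1/2] of that integer. *)
have key (y z' : R) (p' : nat) : `|y - z'| < 1 / 6 -> p' = rnd z' -> rnd y <> p' ->
    r <= `|y - (rnd y)%:R| /\ r <= `|y - p'%:R|.
  move=> yz -> ne; split; rewrite leNgt; apply/negP => h; apply: ne.
    apply/esym/rnd_eq; rewrite -(subrKA y) (le_lt_trans (ler_normD _ _))// distrC.
    lra.
  by apply: rnd_eq; lra.
near=> y => s.
have y0 : `|y ord0 i0 - z ord0 i0| < 1 / 6 by near: y; exact: near_coord.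
have y1 : `|y ord0 i1 - z ord0 i1| < 1 / 6 by near: y; exact: near_coord.
have [e0|/(key _ _ _ y0 erefl)[a0 b0]] := pselect (rnd (y ord0 i0) = p); last first.
  rewrite /mult (@bumpd_eq0 _ _ _ _ _ _ i0) ?cen0//.
  by rewrite (@bumpd_eq0 _ _ _ _ (cen p q) _ i0) ?cen0// !mulr0.
have [e1|/(key _ _ _ y1 erefl)[a1 b1]] := pselect (rnd (y ord0 i1) = q); last first.
  rewrite /mult (@bumpd_eq0 _ _ _ _ _ _ i1) ?cen1//.
  by rewrite (@bumpd_eq0 _ _ _ _ (cen p q) _ i1) ?cen1// !mulr0.
by rewrite /mult e0 e1.
Unshelve. all: by end_near. Qed.

Lemma smooth_mult A : smooth (mult A [::]).
Proof.
apply: smooth_local => z; have [p [q H]] := mult_local A z.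
exists (fun y => A p q * bumpd r [::] (cen p q) y); first exact/smoothZ/smooth_bumpd.
by apply: filterS H => y; apply.
Qed.

Lemma pderiv_mult A s : pderiv s (mult A [::]) = mult A s.
Proof.
apply/funext => z; have [p [q H]] := mult_local A z.
have H0 : \forall y \near z, mult A [::] y = A p q * bumpd r [::] (cen p q) y.
  by apply: filterS H => y; apply.
rewrite (nbhs_singleton (pderiv_near s H0)) (nbhs_singleton H).
by rewrite pderivZ ?pderiv_bumpd//; exact: smooth_bumpd.
Qed.

Lemma mult_neq0 A s z : mult A s z != 0 ->
  A (rnd (z ord0 i0)) (rnd (z ord0 i1)) != 0 /\
  forall i, `|z ord0 i - cen (rnd (z ord0 i0)) (rnd (z ord0 i1)) ord0 i| < r.
Proof.
rewrite mulf_eq0 negb_or => /andP[? h]; split=> // i.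
by rewrite ltNge; apply: contra h => h; rewrite (bumpd_eq0 _ h).
Qed.

Lemma mult_bound s : exists M : R, forall A z,
  `|mult A s z| <= `|A (rnd (z ord0 i0)) (rnd (z ord0 i1))| * M.
Proof.
have [M HM] := bumpd_bounded r s; exists M => A z.
by rewrite normrM ler_wpM2l.
Qed.

Lemma schwartzR_mult_trunc A (a : R) (K : nat) : (forall p q, `|A p q| <= a) ->
  (forall p q, A p q != 0 -> (p < K)%N && (q < K)%N) -> schwartzR (mult A [::]).
Proof.
move=> Aa AK; apply: (@schwartzR_supported _ _ _ (K%:R + 1)).
- exact: smooth_mult.
- move=> s; have [M HM] := mult_bound s; exists (a * `|M|) => z; rewrite pderiv_mult.
  apply: (le_trans (HM A z)); apply: (le_trans (ler_wpM2l (normr_ge0 _) (ler_norm M))).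
  by rewrite ler_wpM2r.
move=> s z i zi; rewrite pderiv_mult; apply/eqP; apply: contraTT zi => /mult_neq0[/AK/andP[pK qK]].
move=> /(_ i); rewrite -leNgt; set p := rnd _; set q := rnd _; rewrite mxE => zi.
have r6' := r6.
have [c c0 cK] : exists2 c : R, 0 <= c <= K%:R & `|z ord0 i - c| < r.
  exists (if i == i0 then p%:R else if i == i1 then q%:R else 0) => //.
  by do 2?case: ifP => _; rewrite ?lexx ?ler0n ?ler_nat//= ltnW.
have := ler_normD (z ord0 i - c) c; rewrite subrK => h.
apply: (le_trans h); have /andP[c1 c2] := c0; rewrite (ger0_norm c1); lra.
Qed.

Lemma continuous_mult A s : continuous (mult A s).
Proof. by rewrite -pderiv_mult; apply: smooth_continuous; exact/smooth_pderiv/smooth_mult. Qed.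

Variable A : nat -> nat -> R.
Variable a : R.
Hypothesis Aa : forall p q, `|A p q| <= a.

Definition trunc_coef (K : nat) p q : R := if (p < K)%N && (q < K)%N then A p q else 0.

Lemma bessel_op_mult B k : bessel_op k (mult B [::]) =
  fun z => \sum_(p <- bessel_terms R D k) p.1 * mult B p.2 z.
Proof. by apply/funext => z; apply: eq_bigr => p _; rewrite pderiv_mult. Qed.

(** The constant is uniform in the coefficients, so it can be fixed first and the coefficients
    normalised by it afterwards. *)
Lemma bessel_op_mult_bound k : exists M : R, 0 <= M /\ forall B z,
  `|bessel_op k (mult B [::]) z| <= `|B (rnd (z ord0 i0)) (rnd (z ord0 i1))| * M.
Proof.
have /choice[M HM] := mult_bound.
exists (\sum_(p <- bessel_terms R D k) `|p.1| * `|M p.2|); split.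
  by apply: sumr_ge0 => p _; rewrite mulr_ge0.
move=> B z; rewrite bessel_op_mult mulr_sumr.
apply: (le_trans (ler_norm_sum _ _ _)); apply: ler_sum => p _.
rewrite normrM mulrCA ler_wpM2l//; apply: (le_trans (HM _ _ _)).
by rewrite ler_wpM2l// ler_norm.
Qed.

(** Locality of the differential operator: all derivatives of a bump vanish where the bump does. *)
Lemma bessel_op_mult_neq0 B k z : bessel_op k (mult B [::]) z != 0 ->
  forall i, `|z ord0 i - cen (rnd (z ord0 i0)) (rnd (z ord0 i1)) ord0 i| < r.
Proof.
move=> h i; rewrite ltNge; apply: contra h => hi.
rewrite bessel_op_mult big1 ?eqxx// => p _.
by rewrite /mult (bumpd_eq0 _ hi) !mulr0.
Qed.

Lemma continuous_bessel_op_mult B k : continuous (bessel_op k (mult B [::])).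
Proof.
rewrite bessel_op_mult; apply: continuous_sum_rV => p.
by apply: continuousM_rV; [exact: continuous_cst_rV|exact: continuous_mult].
Qed.

(* The identity holds for the compactly supported truncations of the coefficients. *)
Lemma bessel_op_trig c k phi : schwartzR phi ->
  \int[J]_x (bessel_op k (mult A [::]) x * trig c phi x) =
  \int[J]_x (mult A [::] x * trig c (symbolM k phi) x).
Proof.
move=> Sphi; have Spsi := schwartzR_symbolM k Sphi.
have It f : schwartzR f -> J.-integrable setT (EFin \o trig c f).
  by move=> Sf; exact: schwartzR_integrable (schwartzR_trig c Sf).
have Ta K p q : `|trunc_coef K p q| <= a.
  by rewrite /trunc_coef; case: ifP => // _; rewrite normr0 (le_trans _ (Aa 0 0)).
have Su K : schwartzR (mult (trunc_coef K) [::]).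
  apply: (@schwartzR_mult_trunc _ a K) => // p q.
  by rewrite /trunc_coef; case: ifP => //; rewrite eqxx.
have E K : \int[J]_x (bessel_op k (mult (trunc_coef K) [::]) x * trig c phi x) =
    \int[J]_x (mult (trunc_coef K) [::] x * trig c (symbolM k phi) x).
  have Iu := schwartzR_integrable (Su K).
  have Sh : schwartzR (bessel_op k (mult (trunc_coef K) [::])).
    by apply: schwartzR_sum => p; exact: schwartzR_pderiv.
  have Ih := schwartzR_integrable Sh.
  rewrite (trig_sym c Ih (schwartzR_integrable Sphi)) (trig_sym c Iu (schwartzR_integrable Spsi)).
  apply: eq_Rintegral => x _; rewrite trig_bessel_op// /symbolM; ring.
(* At a fixed point the truncated integrand is eventually constant, namely once [K] exceeds both
   rounded indices; the uniform bound [M] allows dominated convergence. *)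
have cvgT (F : (nat -> nat -> R) -> 'rV[R]_D -> R) (g : 'rV[R]_D -> R) (M : R) :
    (forall B, continuous (F B)) ->
    (forall B (z : 'rV[R]_D), (forall p q, `|B p q| <= a) -> `|F B z| <= M) ->
    (forall B (z : 'rV[R]_D), B (rnd (z ord0 i0)) (rnd (z ord0 i1)) = A (rnd (z ord0 i0)) (rnd (z ord0 i1)) ->
      F B z = F A z) ->
    J.-integrable setT (EFin \o g) ->
    (fun K => \int[J]_x (F (trunc_coef K) x * g x)) @ \oo --> \int[J]_x (F A x * g x).
  move=> cF FM Floc Ig.
  have mg : measurable_fun setT g by apply/measurable_EFinP; case/integrableP: Ig.
  apply: (@Rintegral_dominated_cvg _ _ _ _ _ _ (fun x => M * `|g x|)).
  - by move=> K; apply: measurable_funM => //; exact: continuous_measurable_rV.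
  - by apply: integrable_Z; exact: integrable_norm.
  - move=> z; apply: cvg_near_cst; near=> K; rewrite (Floc (trunc_coef K))//.
    rewrite /trunc_coef ifT//; apply/andP; split; near: K; exact: nbhs_infty_gt.
  - by move=> K z; rewrite normrM ler_wpM2r// FM.
have [M0 [M0_ge0 HM0]] := bessel_op_mult_bound k.
have [M1 HM1] := mult_bound [::].
have L1 := cvgT (fun B => bessel_op k (mult B [::])) (trig c phi) (a * M0)
  (fun B => @continuous_bessel_op_mult B k) _ _ (It _ Sphi).
have L2 := cvgT (fun B => mult B [::]) (trig c (symbolM k phi)) (a * `|M1|)
  (fun B => @continuous_mult B [::]) _ _ (It _ Spsi).
apply: (cvg_unique _ (L1 _ _)) => //.
- move=> B z HB; apply: (le_trans (HM0 B z)); exact: ler_wpM2r.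
- by move=> B z HB; rewrite !bessel_op_mult /mult; apply: eq_bigr => p _; rewrite HB.
rewrite (_ : (fun K => _) = fun K =>
  \int[J]_x (mult (trunc_coef K) [::] x * trig c (symbolM k phi) x)); last first.
  exact/funext.
apply: L2.
- move=> B z HB; apply: (le_trans (HM1 B z)).
  by apply: (le_trans (ler_wpM2l (normr_ge0 _) (ler_norm M1))); exact: ler_wpM2r.
- by move=> B z HB; rewrite /mult HB.
Unshelve. all: by end_near. Qed.

End multiplier.

(** * Complex-valued functions *)

Section complex_glue.
Variables (R : realType) (d : nat).
Local Notation C := R[i].
Local Notation J := (leb R d).
Implicit Types (u v f : 'rV[R]_d -> R) (phi : 'rV[R]_d -> C).

Lemma normc_real (a : R) : normc a%:C = `|a|.
Proof. by rewrite /= expr0n addr0 sqrtr_sqr. Qed.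

Lemma Re_le_normc (z : C) : `|complex.Re z| <= normc z.
Proof. by case: z => a b; rewrite /= -sqrtr_sqr ler_wsqrtr// lerDl sqr_ge0. Qed.

Lemma Im_le_normc (z : C) : `|complex.Im z| <= normc z.
Proof. by case: z => a b; rewrite /= -sqrtr_sqr ler_wsqrtr// lerDr sqr_ge0. Qed.

Lemma normc_le_ReIm (z : C) : normc z <= `|complex.Re z| + `|complex.Im z|.
Proof.
case: z => a b /=; rewrite -[leRHS]ger0_norm ?addr_ge0// -sqrtr_sqr ler_wsqrtr//.
by rewrite sqrrD !real_normK ?num_real// lerD2r lerDl mulrn_wge0// mulr_ge0.
Qed.

Lemma pderiv0 s : pderiv s (fun _ : 'rV[R]_d => 0) = fun=> 0.
Proof. by elim: s => [//|i s IH] /=; rewrite IH; apply/funext => x; exact: derive_cst. Qed.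

Lemma smoothC_real f : smooth f -> smoothC (fun x => (f x)%:C).
Proof. by move=> sf; split; [exact: sf|exact: smooth_cst]. Qed.

Lemma pderivC_real s f x : pderivC s (fun x => (f x)%:C) x = (pderiv s f x)%:C.
Proof. by rewrite /pderivC /= pderiv0. Qed.

Lemma schwartz_Re phi : schwartz phi -> schwartzR (fun x => complex.Re (phi x)).
Proof.
move=> [[sR _] dec]; split => // s a; have [M HM] := dec a s; exists M => x.
apply: le_trans (HM x); rewrite ler_wpM2l//.
exact: (Re_le_normc (pderivC s phi x)).
Qed.

Lemma schwartz_Im phi : schwartz phi -> schwartzR (fun x => complex.Im (phi x)).
Proof.
move=> [[_ sI] dec]; split => // s a; have [M HM] := dec a s; exists M => x.
apply: le_trans (HM x); rewrite ler_wpM2l//.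
exact: (Im_le_normc (pderivC s phi x)).
Qed.

Lemma schwartz_ReIm phi : schwartzR (fun x => complex.Re (phi x)) ->
  schwartzR (fun x => complex.Im (phi x)) -> schwartz phi.
Proof.
move=> [sR dR] [sI dI]; split; first by split.
move=> a s; have [M HM] := dR s a; have [M' HM'] := dI s a; exists (M + M') => x.
apply: le_trans (lerD (HM x) (HM' x)); rewrite -mulrDr ler_wpM2l//.
exact: (normc_le_ReIm (pderivC s phi x)).
Qed.

Lemma Re_mul_cisN (z : C) (t : R) :
  complex.Re (z * cis (- t)) = complex.Re z * cos (t + 0) + complex.Im z * cos (t + - (pi / 2)).
Proof. by case: z => a b; rewrite /= addr0 cosN sinN cosBpihalf; ring. Qed.

Lemma Im_mul_cisN (z : C) (t : R) :
  complex.Im (z * cis (- t)) = complex.Im z * cos (t + 0) - complex.Re z * cos (t + - (pi / 2)).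
Proof. by case: z => a b; rewrite /= addr0 cosN sinN cosBpihalf; ring. Qed.

Lemma Re_fourier phi xi : J.-integrable setT (EFin \o (fun x => complex.Re (phi x))) ->
  J.-integrable setT (EFin \o (fun x => complex.Im (phi x))) ->
  complex.Re (fourier phi xi) =
  trig 0 (fun x => complex.Re (phi x)) xi + trig (- (pi / 2)) (fun x => complex.Im (phi x)) xi.
Proof.
move=> IR II; apply: (eq_trans _ (Rintegral_D (integrable_wave 0 xi IR) (integrable_wave (- (pi / 2)) xi II))).
by apply: eq_Rintegral => x _; rewrite Re_mul_cisN.
Qed.

Lemma Im_fourier phi xi : J.-integrable setT (EFin \o (fun x => complex.Re (phi x))) ->
  J.-integrable setT (EFin \o (fun x => complex.Im (phi x))) ->
  complex.Im (fourier phi xi) =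
  trig 0 (fun x => complex.Im (phi x)) xi - trig (- (pi / 2)) (fun x => complex.Re (phi x)) xi.
Proof.
move=> IR II; apply: (eq_trans _ (Rintegral_B (integrable_wave 0 xi II) (integrable_wave (- (pi / 2)) xi IR))).
by apply: eq_Rintegral => x _; rewrite Im_mul_cisN.
Qed.

Lemma temperate_real f (M : R) : continuous f -> (forall x, `|f x| <= M) ->
  temperate (fun x => (f x)%:C).
Proof.
move=> cf fM; split; first by split => //=; exact: continuous_cst_rV.
by exists M, 0%N => x; rewrite expr0 mulr1 normc_real.
Qed.

Lemma Re_realM (a : R) (z : C) : complex.Re (a%:C * z) = a * complex.Re z.
Proof. by case: z => b c; rewrite /= mul0r subr0. Qed.

Lemma Im_realM (a : R) (z : C) : complex.Im (a%:C * z) = a * complex.Im z.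
Proof. by case: z => b c; rewrite /= mul0r addr0. Qed.

Lemma Cint_real_fourier (w : 'rV[R]_d -> R) phi (M : R) : continuous w -> (forall x, `|w x| <= M) ->
  schwartzR (fun x => complex.Re (phi x)) -> schwartzR (fun x => complex.Im (phi x)) ->
  Cint (fun x => (w x)%:C * fourier phi x) =
  (\int[J]_x (w x * trig 0 (fun x => complex.Re (phi x)) x) +
   \int[J]_x (w x * trig (- (pi / 2)) (fun x => complex.Im (phi x)) x)) +i*
  (\int[J]_x (w x * trig 0 (fun x => complex.Im (phi x)) x) -
   \int[J]_x (w x * trig (- (pi / 2)) (fun x => complex.Re (phi x)) x)).
Proof.
move=> cw wM SR SI.
have IR := schwartzR_integrable SR; have II := schwartzR_integrable SI.
have It c f : schwartzR f -> J.-integrable setT (EFin \o (fun x => w x * trig c f x)).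
  move=> Sf; under [X in EFin \o X]eq_fun do rewrite mulrC.
  apply: (integrable_Mbounded (continuous_measurable_rV cw) wM).
  exact: schwartzR_integrable (schwartzR_trig c Sf).
rewrite -(Rintegral_D (It 0 _ SR) (It (- (pi / 2)) _ SI)).
rewrite -(Rintegral_B (It 0 _ SI) (It (- (pi / 2)) _ SR)).
rewrite /Cint; congr Complex; apply: eq_Rintegral => x _.
  by rewrite Re_realM (Re_fourier x IR II) mulrDr.
by rewrite Im_realM (Im_fourier x IR II) mulrBr.
Qed.

(** Splits the distributional identity into real cosine and sine identities: multiplication by the
    real symbol acts separately on the real and imaginary parts of [phi]. *)
Lemma bessel_real k u v (M : R) : continuous u -> continuous v ->
  (forall x, `|u x| <= M) -> (forall x, `|v x| <= M) ->
  (forall c f, schwartzR f ->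
    \int[J]_x (v x * trig c f x) = \int[J]_x (u x * trig c (symbolM k f) x)) ->
  bessel (k.*2)%:R (fun x => (u x)%:C) (fun x => (v x)%:C).
Proof.
move=> cu cv uM vM H; split; [exact: temperate_real uM|exact: temperate_real vM|].
move=> phi Sphi; have SR := schwartz_Re Sphi; have SI := schwartz_Im Sphi.
pose psi xi := ((1 + 4 * pi ^+ 2 * normsq xi) `^ ((k.*2)%:R / 2))%:C * phi xi.
(* Here evenness of the order enters: the real power of the nonnegative symbol is an integer
   power. *)
have sym (xi : 'rV[R]_d) :
    (1 + 4 * pi ^+ 2 * normsq xi) `^ ((k.*2)%:R / 2) = (1 + 4 * pi ^+ 2 * normsq xi) ^+ k.
  rewrite -muln2 natrM mulfK// powR_mulrn// addr_ge0// !mulr_ge0 ?pi_ge0//.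
  by apply: sumr_ge0 => i _; rewrite -expr2 sqr_ge0.
have ReE : (fun x => complex.Re (psi x)) = symbolM k (fun x => complex.Re (phi x)).
  by apply/funext => x; rewrite /psi sym Re_realM.
have ImE : (fun x => complex.Im (psi x)) = symbolM k (fun x => complex.Im (phi x)).
  by apply/funext => x; rewrite /psi sym Im_realM.
have Sk f : schwartzR f -> schwartzR (symbolM k f) by exact: schwartzR_symbolM.
rewrite (Cint_real_fourier cv vM SR SI).
have := Cint_real_fourier (phi := psi) cu uM; rewrite ReE ImE => /(_ (Sk _ SR) (Sk _ SI)).
rewrite -!(H _ _ SR) -!(H _ _ SI) => <-.
by [].
Qed.

End complex_glue.

Section complex_integral.
Variables (R : realType) (d : nat).
Local Notation C := R[i].
Local Notation J := (leb R d).
Implicit Types (F G : 'rV[R]_d -> C) (f g : 'rV[R]_d -> R) (x v : 'rV[R]_d).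

Definition Cintegrable F :=
  J.-integrable setT (EFin \o (fun x => complex.Re (F x))) /\
  J.-integrable setT (EFin \o (fun x => complex.Im (F x))).

Lemma Cintegrable_ZD (z : C) F G : Cintegrable F -> Cintegrable G ->
  Cintegrable (fun x => z * F x + G x).
Proof.
case: z => a b [IR II] [JR JI]; split.
- rewrite (_ : (fun x => _) = fun x => a * complex.Re (F x) + (- b * complex.Im (F x) + complex.Re (G x))).
    exact: (integrable_ZD a IR (integrable_ZD (- b) II JR)).
  by apply/funext => x; case: (F x) => s t; case: (G x) => u v /=; ring.
- rewrite (_ : (fun x => _) = fun x => a * complex.Im (F x) + (b * complex.Re (F x) + complex.Im (G x))).
    exact: (integrable_ZD a II (integrable_ZD b IR JI)).
  by apply/funext => x; case: (F x) => s t; case: (G x) => u v /=; ring.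
Qed.

Lemma Cint_ZD (z : C) F G : Cintegrable F -> Cintegrable G ->
  Cint (fun x => z * F x + G x) = z * Cint F + Cint G.
Proof.
case: z => a b [IR II] [JR JI]; rewrite /Cint.
have -> : \int[J]_x complex.Re ((a +i* b) * F x + G x) =
    a * (\int[J]_x complex.Re (F x)) + (- b * (\int[J]_x complex.Im (F x)) + \int[J]_x complex.Re (G x)).
  rewrite -(Rintegral_ZD (- b) II JR) -(Rintegral_ZD a IR (integrable_ZD (- b) II JR)).
  by apply: eq_Rintegral => x _; case: (F x) => s t; case: (G x) => u v /=; ring.
have -> : \int[J]_x complex.Im ((a +i* b) * F x + G x) =
    a * (\int[J]_x complex.Im (F x)) + (b * (\int[J]_x complex.Re (F x)) + \int[J]_x complex.Im (G x)).
  rewrite -(Rintegral_ZD b IR JI) -(Rintegral_ZD a II (integrable_ZD b IR JI)).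
  by apply: eq_Rintegral => x _; case: (F x) => s t; case: (G x) => u v /=; ring.
by apply/eqP; rewrite eq_complex /=; apply/andP; split; apply/eqP; ring.
Qed.

Lemma Cint_sum (I : Type) (r : seq I) (z : I -> C) (F : I -> 'rV[R]_d -> C) :
  (forall i, Cintegrable (F i)) ->
  Cint (fun x => \sum_(i <- r) z i * F i x) = \sum_(i <- r) z i * Cint (F i).
Proof.
move=> IF; suff [_] : Cintegrable (fun x => \sum_(i <- r) z i * F i x) /\
  Cint (fun x => \sum_(i <- r) z i * F i x) = \sum_(i <- r) z i * Cint (F i) by [].
elim: r => [|i r [Ir IH]].
  have -> : (fun x => \sum_(i <- [::]) z i * F i x) = fun=> 0.
    by apply/funext => x; rewrite big_nil.
  split; first by split; exact: integrable0R.
  by rewrite big_nil /Cint /= /Rintegral !integral0.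
have -> : (fun x => \sum_(i <- i :: r) z i * F i x) =
    fun x => z i * F i x + \sum_(i <- r) z i * F i x.
  by apply/funext => x; rewrite big_cons.
by split; [exact: Cintegrable_ZD|rewrite Cint_ZD// IH big_cons].
Qed.

(** The inverse Fourier transform of a real function, as [Cint_invft] shows; the phase [- (pi / 2)]
    turns the cosine into a sine. *)
Definition invft g x : C := trig 0 g x +i* trig (- (pi / 2)) g x.

Lemma Re_real_cis (a t : R) : complex.Re (a%:C * cis t) = a * cos (t + 0).
Proof. by rewrite Re_realM addr0. Qed.

Lemma Im_real_cis (a t : R) : complex.Im (a%:C * cis t) = a * cos (t + - (pi / 2)).
Proof. by rewrite Im_realM cosBpihalf. Qed.

Lemma Cintegrable_invft g x : J.-integrable setT (EFin \o g) ->
  Cintegrable (fun xi => (g xi)%:C * cis (2 * pi * dot x xi)).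
Proof.
move=> Ig; split.
  rewrite (_ : (fun xi => _) = fun xi => g xi * wave 0 xi x); first exact: integrable_wave.
  by apply/funext => xi; rewrite Re_real_cis dotC.
rewrite (_ : (fun xi => _) = fun xi => g xi * wave (- (pi / 2)) xi x); first exact: integrable_wave.
by apply/funext => xi; rewrite Im_real_cis dotC.
Qed.

Lemma Cint_invft g x : Cint (fun xi => (g xi)%:C * cis (2 * pi * dot x xi)) = invft g x.
Proof.
rewrite /Cint /invft; congr Complex; apply: eq_Rintegral => xi _.
  by rewrite Re_real_cis dotC.
by rewrite Im_real_cis dotC.
Qed.

Lemma invft_translate g v x : J.-integrable setT (EFin \o g) ->
  invft (fun t => g (t - v)) x = cis (2 * pi * dot x v) * invft g x.
Proof.
move=> Ig; have E : dot x (- v) = - dot x v by rewrite dotC dotNl dotC.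
have tr c : trig c (fun t => g (t - v)) x = trig (c + 2 * pi * dot x v) g x.
  by rewrite trig_translate// E mulrN opprK.
have T0 := trig_shift 0 (2 * pi * dot x v) x Ig.
have T1 := trig_shift (- (pi / 2)) (2 * pi * dot x v) x Ig.
rewrite /invft !tr T0 T1 sub0r trig_subpihalf2//.
by apply/eqP; rewrite eq_complex /=; apply/andP; split; apply/eqP; ring.
Qed.

Lemma invft_sum (I : Type) (r : seq I) (a : I -> R) (G : I -> 'rV[R]_d -> R) x :
  (forall i, J.-integrable setT (EFin \o G i)) ->
  invft (fun t => \sum_(i <- r) a i * G i t) x = \sum_(i <- r) (a i)%:C * invft (G i) x.
Proof.
move=> IG; rewrite -Cint_invft.
rewrite (_ : (fun xi => _) = fun xi => \sum_(i <- r) (a i)%:C * ((G i xi)%:C * cis (2 * pi * dot x xi))).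
  rewrite Cint_sum; last by move=> i; exact: Cintegrable_invft.
  by apply: eq_bigr => i _; rewrite Cint_invft.
apply/funext => xi; rewrite rmorph_sum mulr_suml; apply: eq_bigr => i _.
by rewrite rmorphM mulrA.
Qed.

Lemma schwartz_invft g : schwartzR g -> schwartz (invft g).
Proof. by move=> Sg; apply: schwartz_ReIm; exact: schwartzR_trig. Qed.

End complex_integral.

Section box_bounds.
Variables (R : realType) (d : nat).
Local Notation J := (leb R d).

Definition box (h : R) : set 'rV[R]_d := [set x | forall i, `[0, h]%classic (x ord0 i)].

Lemma measurable_segment_box h : measurable (box h).
Proof. exact: (measurable_box (fun=> measurable_itv _)). Qed.

Lemma leb_segment_box h : 0 <= h -> J (box h) = (h ^+ d)%:E.
Proof.
move=> h0; rewrite /box (leb_box (A := fun=> `[0, h]%classic))//.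
rewrite (eq_bigr (fun=> h%:E)); last first.
  move=> i _; rewrite lebesgue_measure_itv/= lte_fin; case: ltgtP h0 => // [_ _|<- _].
    by rewrite oppr0 adde0.
  by [].
by rewrite prodEFin prodr_const card_ord.
Qed.

Lemma Rintegral_box_lower (g : 'rV[R]_d -> R) (c h : R) : 0 <= c -> 0 <= h ->
  J.-integrable setT (EFin \o g) -> (forall x, 0 <= g x) ->
  (forall x, box h x -> c <= g x) -> c * h ^+ d <= \int[J]_x g x.
Proof.
move=> c0 h0 Ig g0 gc; have mb := measurable_segment_box h.
rewrite -lee_fin EFinM -leb_segment_box// -integral_cst//.
rewrite /Rintegral fineK; last exact: (integrable_fin_num _ Ig).
have mg : measurable_fun setT (EFin \o g) by case/integrableP: Ig.
apply: (@le_trans _ _ (\int[J]_(x in box h) (g x)%:E)%E).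
  apply: ge0_le_integral => //; first exact: measurable_funS mg.
by apply: ge0_subset_integral => // x _; rewrite lee_fin.
Qed.

(** The support of [g] is so small that the cosine stays above [1 / 2] for every [x] in the unit
    box. *)
Lemma trig_box_lower (g : 'rV[R]_d -> R) (rad : R) : 0 <= rad -> 16 * (rad * d%:R) <= 1 ->
  J.-integrable setT (EFin \o g) -> (forall x, 0 <= g x) ->
  (forall (x : 'rV[R]_d) i, rad <= `|x ord0 i| -> g x = 0) ->
  forall x : 'rV[R]_d, box 1 x -> (\int[J]_t g t) / 2 <= trig 0 g x.
Proof.
move=> rad0 radd Ig g0 gsupp x bx.
rewrite mulrC -Rintegral_Z//; apply: le_Rintegral => //.
- exact: integrable_Z.
- exact: integrable_wave.
move=> t _; have [/existsP[i ti]|] := boolP [exists i, rad <= `|t ord0 i|].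
  by rewrite (gsupp t i ti) mulr0 mul0r.
rewrite negb_exists => /forallP tr.
rewrite mulrC ler_wpM2l// /wave addr0.
have : `|dot t x| <= rad * d%:R.
  apply: (le_trans (ler_norm_sum _ _ _)).
  rewrite -[d in d%:R]card_ord -sum1_card natr_sum mulr_sumr; apply: ler_sum => i _.
  rewrite normrM mulr1; have /andP[x0 x1] := bx i.
  rewrite -[leRHS]mulr1; apply: ler_pM => //; first by have := tr i; rewrite -ltNge => /ltW.
  by rewrite ger0_norm.
move=> dtx; have := cos_lipschitz (2 * pi * dot t x) 0.
rewrite cos0 subr0 normrM ger0_norm ?mulr_ge0 ?pi_ge0// => h.
have p4 := pihalf_lt2 R; have p0 := pi_ge0 R.
(* From [|dot t x| <= 1 / 16] and [pi < 4]; this is where the constant 16 comes from. *)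
have : 2 * pi * `|dot t x| <= 1 / 2.
  have := normr_ge0 (dot t x); nra.
move=> h2; have := le_trans h h2; rewrite ler_norml => /andP[]; lra.
Qed.

End box_bounds.

(** * Wave packets *)

Section bump_integral.
Variables (R : realType) (d : nat) (r : R).
Hypotheses (r0 : 0 < r) (rd : 16 * (r * d%:R) <= 1).
Local Notation J := (leb R d).
Local Notation rho := (bumpd r [::] (0 : 'rV[R]_d)).

Lemma bumpd_ge0 (x : 'rV[R]_d) : 0 <= rho x.
Proof. by apply: prodr_ge0 => i _; exact: bump_ge0. Qed.

Lemma bumpd_even (x : 'rV[R]_d) : rho (- x) = rho x.
Proof.
by apply: eq_bigr => i _; rewrite !mxE /= subr0 subr0 bump_even.
Qed.

Lemma bumpd_at0 : 0 < rho 0.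
Proof.
by apply: prodr_gt0 => i _; rewrite subrr; apply: bump_gt0; rewrite ?normr0.
Qed.

(** Both [r - t] and [r + t] are at least [r / 2] here. *)
Lemma bump_lower (t : R) : 0 <= t <= r / 2 -> expR (- (2 / r)) ^+ 2 <= bump r t.
Proof.
have r0' := r0; move=> /andP[t0 tr]; rewrite expr2 /bump /flat.
rewrite (_ : 0 < r - t); last lra.
rewrite (_ : 0 < r + t); last lra.
rewrite expr0 invr1 !mul1r; apply: ler_pM; rewrite ?expR_ge0// ler_expR lerN2.
  by rewrite -[2 / r]invrK invf_div lef_pV2 ?posrE//; lra.
by rewrite -[2 / r]invrK invf_div lef_pV2 ?posrE//; lra.
Qed.

Lemma bumpd_lower : exists2 c : R, 0 < c &
  forall x, box (r / 2) x -> c <= rho x.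
Proof.
exists ((expR (- (2 / r)) ^+ 2) ^+ d); first by rewrite !exprn_gt0 ?expR_gt0.
move=> x bx; rewrite -[d in _ ^+ d]card_ord -prodr_const; apply: ler_prod => i _.
rewrite exprn_ge0 ?expR_ge0//= mxE subr0; apply: bump_lower.
by have := bx i; rewrite /= in_itv.
Qed.

Lemma bumpd_supp (x : 'rV[R]_d) i : r <= `|x ord0 i| -> rho x = 0.
Proof. by move=> h; apply: (@bumpd_eq0 _ _ _ _ _ _ i); rewrite mxE subr0. Qed.

Lemma integrable_bumpd : J.-integrable setT (EFin \o rho).
Proof. exact/schwartzR_integrable/schwartzR_bumpd. Qed.

Lemma integrable_bumpd2 : J.-integrable setT (EFin \o (fun x => rho x ^+ 2)).
Proof.
have [M HM] := bumpd_bounded r ([::] : seq 'I_d).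
under eq_fun do rewrite expr2.
apply: (@integrable_Mbounded _ _ _ J _ _ M _ _ integrable_bumpd).
  by apply: continuous_measurable_rV; exact: continuous_bumpd.
by move=> x; exact: HM.
Qed.

Lemma bumpd_integral_gt0 : 0 < \int[J]_x rho x.
Proof.
have [c c0 rc] := bumpd_lower.
have r2 : 0 <= r / 2 by apply: divr_ge0; rewrite ?(ltW r0).
apply: lt_le_trans (Rintegral_box_lower (ltW c0) r2 integrable_bumpd bumpd_ge0 rc).
by rewrite mulr_gt0 ?exprn_gt0 ?divr_gt0.
Qed.

Lemma bumpd2_integral_gt0 : 0 < \int[J]_x (rho x ^+ 2).
Proof.
have [c c0 rc] := bumpd_lower.
have r2 : 0 <= r / 2 by apply: divr_ge0; rewrite ?(ltW r0).
apply: lt_le_trans (Rintegral_box_lower (sqr_ge0 c) r2 integrable_bumpd2 _ _).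
- by rewrite mulr_gt0 ?exprn_gt0 ?divr_gt0.
- by move=> x; exact: sqr_ge0.
- by move=> x /rc cx; rewrite ler_sqr ?nnegrE ?bumpd_ge0// ltW.
Qed.

(** Supplies the positivity assumed in the inversion section: on the unit box the transform is at
    least half the integral of the bump. *)
Lemma trig_bumpd_integral_gt0 : 0 < \int[J]_x (trig 0 rho x) ^+ 2.
Proof.
have I0 := bumpd_integral_gt0; have St := schwartzR_trig 0 (schwartzR_bumpd r [::] (0 : 'rV[R]_d)).
have [M HM] := schwartzR_bounded St.
have It : J.-integrable setT (EFin \o (fun x => trig 0 rho x ^+ 2)).
  under eq_fun do rewrite expr2.
  apply: (@integrable_Mbounded _ _ _ J _ _ M _ _ (schwartzR_integrable St)) => //.
  exact: continuous_measurable_rV (schwartzR_continuous St).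
have := Rintegral_box_lower (sqr_ge0 ((\int[J]_x rho x) / 2)) ler01 It (fun x => sqr_ge0 _).
rewrite expr1n mulr1 => H; apply: lt_le_trans (H _).
  by rewrite exprn_gt0// divr_gt0.
move=> x bx; have h := trig_box_lower (ltW r0) rd integrable_bumpd bumpd_ge0 bumpd_supp bx.
by rewrite ler_sqr ?nnegrE// ?(le_trans _ h)// divr_ge0// ltW.
Qed.

Definition bumpc : R := invconst rho.

Lemma bumpc_gt0 : 0 < bumpc.
Proof.
apply: invconst_gt0; [exact: schwartzR_bumpd|exact: bumpd_even| |exact: trig_bumpd_integral_gt0].
by rewrite gt_eqF// bumpd_at0.
Qed.

(** Its real and imaginary parts are [trig_inversion_re] and [trig_inversion_im]. *)
Lemma fourier_invft (b : 'rV[R]_d -> R) xi : schwartzR b -> fourier (invft b) xi = (bumpc * b xi)%:C.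
Proof.
move=> Sb; have It c := schwartzR_integrable (schwartzR_trig c Sb).
apply/eqP; rewrite eq_complex Re_fourier; [|exact: It..].
rewrite Im_fourier; [|exact: It..].
have Srho := schwartzR_bumpd r [::] (0 : 'rV[R]_d); have rho0 := lt0r_neq0 bumpd_at0.
have Hre := trig_inversion_re Srho rho0 xi Sb.
have Him := trig_inversion_im Srho bumpd_even rho0 xi Sb.
by apply/andP; split; apply/eqP; [exact: Hre|exact: Him].
Qed.

End bump_integral.

Section wave_packets.
Variables (R : realType) (n : nat) (r : R).
Local Notation N := n.+1.
Local Notation C := R[i].
Local Notation J := (leb R N).
Local Notation leb1 := (@lebesgue_measure R).
Local Notation rs K := (rudin_shapiro R K).1.
Local Notation e0 := (delta_mx ord0 ord0 : 'rV[R]_N).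
Local Notation rho := (bumpd r [::] (0 : 'rV[R]_N)).
Local Notation rho2 := (fun x : 'rV[R]_N => rho x ^+ 2).
Hypotheses (r0 : 0 < r) (rN : 16 * (r * N%:R) <= 1).

Lemma radius_le6 : r <= 1 / 6.
Proof.
have r0' := r0; have : r <= r * N%:R by rewrite ler_peMr ?ler1n// ltW.
by have := rN; lra.
Qed.

Definition freq (K i : nat) : 'rV[R]_N := (2 ^ K + i)%:R *: e0.

Definition packet_symbol K (xi : 'rV[R]_N) : R :=
  \sum_(i < 2 ^ K) rs K i * rho (xi - freq K i).

Definition packet K : 'rV[R]_N -> C := invft (packet_symbol K).

Lemma schwartzR_packet_symbol K : schwartzR (packet_symbol K).
Proof.
apply: schwartzR_sum => i.
have -> : (fun xi => rho (xi - freq K i)) = bumpd r [::] (freq K i).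
  by apply/funext => xi; rewrite bumpd_shift opprK add0r.
exact: schwartzR_bumpd.
Qed.

Lemma schwartz_packet K : schwartz (packet K).
Proof. exact/schwartz_invft/schwartzR_packet_symbol. Qed.

Lemma dot_freq K i (x : 'rV[R]_N) : dot x (freq K i) = (2 ^ K + i)%:R * x ord0 ord0.
Proof. by rewrite dotZr dotC dot_ebase. Qed.

(** Translating a bump in frequency modulates it in space, so the packet is a flat polynomial in
    [x_0] times a fixed profile. *)
Lemma packetE K (x : 'rV[R]_N) : packet K x =
  cis (2 * pi * (2 ^ K)%:R * x ord0 ord0) * trigpoly (rs K) (2 ^ K) (x ord0 ord0) * invft rho x.
Proof.
rewrite /packet invft_sum; last first.
  by move=> i; exact/integrable_translation/integrable_bumpd.
rewrite /trigpoly mulr_sumr mulr_suml; apply: eq_bigr => i _.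
rewrite invft_translate; last exact: integrable_bumpd.
rewrite (_ : 2 * pi * _ = 2 * pi * (2 ^ K)%:R * x ord0 ord0 + 2 * pi * i%:R * x ord0 ord0).
  by rewrite cisD; ring.
by rewrite dot_freq natrD; ring.
Qed.

Lemma normc_cis (t : R) : normc (cis t) = 1.
Proof. by rewrite normc_sqnorm sqnorm_cis sqrtr1. Qed.

Lemma normc_packet K (x : 'rV[R]_N) :
  normc (packet K x) ^+ 2 <= 2 ^+ K.+1 * sqnorm (invft rho x).
Proof.
rewrite packetE !normcM normc_cis mul1r exprMn [normc (invft _ _)]normc_sqnorm.
rewrite [X in _ * X]sqr_sqrtr ?addr_ge0 ?sqr_ge0//.
rewrite ler_wpM2r ?addr_ge0 ?sqr_ge0//.
rewrite -[leRHS]sqr_sqrtr ?exprn_ge0// ler_sqr ?nnegrE ?sqrtr_ge0 ?rs_normc//.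
by rewrite normc_sqnorm sqrtr_ge0.
Qed.

Lemma fourier_packet K xi : fourier (packet K) xi = (bumpc N r * packet_symbol K xi)%:C.
Proof. exact/fourier_invft/schwartzR_packet_symbol. Qed.

Lemma measurable_normc_schwartz (f : 'rV[R]_N -> C) : schwartz f ->
  measurable_fun setT (fun x => normc (f x)).
Proof.
move=> Sf; apply: continuous_measurable_rV => x.
have cR := schwartzR_continuous (schwartz_Re Sf).
have cI := schwartzR_continuous (schwartz_Im Sf).
under eq_fun do rewrite normc_sqnorm /sqnorm !expr2.
apply: (@continuous_comp _ _ _ (fun x : 'rV[R]_N => complex.Re (f x) * complex.Re (f x) +
  complex.Im (f x) * complex.Im (f x)) (@Num.sqrt R)); last exact: sqrt_continuous.
by apply: continuousD_rV; apply: continuousM_rV.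
Qed.

(** Pointwise, the squared modulus of the packet is at most [2 ^+ K.+1] times that of the profile of
    one bump, by the Rudin-Shapiro bound. *)
Lemma Lpnorm2_packet : exists2 G : R, 0 < G & forall K,
  (Lpnorm 2%:E (packet K) * Lpnorm 2%:E (packet K) <= (2 ^+ K * G)%:E)%E.
Proof.
have I0 := integrable_bumpd N r.
have St c := schwartzR_trig c (schwartzR_bumpd r [::] (0 : 'rV[R]_N)).
have It c : J.-integrable setT (EFin \o (fun x => trig c rho x ^+ 2)).
  have [M HM] := schwartzR_bounded (St c).
  under eq_fun do rewrite expr2.
  apply: (@integrable_Mbounded _ _ _ J _ _ M _ _ (schwartzR_integrable (St c))) => //.
  exact: continuous_measurable_rV (schwartzR_continuous (St c)).
have Is := integrable_D (It 0) (It (- (pi / 2))).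
exists (2 * (\int[J]_x sqnorm (invft rho x)) + 1).
  by rewrite ltr_pwDr// mulr_ge0// Rintegral_ge0// => x _; rewrite addr_ge0 ?sqr_ge0.
move=> K.
have -> : (Lpnorm 2%:E (packet K) * Lpnorm 2%:E (packet K) =
    \int[J]_x (normc (packet K x) ^+ 2)%:E)%E.
  have sq (y : \bar R) : (0 <= y -> y * y = y `^ 2)%E.
    move=> y0; rewrite (_ : 2 = 1 + 1); last by ring.
    by rewrite poweRD ?poweRe1// add_neq0_poweRD_def// (_ : 1 + 1 = 2)//; ring.
  rewrite sq ?Lnorm_ge0// /Lpnorm poweR_Lnorm//; apply: eq_integral => x _ /=.
  by rewrite ger0_norm ?sqrtr_ge0// powR_mulrn ?sqrtr_ge0.
apply: (@le_trans _ _ (\int[J]_x (2 ^+ K.+1 * sqnorm (invft rho x))%:E)%E).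
  apply: ge0_le_integral => //.
  - by move=> x _; rewrite lee_fin sqr_ge0.
  - apply/measurable_EFinP; under eq_fun do rewrite expr2.
    have m := measurable_normc_schwartz (schwartz_packet K).
    exact: (measurable_funM m m).
  - by have /integrableP[] := integrable_Z (2 ^+ K.+1) Is.
  - by move=> x _; rewrite lee_fin normc_packet.
have /integrable_fin_num := integrable_Z (2 ^+ K.+1) Is => /(_ _)/fineK <-//.
rewrite lee_fin; have := Rintegral_Z (2 ^+ K.+1) Is; rewrite /Rintegral => ->.
by rewrite mulrDr mulr1 mulrA -exprSr lerDl exprn_ge0.
Qed.

(** A bump of the multiplier is the tensor product of the very bumps used in the packets, so
    wherever they meet they get squared; the resulting profile [rho2] is nonnegative. *)
Lemma packet_mult A K (xi eta : 'rV[R]_N) :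
  mult r A [::] (row_mx xi eta) * packet_symbol K xi * packet_symbol K eta =
  \sum_(p : 'I_(2 ^ K) * 'I_(2 ^ K))
    (A (2 ^ K + p.1)%N (2 ^ K + p.2)%N * rs K p.1 * rs K p.2) *
    (rho2 (xi - freq K p.1) * rho2 (eta - freq K p.2)).
Proof.
rewrite -mulrA /packet_symbol mulr_suml mulr_sumr.
under eq_bigr => i _ do rewrite mulr_sumr mulr_sumr.
rewrite pair_bigA; apply: eq_bigr => -[i j] _ /=.
set x := rho _; set y := rho _.
(* Away from the centre of the packet bump both sides vanish; close to it, [mult_at] identifies the
   selected coefficient. *)
have [h0|] := boolP (r <= `|xi ord0 ord0 - (2 ^ K + i)%:R|).
  have -> : x = 0.
    by apply: (@bumpd_supp _ _ _ _ ord0); rewrite !mxE !eqxx mulr1.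
  by rewrite mulr0 mul0r mulr0 expr0n/= mul0r mulr0.
rewrite -ltNge => h0.
have [h1|] := boolP (r <= `|eta ord0 ord0 - (2 ^ K + j)%:R|).
  have -> : y = 0.
    by apply: (@bumpd_supp _ _ _ _ ord0); rewrite !mxE !eqxx mulr1.
  by rewrite !mulr0 expr0n/= !mulr0.
rewrite -ltNge => h1.
rewrite (mult_at radius_le6 A [::] (p := (2 ^ K + i)%N) (q := (2 ^ K + j)%N)) ?row_mxEl ?row_mxEr//.
have -> : bumpd r [::] (cen R n (2 ^ K + i) (2 ^ K + j)) (row_mx xi eta) = x * y.
  rewrite /bumpd big_split_ord; congr (_ * _); apply: eq_bigr => k _ /=.
    by rewrite row_mxEl !mxE eq_lshift eq_lrshift eqxx /= subr0; case: eqVneq => _; rewrite ?mulr1 ?mulr0.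
  by rewrite row_mxEr !mxE eq_rshift eq_rlshift eqxx /= subr0; case: eqVneq => _; rewrite ?mulr1 ?mulr0.
ring.
Qed.

(** The hypothesis says that the packet signs cancel those in [A]. The offsets [2 ^ K] of the two
    frequencies add up to the unimodular factor of frequency [2 ^ K.+1]. *)
Lemma bilinear_packet A (W : R) K (x : 'rV[R]_N) :
  (forall i j : 'I_(2 ^ K), A (2 ^ K + i)%N (2 ^ K + j)%N * rs K i * rs K j = W * rs K.+1 (i + j)%N) ->
  bilinear_multiplier (fun z => (mult r A [::] z)%:C) (packet K) (packet K) x =
  (bumpc N r ^+ 2 * W)%:C * cis (2 * pi * (2 ^ K.+1)%:R * x ord0 ord0) *
  rs_sum K (x ord0 ord0) * invft rho2 x ^+ 2.
Proof.
move=> AW; set c := bumpc N r.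
pose B (p : 'I_(2 ^ K) * 'I_(2 ^ K)) := c ^+ 2 * (W * rs K.+1 (p.1 + p.2)%N).
have IU := integrable_bumpd2 N r.
have IUf i : J.-integrable setT (EFin \o (fun xi => rho2 (xi - freq K i))).
  exact: (integrable_translation (- freq K i) IU).
pose P i (xi : 'rV[R]_N) : C := (rho2 (xi - freq K i))%:C * cis (2 * pi * dot x xi).
have IP i : Cintegrable (P i) by exact: Cintegrable_invft.
have E xi eta : (mult r A [::] (row_mx xi eta))%:C * fourier (packet K) xi * fourier (packet K) eta
      * cis (2 * pi * dot x (xi + eta)) =
    \sum_p ((B p)%:C * P p.1 xi) * P p.2 eta.
  rewrite !fourier_packet -!rmorphM /= -/c.
  rewrite (_ : _ * (c * _) * (c * _) = c ^+ 2 *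
    (mult r A [::] (row_mx xi eta) * packet_symbol K xi * packet_symbol K eta)); last by ring.
  rewrite packet_mult dotDr mulrDr cisD rmorphM rmorph_sum /= mulr_sumr mulr_suml.
  apply: eq_bigr => p _; rewrite AW /B /P !rmorphM /=; ring.
rewrite /bilinear_multiplier.
under eq_fun => xi.
  under eq_fun => eta do rewrite E.
  rewrite Cint_sum; last by move=> p; exact: IP.
  under eq_bigr => p _ do rewrite mulrAC.
  over.
rewrite Cint_sum; last by move=> p; exact: IP.
have PE i : Cint (P i) = cis (2 * pi * dot x (freq K i)) * invft rho2 x.
  by rewrite -invft_translate// -Cint_invft.
rewrite rs_sumE mulr_sumr mulr_suml; apply: eq_bigr => p _.
rewrite !PE !dot_freq.
pose e (k : nat) : R := 2 * pi * k%:R * x ord0 ord0.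
have eD k l : e (k + l)%N = e k + e l by rewrite /e natrD; ring.
have eM (k : nat) : 2 * pi * (k%:R * x ord0 ord0) = e k by rewrite /e; ring.
rewrite !eM -/(e (2 ^ K.+1)%N) -/(e (p.1 + p.2)%N) expnS mul2n -addnn !eD.
rewrite !cisD /B !rmorphM /=; ring.
Qed.

Lemma normc_bilinear_packet A (W : R) K (x : 'rV[R]_N) : 0 <= W ->
  (forall i j : 'I_(2 ^ K), A (2 ^ K + i)%N (2 ^ K + j)%N * rs K i * rs K j = W * rs K.+1 (i + j)%N) ->
  normc (bilinear_multiplier (fun z => (mult r A [::] z)%:C) (packet K) (packet K) x) =
  bumpc N r ^+ 2 * W * normc (rs_sum K (x ord0 ord0)) * sqnorm (invft rho2 x).
Proof.
move=> W0 AW; rewrite (bilinear_packet x AW) !normcM normc_cis mulr1.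
rewrite normc_real ger0_norm; last by apply: mulr_ge0 => //; exact: sqr_ge0.
by rewrite [normc (invft _ _)]normc_sqnorm -expr2 sqr_sqrtr// addr_ge0 ?sqr_ge0.
Qed.

(** On the unit box the profile is bounded below by [trig_box_lower], which leaves a function of
    [x_0] alone. *)
Lemma Lpnorm1_packet_lower A (W : R) K : 0 <= W ->
  (forall i j : 'I_(2 ^ K), A (2 ^ K + i)%N (2 ^ K + j)%N * rs K i * rs K j = W * rs K.+1 (i + j)%N) ->
  ((bumpc N r ^+ 2 * W * ((\int[J]_x rho2 x) / 2) ^+ 2 *
    \int[leb1]_(t in `[0, 1]) normc (rs_sum K t))%:E <=
   Lpnorm 1 (bilinear_multiplier (fun z => (mult r A [::] z)%:C) (packet K) (packet K)))%E.
Proof.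
move=> W0 AW; set c := bumpc N r ^+ 2 * W * _.
have c0 : 0 <= c by apply: mulr_ge0; [apply: mulr_ge0 => //|]; exact: sqr_ge0.
pose ind (t : R) : R := \1_`[0, 1] t.
(* Factors of a tensor minorant: the first coordinate carries the exponential sum, the others
   indicators of integral 1. *)
pose g (i : 'I_N) (t : R) := if i == ord0 then c * (normc (rs_sum K t) * ind t) else ind t.
have leb01 : leb1 `[0%R, 1%R]%classic = 1%E.
  by rewrite lebesgue_measure_itv/= lte_fin ltr01 oppr0 adde0.
have mind : measurable_fun setT ind by exact: measurable_indic.
have mrs : measurable_fun setT (fun t : R => normc (rs_sum K t)).
  by apply: continuous_measurable_fun; exact: continuous_rs_sum.
have ind0 t : 0 <= ind t by rewrite /ind indicE ler0n.
have rs0 (t : R) : 0 <= normc (rs_sum K t) by rewrite normc_sqnorm sqrtr_ge0.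
have mg i : measurable_fun setT (g i).
  rewrite /g; case: (i == ord0) => //.
  by apply: measurable_funM => //; exact: measurable_funM.
have g0 i t : 0 <= g i t.
  by rewrite /g; case: (i == ord0) => //; apply: mulr_ge0 => //; exact: mulr_ge0.
have := ge0_integral_tensor mg g0; rewrite big_ord_recl.
rewrite [X in (_ * X)%E]big1 ?mule1; last first.
  move=> i _; rewrite /g /= (@integral_indic _ _ _ leb1 setT measurableT `[0%R, 1%R]%classic)//.
  rewrite setIT; exact: leb01.
have -> : (\int[leb1]_t (g ord0 t)%:E = (c * \int[leb1]_(t in `[0%R, 1%R]) normc (rs_sum K t))%:E)%E.
  rewrite EFinM /Rintegral fineK; last first.
    apply: integrable_fin_num; first exact: measurable_itv.
    exact: (integrable_segment (@continuous_rs_sum R K)).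
  rewrite [in RHS]integral_mkcond -ge0_integralZl_EFin//; first last.
  - by apply/(measurable_restrictT _ (measurable_itv _))/measurable_EFinP/measurable_funTS.
  - by move=> t _; rewrite patchE; case: ifP => // _; rewrite lee_fin.
  apply: eq_integral => t _; rewrite /g eqxx EFinM; congr (_ * _)%E.
  by rewrite patchE /ind indicE; case: ifP => _; rewrite ?mulr1 ?mulr0.
move=> <-; rewrite /Lpnorm Lnorm1.
apply: ge0_le_integral => //.
- by move=> x _; rewrite lee_fin prodr_ge0.
- apply/measurable_EFinP; apply: measurable_prod => i _.
  by apply: measurableT_comp => //; exact: measurable_rV_coord.
- apply: measurableT_comp => //; apply/measurable_EFinP.
  rewrite (funext (fun x => normc_bilinear_packet x W0 AW) : @normc R \o _ = _).
  have mU b : measurable_fun setT (trig b rho2).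
    by apply: measurable_trig; have /integrableP[/measurable_EFinP] := integrable_bumpd2 N r.
  apply: measurable_funM; last first.
    by rewrite /sqnorm /=; apply: measurable_funD; apply: measurable_funX; exact: mU.
  apply: measurable_funM => //; apply: (measurableT_comp mrs).
  exact: measurable_rV_coord.
move=> x _; rewrite /comp abse_EFin lee_fin (normc_bilinear_packet x W0 AW).
have [/forallP bx|] := boolP [forall i, x ord0 i \in `[0, 1]%R]; last first.
  rewrite negb_forall => /existsP[i /negPf xi].
  have gi0 : g i (x ord0 i) = 0.
    by rewrite /g /ind indicE mem_setE xi !mulr0; case: ifP.
  rewrite (bigD1 i)//= gi0 mul0r; exact: normr_ge0.
rewrite (_ : \prod_i _ = c * normc (rs_sum K (x ord0 ord0))); last first.
  rewrite big_ord_recl big1; last by move=> i _; rewrite /g /= /ind indicE mem_setE bx.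
  by rewrite /g eqxx /ind indicE mem_setE bx !mulr1.
apply: (le_trans _ (ler_norm _)); rewrite /c mulrAC.
apply: ler_wpM2l; first by apply: mulr_ge0 => //; apply: mulr_ge0 => //; exact: sqr_ge0.
have I0 := bumpd2_integral_gt0 N r0.
have supp2 (y : 'rV[R]_N) i : r <= `|y ord0 i| -> rho2 y = 0.
  by move=> h; rewrite (bumpd_supp h) expr0n.
have H := trig_box_lower (ltW r0) rN (integrable_bumpd2 N r) (fun y => sqr_ge0 _) supp2 bx.
apply: (@le_trans _ _ (trig 0 rho2 x ^+ 2)); last by rewrite lerDl sqr_ge0.
have I2 : 0 <= (\int[J]_y rho2 y) / 2 by rewrite divr_ge0// ltW.
by rewrite ler_sqr ?nnegrE// (le_trans I2 H).
Qed.

End wave_packets.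

(** * Choice of the coefficients *)

Section coefficients.
Variable R : realType.
Local Notation rs K := (rudin_shapiro R K).1.

(** Both sides of the assumed bound are compared at the packets: [2 ^ K] on the right against
    [W K * 4 ^ K / 2 ^ ((K + 2) / 2)] on the left, up to fixed constants. *)
Lemma packet_unbounded n (r c : R) (A : nat -> nat -> R) (W : nat -> R) :
  0 < r -> 16 * (r * n.+1%:R) <= 1 -> (forall K, 0 <= W K) ->
  (forall K (i j : 'I_(2 ^ K)),
    A (2 ^ K + i)%N (2 ^ K + j)%N * rs K i * rs K j = W K * rs K.+1 (i + j)%N) ->
  (forall f g : 'rV[R]_n.+1 -> R[i], schwartz f -> schwartz g ->
    (Lpnorm 1 (bilinear_multiplier (fun z => (mult r A [::] z)%:C) f g)
       <= c%:E * Lpnorm 2%:E f * Lpnorm 2%:E g)%E) ->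
  exists G : R, forall K, W K ^+ 2 * 2 ^+ K <= G.
Proof.
move=> r0 rN W0 AW bound.
have [G G0 L2] := Lpnorm2_packet n r.
set I := \int[leb R n.+1]_x (bumpd r [::] (0 : 'rV[R]_n.+1) x ^+ 2).
pose a := bumpc n.+1 r ^+ 2 * (I / 2) ^+ 2.
have a0 : 0 < a.
  by rewrite mulr_gt0 ?exprn_gt0 ?bumpc_gt0 ?divr_gt0 ?bumpd2_integral_gt0.
exists (4 * (`|c| * G) ^+ 2 / a ^+ 2) => K.
set S := \int[@lebesgue_measure R]_(t in `[0, 1]) normc (rs_sum K t).
have aWS : a * W K * S <= `|c| * (2 ^+ K * G).
  rewrite -lee_fin.
  have := Lpnorm1_packet_lower r0 rN (W0 K) (AW K).
  rewrite (_ : _ * S = a * W K * S); last by rewrite /a /I; ring.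
  move=> /le_trans; apply; apply: le_trans (bound _ _ _ _) _; [exact: schwartz_packet..|].
  rewrite -muleA EFinM.
  (* The constant [c] has no prescribed sign, so its absolute value is used. *)
  apply: (@le_trans _ _ (`|c|%:E * (Lpnorm 2 (packet r K) * Lpnorm 2 (packet r K)))%E).
    by apply: lee_wpmul2r; rewrite ?mule_ge0 ?Lnorm_ge0// lee_fin ler_norm.
  by apply: lee_wpmul2l; [rewrite lee_fin|exact: L2].
have S4 := rs_sum_lower R K; rewrite -/S in S4.
set q := Num.sqrt _ in S4.
have q2 : q ^+ 2 = 4 * 2 ^+ K by rewrite sqr_sqrtr ?exprn_ge0// !exprS; ring.
have q0 : 0 <= q by exact: sqrtr_ge0.
have t0 : 0 < 2 ^+ K :> R by rewrite exprn_gt0.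
have e4 : 4 ^+ K = 2 ^+ K * 2 ^+ K :> R by rewrite -exprMn; congr (_ ^+ _); ring.
have aW0 : 0 <= a * W K by rewrite mulr_ge0// ltW.
(* Multiply [aWS] by [q], bound [q * S] below by [4 ^+ K], and cancel one factor [2 ^+ K]; squaring
   then removes the root in [q]. *)
have key : a * W K * 2 ^+ K <= q * (`|c| * G).
  rewrite -(ler_pM2r t0); have h1 := ler_wpM2l aW0 S4; have h2 := ler_wpM2l q0 aWS.
  by rewrite e4 in h1; lra.
rewrite ler_pdivlMr ?exprn_gt0// -(ler_pM2r t0).
have : (a * W K * 2 ^+ K) ^+ 2 <= (q * (`|c| * G)) ^+ 2.
  have L0 : 0 <= a * W K * 2 ^+ K by rewrite mulr_ge0// ltW.
  by rewrite ler_sqr ?nnegrE ?(le_trans L0).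
by rewrite [leRHS]exprMn q2; lra.
Qed.

(** Takes the least [K] with [y < 16 * 4 ^+ K]; the assumption [4 <= y] covers [K = 0]. *)
Lemma power4_bracket (y : R) : 4 <= y -> exists K, 4 * 4 ^+ K <= y < 16 * 4 ^+ K.
Proof.
move=> y4.
have ex : exists K, y < 16 * 4 ^+ K.
  have y0 : 0 <= y by lra.
  have /archi_boundP h := y0; exists (Num.bound y); apply: (lt_le_trans h).
  set k := Num.bound y; have : k%:R <= 4 ^+ k :> R by rewrite -natrX ler_nat ltnW// ltn_expl.
  have : 0 <= 4 ^+ k :> R by rewrite exprn_ge0.
  lra.
have := ex_minnP ex => -[K yK minK]; exists K; rewrite yK andbT.
case: K yK minK => [|K] _ minK; first by rewrite expr0 mulr1.
rewrite leNgt; apply/negP => h.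
have : (K.+1 <= K)%N by apply: minK; rewrite exprS in h; lra.
by rewrite ltnn.
Qed.

End coefficients.

(** * The largest admissible coefficient at each scale *)

Section level.
Variables (R : realType) (mu : R -> R).
Hypothesis mu_nonincreasing : forall l1 l2 : R,
  0 < l1 < 1 -> 0 < l2 < 1 -> l1 <= l2 -> mu l2 <= mu l1.
Hypothesis mu_sup : ereal_sup [set (l * mu l `^ (1 / 4))%:E | l in `]0, 1[] = +oo%E.
Hypothesis mu_ge0 : forall l : R, 0 < l < 1 -> 0 <= mu l.

(** If no [l] qualifies, the supremum of the empty set is 0 and the scale simply carries no
    bumps. *)
Definition level (K : nat) : R := sup [set l | 0 < l < 1 /\ 4 * 4 ^+ K <= mu l].

Let level_ub K : ubound [set l | 0 < l < 1 /\ 4 * 4 ^+ K <= mu l] 1.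
Proof. by move=> l [/andP[_ /ltW]]. Qed.

Lemma level_ge K l : 0 < l < 1 -> 4 * 4 ^+ K <= mu l -> l <= level K.
Proof. by move=> l01 lK; apply: ub_le_sup; [exists 1; exact: level_ub|]. Qed.

Lemma level_ge0 K : 0 <= level K.
Proof.
have [[l [l01 lK]]|E] := pselect ([set l | 0 < l < 1 /\ 4 * 4 ^+ K <= mu l] !=set0).
  by apply: le_trans (level_ge l01 lK); case/andP: l01 => /ltW.
by rewrite /level (_ : [set _ | _] = set0) ?sup0//; apply/eqP/negPn/negP => /set0P.
Qed.

Lemma level_le1 K : level K <= 1.
Proof.
have [ne|E] := pselect ([set l | 0 < l < 1 /\ 4 * 4 ^+ K <= mu l] !=set0).
  by apply: ge_sup => //; exact: level_ub.
by rewrite /level (_ : [set _ | _] = set0) ?sup0//; apply/eqP/negPn/negP => /set0P.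
Qed.

(** Monotonicity of [mu] makes the set of admissible [l] an initial segment of []0, 1[]; the
    inequality is strict as the supremum may not be attained. *)
Lemma level_gt K l : 0 < l < 1 -> l < level K -> 4 * 4 ^+ K <= mu l.
Proof.
move=> l01 lK.
have ne : [set l | 0 < l < 1 /\ 4 * 4 ^+ K <= mu l] !=set0.
  apply/set0P/negP => /eqP E; move: lK; rewrite /level E sup0.
  by case/andP: l01 => l0 _; rewrite ltNge (ltW l0).
have [l' [l'01 H] ll'] := sup_gt ne lK.
exact: le_trans H (mu_nonincreasing l01 l'01 (ltW ll')).
Qed.

(** For [l] with [l * mu l ^ (1/4)] large, bracket [mu l] between [4 * 4 ^ K] and [16 * 4 ^ K]: then
    [level K >= l] while [2 ^ K] exceeds a quarter of the square root of [mu l]. *)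
Lemma level_unbounded (G : R) : exists K, G < level K ^+ 2 * 2 ^+ K.
Proof.
(* Chosen so that [M ^ 2 / 4 = (1 + |G|) ^ 2] exceeds [G], and so that [M >= 2] forces [mu l >= 4],
   as the bracketing requires. *)
pose M := 2 * (1 + `|G|).
have : ((M%:E : \bar R) < ereal_sup [set (l * mu l `^ (1 / 4))%:E | l in `]0%R, 1%R[])%E.
  by rewrite mu_sup ltry.
move=> /ereal_sup_gt[_ [l l01 <-]]; rewrite lte_fin => Ml.
have {l01}l01 : 0 < l < 1 by move: l01; rewrite /= in_itv.
have m0 := mu_ge0 l01.
have M2 : 2 <= M by have := normr_ge0 G; rewrite /M; lra.
have Ml4 : M ^+ 4 < l ^+ 4 * mu l.
  have : M ^+ 4 < (l * mu l `^ (1 / 4)) ^+ 4 by rewrite ltr_pXn2r// ?nnegrE; lra.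
  rewrite [ltRHS]exprMn (_ : (mu l `^ (1 / 4)) ^+ 4 = mu l)//.
  by rewrite -powR_mulrn ?powR_ge0// -powRrM (_ : 1 / 4 * 4 = 1) ?powRr1//; field.
have l4 : l ^+ 4 <= 1 by case/andP: l01 => l0 l1; rewrite exprn_ile1 ?ltW.
have M4 : M ^+ 2 <= M ^+ 4 by rewrite ler_weXn2l//; lra.
have mu4 : 4 <= mu l.
  have : l ^+ 4 * mu l <= 1 * mu l by rewrite ler_wpM2r.
  have : 2 ^+ 2 <= M ^+ 2 by rewrite ler_sqr ?nnegrE//; lra.
  lra.
have [K /andP[K1 K2]] := power4_bracket mu4; exists K.
have lK := level_ge l01 K1.
set T := 2 ^+ K; have T0 : 0 < T by rewrite exprn_gt0.
have e4 : 4 ^+ K = T ^+ 2 :> R by rewrite /T exprAC; congr (_ ^+ _); ring.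
have l0 : 0 < l by case/andP: l01.
have lL4 : l ^+ 4 <= level K ^+ 4 by rewrite ler_pXn2r// nnegrE ?level_ge0// ltW.
have h : (M ^+ 2) ^+ 2 < (4 * (level K ^+ 2 * T)) ^+ 2.
  rewrite -exprM; apply: (lt_le_trans Ml4).
  apply: (@le_trans _ _ (level K ^+ 4 * (16 * T ^+ 2))); last first.
    by rewrite le_eqVlt; apply/orP; left; apply/eqP; ring.
  by apply: ler_pM => //; rewrite ?exprn_ge0 ?ltW// -e4.
have LT0 : 0 <= level K ^+ 2 * T by rewrite mulr_ge0 ?sqr_ge0 ?ltW.
have h2 : M ^+ 2 < 4 * (level K ^+ 2 * T).
  have LT4 : 0 <= 4 * (level K ^+ 2 * T) by lra.
  by rewrite -ltr_sqr ?nnegrE ?sqr_ge0.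
have gG := ler_norm G; have g0 := normr_ge0 G; move: h2; rewrite /M; nra.
Qed.

End level.

(** * The coefficients and their superlevel sets *)

Section counterexample.
Variables (R : realType) (n : nat) (r : R) (w : nat -> R).
Local Notation N := n.+1.
Local Notation D := (N + N)%N.
Local Notation i0 := (lshift N (ord0 : 'I_N)).
Local Notation i1 := (rshift N (ord0 : 'I_N)).
Local Notation J := (leb R D).
Local Notation rs K := (rudin_shapiro R K).1.

(** The scale is read off as the binary logarithm of [p], and [q] must lie in the same dyadic block.
    The positivity tests exclude 0, whose [trunc_log] is 0 by default. *)
Definition coef (p q : nat) : R :=
  let K := trunc_log 2 p in
  if [&& 0 < p, 0 < q & trunc_log 2 q == K]%N then
    w K * rs K.+1 (p - 2 ^ K + (q - 2 ^ K))%N * rs K (p - 2 ^ K)%N * rs K (q - 2 ^ K)%N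
  else 0.

Lemma rs_norm K i : `|rs K i| = 1.
Proof.
apply/eqP; rewrite -(@eqrXn2 _ 2)// ?normr_ge0// expr1n real_normK ?num_real//.
by rewrite rs_sqr.
Qed.

Lemma coef_le p q : 0 <= w (trunc_log 2 p) -> `|coef p q| <= w (trunc_log 2 p).
Proof.
move=> w0; rewrite /coef; case: ifP => _; last by rewrite normr0.
by rewrite !normrM !rs_norm !mulr1 ger0_norm.
Qed.

Lemma coef_neq0 p q : coef p q != 0 ->
  (p < 2 ^ (trunc_log 2 p).+1)%N && (q < 2 ^ (trunc_log 2 p).+1)%N.
Proof.
rewrite /coef; case: ifP => [/and3P[p0 q0 /eqP E] _|]; last by rewrite eqxx.
by rewrite trunc_log_ltn// -E trunc_log_ltn.
Qed.

Lemma coef_packet K (i j : 'I_(2 ^ K)) :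
  coef (2 ^ K + i)%N (2 ^ K + j)%N * rs K i * rs K j = w K * rs K.+1 (i + j)%N.
Proof.
have logE (k : 'I_(2 ^ K)) : trunc_log 2 (2 ^ K + k) = K.
  apply: trunc_log_eq => //; rewrite leq_addr/= expnS mul2n -addnn ltn_add2l.
  exact: ltn_ord.
have pos (k : 'I_(2 ^ K)) : (0 < 2 ^ K + k)%N by rewrite addn_gt0 expn_gt0.
have -> : coef (2 ^ K + i)%N (2 ^ K + j)%N = w K * rs K.+1 (i + j)%N * rs K i * rs K j.
  by rewrite /coef !logE eqxx !pos !addKn.
set u := rs K.+1 _.
rewrite (_ : _ * rs K i * rs K j = w K * u * (rs K i ^+ 2) * (rs K j ^+ 2)); last by ring.
by rewrite !rs_sqr !mulr1.
Qed.

(** Only the two active coordinates range over long sides. The offset [1 / 2] leaves room for the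
    bump radius around the integer centres. *)
Definition side (s : R) (i : 'I_D) : set R :=
  if (i == i0) || (i == i1) then `[- (1 / 2), s - 1 / 2]%classic else `[- (1 / 2), 1 / 2]%classic.

Lemma measurable_side s i : measurable (side s i).
Proof. by rewrite /side; case: ifP => _; exact: measurable_itv. Qed.

Lemma leb_side_box (s : R) : 0 <= s ->
  J [set z | forall i, side s i (z ord0 i)] = (s ^+ 2)%:E.
Proof.
move=> s0; rewrite (leb_box (measurable_side s)).
rewrite (eq_bigr (fun i => (if (i == i0) || (i == i1) then s else 1)%:E)); last first.
  move=> i _; rewrite /side; case: ifP => _; rewrite lebesgue_measure_itv/= lte_fin.
    case: ifPn => [_|]; first by rewrite -EFinD; congr EFin; ring.
    by rewrite -leNgt => h; congr EFin; lra.
  rewrite (_ : _ < _); last lra.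
  by rewrite -EFinD; congr EFin; field.
rewrite prodEFin big_split_ord; congr EFin; rewrite !big_ord_recl.
rewrite !big1 => [|i _|i _].
- by rewrite !eqxx eq_rlshift orbT/= !mulr1 expr2.
- by rewrite eq_rlshift eq_rshift.
- by rewrite eq_lshift eq_lrshift.
Qed.

Lemma itv_of_dist (t c s : R) : r <= 1 / 6 -> 0 <= c -> c + 1 <= s -> `|t - c| < r ->
  - (1 / 2) <= t <= s - 1 / 2.
Proof. by move=> r6 c0 cs; rewrite ltr_norml => /andP[tl tr]; apply/andP; split; lra. Qed.

(** Any scale [K] that reaches height [l] satisfies [2 ^ K.+1 <= Num.sqrt y], so all of them
    together fit in a single box with two sides [Num.sqrt y] and unit sides otherwise. *)
Lemma leb_superlevel k (M l y : R) : r <= 1 / 6 -> 0 < l -> 0 <= y -> (forall K, 0 <= w K) ->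
  (forall B z, `|bessel_op k (mult r B [::]) z| <=
    `|B (rnd ((z : 'rV[R]_D) ord0 i0)) (rnd (z ord0 i1))| * M) -> 0 <= M ->
  (forall K, l < w K * M -> 4 * 4 ^+ K <= y) ->
  (J [set z | (l < `|bessel_op k (mult r coef [::]) z|)%R] <= y%:E)%E.
Proof.
move=> r6 l0 y0 w0 HM M0 wy.
rewrite -[y]sqr_sqrtr// -leb_side_box ?sqrtr_ge0//.
apply: le_measure; rewrite ?inE.
- have mh : measurable_fun setT (fun z : 'rV[R]_D => `|bessel_op k (mult r coef [::]) z|).
    apply: measurableT_comp => //.
    by apply: continuous_measurable_rV; exact: continuous_bessel_op_mult.
  rewrite (_ : [set z | _] = (fun z : 'rV[R]_D => `|bessel_op k (mult r coef [::]) z|) @^-1` `]l, +oo[%classic).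
    by rewrite -[X in measurable X]setTI; apply: mh => //; exact: measurable_itv.
  by apply/funext => z /=; rewrite in_itv/= andbT.
- exact: (measurable_box (measurable_side (Num.sqrt y))).
move=> z /= lz i.
have hz : bessel_op k (mult r coef [::]) z != 0.
  by apply: contraTneq lz => ->; rewrite normr0 -leNgt ltW.
have := bessel_op_mult_neq0 r6 hz i.
set p := rnd (z ord0 i0); set q := rnd (z ord0 i1).
have lt_l : l < `|coef p q| * M by exact: lt_le_trans lz (HM _ _).
have pq0 : coef p q != 0.
  by apply: contraTneq lt_l => ->; rewrite normr0 mul0r -leNgt ltW.
set K := trunc_log 2 p.
have /wy yK : l < w K * M by apply: (lt_le_trans lt_l); rewrite ler_wpM2r// coef_le.
have /andP[pK qK] := coef_neq0 pq0.
have sK : 2 ^+ K.+1 <= Num.sqrt y.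
  rewrite -[leLHS]ger0_norm ?exprn_ge0// -sqrtr_sqr ler_wsqrtr//; apply: le_trans yK.
  by rewrite exprAC -exprS (_ : 2 ^+ 2 = 4)//; ring.
have lt_nat (t : nat) : (t < 2 ^ K.+1)%N -> t%:R + 1 <= Num.sqrt y.
  by move=> tK; apply: le_trans sK; rewrite natr1 -natrX ler_nat.
rewrite /side; case: ifPn => [/orP[/eqP ->|/eqP ->]|ni]; rewrite /= in_itv/=.
- by rewrite cen0; apply: itv_of_dist => //; exact: lt_nat.
- by rewrite cen1; apply: itv_of_dist => //; exact: lt_nat.
rewrite mxE; move: ni; rewrite negb_or => /andP[/negPf-> /negPf->] zi.
(* In the inactive coordinates the centre is 0 and the side is [0 + 1]. *)
have := itv_of_dist r6 (lexx 0) (lexx (0 + 1)) zi.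
by rewrite (_ : 0 + 1 - 1 / 2 = 1 / 2)//; field.
Qed.

End counterexample.

Theorem theorem1p2 (R : realType) (n : nat) (hn : (0 < n)%N) (mu : R -> R)
  (mu_ge0 : forall l : R, 0 < l < 1 -> 0 <= mu l)
  (mu_nonincreasing : forall l1 l2 : R,
    0 < l1 < 1 -> 0 < l2 < 1 -> l1 <= l2 -> mu l2 <= mu l1)
  (mu_sup : ereal_sup [set (l * mu l `^ (1 / 4))%:E | l in `]0, 1[] = +oo%E)
  (s : nat) (s_gt0 : (0 < s)%N) (s_even : ~~ odd s) :
  exists m h : 'rV[R]_(n + n) -> R[i],
    [/\ smoothC m,
        bounded_pderivs m,
        bessel s%:R m h,
        forall l : R, 0 < l < 1 ->
          (leb R (n + n) [set x | (l < normc (h x))%R] <= (mu l)%:E)%E &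
        unbounded_L2L2L1 m].
Proof.
case: n hn => [//|n] _.
have -> : s = (s./2).*2 by rewrite -[LHS]odd_double_half (negPf s_even).
set k := s./2.
(* The radius for which [trig_box_lower] holds in dimension [n.+1]; it also meets the separation
   bound [1 / 6]. *)
pose r : R := (16 * n.+1%:R)^-1.
have N0 : 0 < n.+1%:R :> R by rewrite ltr0n.
have r0 : 0 < r by rewrite invr_gt0 mulr_gt0.
have rN : 16 * (r * n.+1%:R) <= 1 by rewrite mulrCA mulVf// mulf_neq0// gt_eqF.
have r6 : r <= 1 / 6 := radius_le6 r0 rN.
have [M [M0 HM]] := bessel_op_mult_bound n r6 k.
have M1 : 0 < M + 1 by rewrite ltr_wpDl.
(* Compensates the constant [M] of the differential operator; adding 1 keeps the divisor positive
   when [M] is 0. *)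
pose w K : R := level mu K / (M + 1).
have w0 K : 0 <= w K by rewrite divr_ge0 ?level_ge0// ltW.
have wM K : w K * M <= level mu K.
  by rewrite -mulrA ler_piMr ?level_ge0// mulrC ler_pdivrMr// mul1r lerDl ler01.
pose A := coef w.
pose a := (M + 1)^-1; have a0 : 0 <= a by rewrite invr_ge0 ltW.
have Aa p q : `|A p q| <= a.
  apply: le_trans (coef_le _ (w0 _)) _; rewrite /w -[leRHS]mul1r.
  by rewrite ler_wpM2r ?level_le1.
have HA (z : 'rV[R]_(n.+1 + n.+1)) : `|bessel_op k (mult r A [::]) z| <= a * M.
  by apply: (le_trans (HM A z)); rewrite ler_wpM2r.
have [M' HM'] := mult_bound (n := n) r [::].
exists (fun z : 'rV[R]_(n.+1 + n.+1) => (mult r A [::] z)%:C),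
  (fun z : 'rV[R]_(n.+1 + n.+1) => (bessel_op k (mult r A [::]) z)%:C).
split.
- apply: smoothC_real; exact: smooth_mult.
- move=> t; have [B HB] := mult_bound (n := n) r t; exists (a * `|B|) => z.
  rewrite pderivC_real normc_real (pderiv_mult r6); apply: (le_trans (HB A z)).
  apply: (le_trans (ler_wpM2l (normr_ge0 _) (ler_norm B))); rewrite ler_wpM2r//.
- apply: (@bessel_real _ _ _ _ _ (Num.max (a * `|M'|) (a * M))).
  + exact: continuous_mult.
  + exact: continuous_bessel_op_mult.
  + move=> z; rewrite le_max; apply/orP; left; apply: (le_trans (HM' A z)).
    by apply: (le_trans (ler_wpM2l (normr_ge0 _) (ler_norm M'))); rewrite ler_wpM2r.
  + by move=> z; rewrite le_max HA orbT.
  + by move=> c f Sf; exact: (bessel_op_trig r6 Aa).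
- move=> l l01; have /andP[l0 _] := l01.
  under eq_set do rewrite normc_real.
  apply: (leb_superlevel r6 l0 (mu_ge0 l l01) w0 HM M0) => K lK.
  by apply: (level_gt mu_nonincreasing l01); exact: lt_le_trans lK (wM K).
move=> [c bound].
have [G HG] := packet_unbounded r0 rN w0 (coef_packet w) bound.
(* The factor [(M + 1) ^+ 2] undoes the normalisation of [w]. *)
have [K] := level_unbounded mu_sup mu_ge0 (G * (M + 1) ^+ 2).
rewrite ltNge => /negP; apply.
by have := HG K; rewrite /w expr_div_n mulrAC ler_pdivrMr ?exprn_gt0.
Qed.
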